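(* Let $f(z)=(z-\alpha_1)^{n_1}\cdots(z-\alpha_s)^{n_s}\in\mathbb{C}[z]$, where $s\ge 2$, $\alpha_1,\dots,\alpha_s$ are distinct complex numbers and $n_1,\dots,n_s$ are positive integers. Let $A=\{\alpha_1,\dots,\alpha_s\}$, let $B=\{\beta_1,\dots,\beta_p\}$ be the set of distinct zeros of $f'$ not in $A$ (the zeros of $f'/f$), and let $m_j$ be the multiplicity of $\beta_j$ as a zero of $f'$ for $j=1,\dots,p$, so that $m_1+\cdots+m_p=s-1$. For each $j=1,\dots,p$, there are exactly $m_j+1$ paths of steepest descent for $|f|$ issued from $\beta_j$ in a small neighborhood of $\beta_j$; continue each of them until it first reaches another point of $A\cup B$. This gives a total of $\sum_{j=1}^p(m_j+1)=s+p-1$ paths, each going from a point of $B$ to a point of $A\cup B$. These paths intersect only at their end-points, and the graph with vertex set $A\cup B$ whose edges are these paths is a tree (a connected graph with no cycle).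
   Context: A path of steepest descent for $|f|$ is a continuous piecewise differentiable curve $\gamma\colon I\to\mathbb{C}$, defined on an interval $I$ of $\mathbb{R}$, which is an integral curve for the gradient of $|f|$, and along which $|f|$ is decreasing. Such curves are considered up to reparametrization, and they may start, pass through or end at zeros of $f'$ and end at zeros of $f$; the gradient condition applies away from the zeros of $f$ and $f'$. In the graph, each path is an edge joining its starting point and its end-point. *)

(* Defs.v *)
From mathcomp Require Import all_boot all_order all_algebra.
From mathcomp Require Import all_classical all_reals all_analysis.
From mathcomp.real_closed Require Import complex.

Set Implicit Arguments.
Unset Strict Implicit.
Unset Printing Implicit Defensive.

Import Order.TTheory GRing.Theory Num.Theory.
Import numFieldNormedType.Exports.

Local Open Scope classical_set_scope.
Local Open Scope ring_scope.
Local Open Scope complex_scope.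

(* The modulus of z as an element of R: the norm of the numDomainType R[i]
   takes its values in R[i]. *)
Definition modulus (R : realType) (z : R[i]) : R := ComplexField.Normc.normc z.

(* R[i] is identified with R^2, so continuity, derivatives and gradients are
   taken componentwise. *)
Definition gradient_modulus (R : realType) (f : {poly R[i]}) (z : R[i]) : R[i] :=
  derive1 (fun x : R => modulus f.[x +i* complex.Im z]) (complex.Re z)
  +i* derive1 (fun y : R => modulus f.[complex.Re z +i* y]) (complex.Im z).

Definition re_part (R : realType) (g : R -> R[i]) (t : R) : R := complex.Re (g t).
Definition im_part (R : realType) (g : R -> R[i]) (t : R) : R := complex.Im (g t).

Definition velocity (R : realType) (g : R -> R[i]) (t : R) : R[i] :=
  derive1 (re_part g) t +i* derive1 (im_part g) t.

(* S is the set of break points of the piecewise differentiable curve g. The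
   positive factor lam, which may depend on t, accounts for the
   reparametrization of an integral curve of the (downward) gradient; in the
   natural parametrization it would take infinite time to leave or reach a zero
   of f'. *)
Definition steepest_descent (R : realType) (f : {poly R[i]}) (I : interval R)
    (g : R -> R[i]) : Prop :=
  [/\ {within [set` I], continuous (re_part g)},
      {within [set` I], continuous (im_part g)},
      exists S : seq R, forall t, interior [set` I] t -> t \notin S ->
        [/\ derivable (re_part g) t 1, derivable (im_part g) t 1 &
            f.[g t] != 0 -> f^`().[g t] != 0 ->
            exists2 lam : R, 0 < lam &
              velocity g t = - (lam%:C * gradient_modulus f (g t))] &
      {in I &, forall t u, t < u -> modulus f.[g u] < modulus f.[g t]}].

(* A curve on the compact interval [lo, hi]; only the values of the underlying
   function on that interval are meaningful. *)
Record curve (R : realType) := Curve { lo : R; hi : R; at_time :> R -> R[i] }.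

Definition dom (R : realType) (c : curve R) : interval R := `[lo c, hi c].

Definition source (R : realType) (c : curve R) : R[i] := c (lo c).
Definition target (R : realType) (c : curve R) : R[i] := c (hi c).

Definition descent_path (R : realType) (f : {poly R[i]}) (c : curve R) : Prop :=
  lo c < hi c /\ steepest_descent f (dom c) c.

Definition same_path (R : realType) (c d : curve R) : Prop :=
  exists phi : R -> R,
    [/\ {within [set` dom c], continuous phi},
        {in dom c &, {homo phi : t u / t < u}},
        phi (lo c) = lo d, phi (hi c) = hi d &
        {in dom c, forall t, c t = d (phi t)}].

Definition initial_part (R : realType) (c d : curve R) : Prop :=
  exists2 u : R, lo d < u <= hi d & same_path c (Curve (lo d) u d).

Definition issued_in_disc (R : realType) (f : {poly R[i]}) (z : R[i]) (r : R)
    (c : curve R) : Prop :=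
  [/\ descent_path f c, source c = z &
      forall t, lo c <= t < hi c -> modulus (c t - z) < r].

(* g lists, without repetition up to reparametrization, the paths of steepest
   descent issued from z in the disc of centre z and radius r, each followed
   until it leaves the disc. *)
Definition paths_in_disc (R : realType) (f : {poly R[i]}) (z : R[i]) (r : R)
    (n : nat) (g : 'I_n -> curve R) : Prop :=
  (forall k, issued_in_disc f z r (g k) /\ modulus (target (g k) - z) = r) /\
  (forall c, issued_in_disc f z r c -> exists! k, initial_part c (g k)).

(* d continues c until it first reaches a point of V other than its source
   (which it cannot meet again, the modulus of f being strictly decreasing). *)
Definition continuation (R : realType) (f : {poly R[i]}) (V : set R[i])
    (c d : curve R) : Prop :=
  [/\ descent_path f d, initial_part c d,
      forall t, lo d < t < hi d -> ~ V (d t) & V (target d)].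

Definition meet_only_at_ends (R : realType) (c d : curve R) : Prop :=
  forall t u, t \in dom c -> u \in dom d -> c t = d u ->
    (t = lo c \/ t = hi c) /\ (u = lo d \/ u = hi d).

(* A multigraph with vertices V and edges E, the edge e having the ends src e
   and tgt e; loops and parallel edges are allowed. *)
Definition joins (V E : finType) (src tgt : E -> V) (e : E) : rel V :=
  fun x y => ((src e == x) && (tgt e == y)) || ((src e == y) && (tgt e == x)).

Definition adjacent (V E : finType) (src tgt : E -> V) : rel V :=
  fun x y => [exists e, joins src tgt e x y].

(* [:: (v0, e0); ...; (vk, ek)] is a cycle if ei joins vi to v(i+1) and ek joins
   vk to v0; a loop is a cycle of length 1, two parallel edges one of length 2. *)
Definition graph_cycle (V E : finType) (src tgt : E -> V) (w : seq (V * E)) : bool :=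
  [&& w != [::], uniq (unzip1 w), uniq (unzip2 w) &
      cycle (fun x y : V * E => joins src tgt x.2 x.1 y.1) w].

Definition is_tree (V E : finType) (src tgt : E -> V) : Prop :=
  (forall x y, connect (adjacent src tgt) x y) /\
  (forall w, ~~ graph_cycle src tgt w).

Definition vertex (R : realType) (s p : nat) (alpha : 'I_s -> R[i])
    (beta : 'I_p -> R[i]) (v : 'I_s + 'I_p) : R[i] :=
  match v with inl i => alpha i | inr j => beta j end.

(* Main.v *)
(** If c is a path of steepest descent, the derivative of f o c is a nonpositive
    multiple of f o c.  Up to reparametrization, c is therefore a continuous lift
    L of a ray: f (L t) = (1 - t) f (L 0).  Lifts exist and are unique away from
    the zeros of f'.  Near a zero z0 of f' of multiplicity m, f takes each other
    value close to f (z0) exactly m + 1 times, which gives m + 1 germs of lifts; two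
    edges with a common interior point coincide, as one sees by lifting
    backwards.  Every z descends to points of A and B, and the component of the
    graph that contains them is a locally constant function of z, hence constant:
    the graph is connected.  Having one edge less than vertices, it is a tree. *)

Require Import Defs.
From mathcomp Require Import all_boot all_order all_algebra.
From mathcomp Require Import all_classical all_reals all_analysis.
From mathcomp.real_closed Require Import complex.
From mathcomp Require Import ring lra.

Set Implicit Arguments.
Unset Strict Implicit.
Unset Printing Implicit Defensive.

Import Order.TTheory GRing.Theory Num.Theory.
Import numFieldNormedType.Exports.

Local Open Scope classical_set_scope.
Local Open Scope ring_scope.

(** * Modulus, real induction and continuity *)

(** The local theory rests on one factorization: the modulus of the monic polynomial [f - w] at [x]
    is the product of the distances from [x] to its roots, so a small value forces a root nearby.
    This produces preimages close to a given point, keeps curves trapped near a point of a fiber and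
    makes lifts converge at the end of their interval, in place of Rouche's theorem and of the
    inverse function theorem. On a lift of a ray the time is determined by |f|, so two lifts of one
    ray that are the same path are equal as functions: reparametrizations disappear. Uniqueness of
    lifts fails at the zeros of f', hence edges issued from such a zero are compared at a small
    positive time, never at time 0. For connectedness, the obstacle is that the end of a descent
    jumps when the starting point crosses a path leading to a critical point. What does not jump is
    the class of this end for an equivalence relation containing the edges. Near a point where f is
    nonzero, this follows from the same property at points of smaller |f|; compactness of the
    sublevel sets turns this into an induction. *)

Lemma modulusE (R : realType) (z : R[i]) :
  modulus z = Num.sqrt (complex.Re z ^+ 2 + complex.Im z ^+ 2).
Proof. by case: z. Qed.

Lemma sqr_modulus (R : realType) (z : R[i]) :
  modulus z ^+ 2 = complex.Re z ^+ 2 + complex.Im z ^+ 2.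
Proof. by rewrite modulusE sqr_sqrtr // addr_ge0 ?sqr_ge0. Qed.

Lemma modulus_ge0 (R : realType) (z : R[i]) : 0 <= modulus z.
Proof. by rewrite modulusE sqrtr_ge0. Qed.

Lemma modulus0 (R : realType) : modulus (0 : R[i]) = 0.
Proof. exact: ComplexField.Normc.normc0. Qed.

Lemma modulus1 (R : realType) : modulus (1 : R[i]) = 1.
Proof. exact: ComplexField.Normc.normc1. Qed.

Lemma modulus_eq0 (R : realType) (z : R[i]) : (modulus z == 0) = (z == 0).
Proof.
apply/eqP/eqP => [|->]; last exact: modulus0.
exact: ComplexField.Normc.eq0_normc.
Qed.

Lemma modulus_gt0 (R : realType) (z : R[i]) : (0 < modulus z) = (z != 0).
Proof. by rewrite lt_neqAle modulus_ge0 andbT eq_sym modulus_eq0. Qed.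

Lemma modulusM (R : realType) (x y : R[i]) : modulus (x * y) = modulus x * modulus y.
Proof. exact: ComplexField.Normc.normcM. Qed.

Lemma modulusV (R : realType) (x : R[i]) : modulus x^-1 = (modulus x)^-1.
Proof. exact: ComplexField.Normc.normcV. Qed.

Lemma modulusX (R : realType) (x : R[i]) k : modulus (x ^+ k) = modulus x ^+ k.
Proof.
elim: k => [|k IH]; first by rewrite !expr0 modulus1.
by rewrite !exprS modulusM IH.
Qed.

Lemma modulus_triangle (R : realType) (x y : R[i]) :
  modulus (x + y) <= modulus x + modulus y.
Proof. exact: le_normcD. Qed.

Lemma modulusN (R : realType) (x : R[i]) : modulus (- x) = modulus x.
Proof. by rewrite !modulusE; case: x => a b /=; rewrite !sqrrN. Qed.

Lemma modulusB (R : realType) (x y : R[i]) : modulus (x - y) = modulus (y - x).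
Proof. by rewrite -modulusN opprB. Qed.

Lemma modulus_dist (R : realType) (y x z : R[i]) :
  modulus (x - z) <= modulus (x - y) + modulus (y - z).
Proof. by apply: le_trans (modulus_triangle _ _); rewrite addrA subrK. Qed.

Lemma modulus_sub_le (R : realType) (x y : R[i]) :
  `|modulus x - modulus y| <= modulus (x - y).
Proof.
have h a b : modulus a - modulus b <= modulus (a - b) :> R.
  by rewrite lerBlDr -{1}(subrK b a) modulus_triangle.
by rewrite ler_norml h lerNl opprB modulusB h.
Qed.

Lemma Re_le_modulus (R : realType) (z : R[i]) : `|complex.Re z| <= modulus z.
Proof. by rewrite -sqrtr_sqr modulusE ler_wsqrtr // lerDl sqr_ge0. Qed.

Lemma Im_le_modulus (R : realType) (z : R[i]) : `|complex.Im z| <= modulus z.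
Proof. by rewrite -sqrtr_sqr modulusE ler_wsqrtr // lerDr sqr_ge0. Qed.

Lemma modulus_le_ReIm (R : realType) (z : R[i]) :
  modulus z <= `|complex.Re z| + `|complex.Im z|.
Proof.
rewrite -(@ler_pXn2r R 2) ?nnegrE ?modulus_ge0 ?addr_ge0 //.
rewrite sqr_modulus sqrrD -!normrX !(ger0_norm (sqr_ge0 _)).
have := mulr_ge0 (normr_ge0 (complex.Re z)) (normr_ge0 (complex.Im z)).
lra.
Qed.

Lemma modulus_real (R : realType) (x : R) : modulus x%:C%C = `|x|.
Proof. by rewrite modulusE /= expr0n addr0 sqrtr_sqr. Qed.

Lemma modulus_sum (R : realType) (I : Type) (r : seq I) (F : I -> R[i]) :
  modulus (\sum_(i <- r) F i) <= \sum_(i <- r) modulus (F i).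
Proof.
elim: r => [|i r IH]; first by rewrite !big_nil modulus0.
by rewrite !big_cons (le_trans (modulus_triangle _ _)) // lerD2l.
Qed.

Lemma modulus_prod (R : realType) (I : Type) (r : seq I) (F : I -> R[i]) :
  modulus (\prod_(i <- r) F i) = \prod_(i <- r) modulus (F i).
Proof.
elim: r => [|i r IH]; first by rewrite !big_nil modulus1.
by rewrite !big_cons modulusM IH.
Qed.

Lemma modulus_small_eq (R : realType) (x y : R[i]) :
  (forall e, 0 < e -> modulus (x - y) < e) -> x = y.
Proof.
move=> h; apply/eqP; rewrite -subr_eq0 -modulus_eq0; apply/negPn/negP => n0.
have p0 : 0 < modulus (x - y) by rewrite lt_neqAle eq_sym n0 modulus_ge0.
by have := h _ p0; rewrite ltxx.
Qed.

(** Let [s] be the supremum of the [t] such that [P] holds on [a, t]. The limit hypothesis gives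
    [P s], and the step hypothesis would pass beyond [s] if [s < b]. *)
Lemma real_induction (R : realType) (a b : R) (P : R -> Prop) :
  a <= b -> P a ->
  (forall t, a <= t < b -> (forall u, a <= u <= t -> P u) ->
     exists2 d, 0 < d & forall u, t < u <= b -> u < t + d -> P u) ->
  (forall t, a < t <= b -> (forall u, a <= u < t -> P u) -> P t) ->
  forall t, a <= t <= b -> P t.
Proof.
move=> ab Pa step lim.
pose S := [set t | a <= t <= b /\ forall u, a <= u <= t -> P u].
have Sa : S a.
  split; first by rewrite lexx.
  by move=> u /andP[h1 h2]; have -> : u = a by apply/eqP; rewrite eq_le h1 h2.
have Sb : has_sup S by split; [exists a|exists b => t [/andP[]]].
set s := sup S.
have as_ : a <= s by apply: ub_le_sup => //; exact: (proj2 Sb).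
have sb : s <= b by apply: ge_sup; [exists a|move=> t [/andP[]]].
have below u : a <= u < s -> P u.
  move=> /andP[au us]; have [|t [_ Pt] ut] := sup_gt _ us; first by exists a.
  by apply: Pt; rewrite au ltW.
have Ps u : a <= u <= s -> P u.
  move=> /andP[au]; rewrite le_eqVlt => /orP[/eqP ->|us]; last first.
    by apply: below; rewrite au.
  move: as_; rewrite le_eqVlt => /orP[/eqP <- //|as_].
  by apply: lim => //; rewrite as_.
suff sbE : s = b by rewrite -sbE.
apply/eqP; rewrite eq_le sb /= leNgt; apply/negP => ltsb.
have [|d d0 Pd] := step s _ Ps; first by rewrite as_.
pose v := Num.min b (s + d / 2).
have sv : s < v by rewrite /v lt_min ltsb ltrDl divr_gt0.
have vb : v <= b by rewrite /v ge_min lexx.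
have vd : v < s + d.
  by rewrite /v gt_min ltrD2l; apply/orP; right; lra.
have Sv : S v.
  split; first by rewrite vb andbT (le_trans as_) // ltW.
  move=> u /andP[au uv]; case: (lerP u s) => us; first by apply: Ps; rewrite au.
  by apply: Pd; [rewrite us (le_trans uv)|exact: le_lt_trans vd].
have : v <= s by apply: ub_le_sup => //; exact: (proj2 Sb).
by rewrite leNgt sv.
Qed.

(** This form, relative to [a, b], makes it easy to restrict, glue and reverse curves; [ccontP]
    relates it to the continuity of both coordinates. *)
Definition ccont (R : realType) (a b : R) (L : R -> R[i]) :=
  forall t, a <= t <= b -> forall e, 0 < e ->
  exists2 d, 0 < d & forall u, a <= u <= b -> `|u - t| < d -> modulus (L u - L t) < e.

Lemma ccont_sub (R : realType) (a b a' b' : R) (L : R -> R[i]) :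
  a <= a' -> b' <= b -> ccont a b L -> ccont a' b' L.
Proof.
move=> aa bb cL t /andP[t1 t2] e e0.
have [|d d0 Hd] := cL t _ e e0; first by rewrite (le_trans aa) // (le_trans t2).
exists d => // u /andP[u1 u2] ut; apply: Hd => //.
by rewrite (le_trans aa) // (le_trans u2).
Qed.

Lemma eq_ccont (R : realType) (a b : R) (L M : R -> R[i]) :
  (forall t, a <= t <= b -> L t = M t) -> ccont a b L -> ccont a b M.
Proof.
move=> LM cL t tab e e0; have [d d0 Hd] := cL t tab e e0.
by exists d => // u uab ut; rewrite -!LM //; exact: Hd.
Qed.

Lemma ccont_glue (R : realType) (a b c : R) (L : R -> R[i]) :
  a <= b <= c -> ccont a b L -> ccont b c L -> ccont a c L.
Proof.
move=> /andP[ab bc] c1 c2 t /andP[t1 t2] e e0.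
case: (ltgtP t b) => tb.
- have [|d d0 Hd] := c1 t _ e e0; first by rewrite t1 ltW.
  exists (Num.min d (b - t)); first by rewrite lt_min d0 subr_gt0.
  move=> u /andP[u1 u2]; rewrite lt_min => /andP[ud ub].
  apply: Hd => //; rewrite u1 /=.
  by move: ub; rewrite ltr_norml => /andP[_]; lra.
- have [|d d0 Hd] := c2 t _ e e0; first by rewrite t2 ltW.
  exists (Num.min d (t - b)); first by rewrite lt_min d0 subr_gt0.
  move=> u /andP[u1 u2]; rewrite lt_min => /andP[ud ub].
  apply: Hd => //; rewrite u2 andbT.
  by move: ub; rewrite ltr_norml => /andP[]; lra.
- have [|d d0 Hd] := c1 t _ e e0; first by rewrite t1 tb lexx.
  have [|d' d0' Hd'] := c2 t _ e e0; first by rewrite t2 tb lexx.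
  exists (Num.min d d'); first by rewrite lt_min d0.
  move=> u /andP[u1 u2]; rewrite lt_min => /andP[ud ud'].
  case: (lerP u b) => ub; first by apply: Hd => //; rewrite u1.
  by apply: Hd' => //; rewrite u2 ltW.
Qed.

Lemma ccont_opp (R : realType) (a b : R) (L : R -> R[i]) :
  ccont a b L -> ccont (- b) (- a) (fun t => L (- t)).
Proof.
move=> cL t tab e e0; have [|d d0 Hd] := cL (- t) _ e e0; first lra.
exists d => // u uab ut; apply: Hd; first lra.
by rewrite -opprD normrN.
Qed.

Lemma ccont_eq_at_end (R : realType) (a b : R) (L M : R -> R[i]) :
  a < b -> ccont a b L -> ccont a b M ->
  (forall t, a <= t < b -> L t = M t) -> L b = M b.
Proof.
move=> ab cL cM LM; apply: modulus_small_eq => e e0.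
have e2 : 0 < e / 2 by lra.
have bab : a <= b <= b by rewrite lexx ltW.
have [d d0 Hd] := cL b bab _ e2.
have [d' d0' Hd'] := cM b bab _ e2.
pose m := Num.min (b - a) (Num.min d d').
have m0 : 0 < m by rewrite !lt_min subr_gt0 ab d0.
have [ma md md'] : [/\ m <= b - a, m <= d & m <= d'].
  by split; rewrite /m !ge_min lexx ?orbT.
pose u := b - m / 2.
have ub : a <= u < b by rewrite /u; lra.
have uab : a <= u <= b by lra.
have ud : `|u - b| < m by rewrite /u ltr_norml; lra.
have := Hd u uab (lt_le_trans ud md); have := Hd' u uab (lt_le_trans ud md').
rewrite (LM u ub) => h1; rewrite modulusB => h2.
by have := modulus_dist (M u) (L b) (M b); lra.
Qed.

Lemma ccont_poly (R : realType) (p : {poly R[i]}) (z : R[i]) (e : R) : 0 < e ->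
  exists2 d, 0 < d & forall x, modulus (x - z) < d -> modulus (p.[x] - p.[z]) < e.
Proof.
elim/poly_ind: p e => [|p c IH] e e0.
  by exists 1 => // x _; rewrite !horner0 subrr modulus0.
(* [A] bounds the modulus on the disc of radius 1 about [z]; the 1 in [B] keeps this divisor
   positive. *)
pose A := modulus z + 1; pose B := modulus p.[z] + 1.
have A0 : 0 < A by rewrite /A; have := modulus_ge0 z; lra.
have B0 : 0 < B by rewrite /B; have := modulus_ge0 p.[z]; lra.
have [d d0 Hd] := IH (e / 2 / A) (divr_gt0 (divr_gt0 e0 (ltr0Sn R 1)) A0).
pose m := Num.min d (Num.min 1 (e / 2 / B)).
exists m; first by rewrite !lt_min d0 ltr01 !divr_gt0.
move=> x; rewrite !lt_min => /and3P[xd x1 xB].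
rewrite !hornerMXaddC.
have -> : p.[x] * x + c - (p.[z] * z + c) = (p.[x] - p.[z]) * x + p.[z] * (x - z).
  by ring.
have xA : modulus x <= A.
  by rewrite -[x](subrK z) (le_trans (modulus_triangle _ _)) // /A addrC lerD2l ltW.
apply: le_lt_trans (modulus_triangle _ _) _; rewrite !modulusM.
have h1 : modulus (p.[x] - p.[z]) * modulus x <= e / 2.
  rewrite -[leRHS](@mulfVK _ A) ?gt_eqF // -mulrA -/A.
  rewrite mulrA ler_pM ?modulus_ge0 // ltW //; exact: Hd.
have h2 : modulus p.[z] * modulus (x - z) < e / 2.
  have: modulus (x - z) * B < e / 2 by rewrite -ltr_pdivlMr.
  apply: le_lt_trans; rewrite mulrC ler_wpM2l ?modulus_ge0 // /B lerDl ler01.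
  by [].
lra.
Qed.

Lemma ccont_horner (R : realType) (p : {poly R[i]}) (a b : R) (L : R -> R[i]) :
  ccont a b L -> ccont a b (fun t => p.[L t]).
Proof.
move=> cL t tab e e0; have [r r0 Hr] := ccont_poly p (L t) e0.
have [d d0 Hd] := cL t tab r r0.
by exists d => // u uab ut; apply/Hr/Hd.
Qed.

(** A continuous curve cannot leave a disc without meeting its circle. *)
Lemma ccont_stays_inside (R : realType) (a b rho : R) (L : R -> R[i]) (z : R[i]) :
  ccont a b L -> modulus (L a - z) < rho ->
  (forall t, a <= t <= b -> modulus (L t - z) <> rho) ->
  forall t, a <= t <= b -> modulus (L t - z) < rho.
Proof.
move=> cL La Lne t0 t0ab; have ab : a <= b by lra.
apply: (real_induction (P := fun t => modulus (L t - z) < rho) ab) t0ab => //.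
  move=> t /andP[at_ tb] Pt; have tab : a <= t <= b by lra.
  have h : 0 < rho - modulus (L t - z) by rewrite subr_gt0; apply: Pt; lra.
  have [d d0 Hd] := cL t tab _ h.
  exists d => // u uab ud; have := Hd u.
  rewrite ltr_norml => H; have := modulus_dist (L t) (L u) z.
  have : modulus (L u - L t) < rho - modulus (L t - z) by apply: H; lra.
  lra.
move=> t tab Pt; have tab' : a <= t <= b by lra.
case: (ltgtP (modulus (L t - z)) rho) => // [h|/(Lne _ tab')//].
have h' : 0 < modulus (L t - z) - rho by rewrite subr_gt0.
have [d d0 Hd] := cL t tab' _ h'.
pose m := Num.min d (t - a).
have [md ma] : m <= d /\ m <= t - a by split; rewrite /m ge_min lexx ?orbT.
have m0 : 0 < m by rewrite lt_min d0; lra.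
pose u := t - m / 2.
have h1 : modulus (L u - L t) < modulus (L t - z) - rho.
  by apply: Hd; rewrite /u ?ltr_norml; lra.
have h2 : modulus (L u - z) < rho by apply: Pt; rewrite /u; lra.
have := modulus_dist (L u) (L t) z; rewrite (modulusB (L t) (L u)).
lra.
Qed.

(** * Points of a fiber of a polynomial *)

Lemma seq_pos_min (R : realType) (T : eqType) (s : seq T) (g : T -> R) :
  (forall x, x \in s -> 0 < g x) ->
  exists2 r : R, 0 < r & forall x, x \in s -> r <= g x.
Proof.
elim: s => [|x s IH] gpos; first by exists 1.
have [|r r0 Hr] := IH; first by move=> y ys; apply: gpos; rewrite inE ys orbT.
exists (Num.min (g x) r); first by rewrite lt_min r0 gpos ?mem_head.
by move=> y; rewrite inE ge_min => /orP[/eqP ->|/Hr ->]; rewrite ?lexx ?orbT.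
Qed.

(** The factor 2 makes the open discs of radius [r] about the points disjoint. *)
Lemma seq_separated (R : realType) (s : seq R[i]) :
  exists2 r : R, 0 < r & forall y y', y \in s -> y' \in s -> y != y' ->
    2 * r <= modulus (y - y').
Proof.
pose P := [seq q <- [seq (y, y') | y <- s, y' <- s] | q.1 != q.2].
have [|r r0 Hr] := @seq_pos_min R _ P (fun q => modulus (q.1 - q.2) / 2).
  move=> q; rewrite mem_filter => /andP[q12 _].
  by rewrite divr_gt0 // modulus_gt0 subr_eq0.
exists r => // y y' ys ys' yy'.
have := Hr (y, y'); rewrite mem_filter /= yy' allpairs_f // => /(_ isT).
lra.
Qed.

Lemma monic_split (R : realType) (p : {poly R[i]}) : p \is monic ->
  exists rs : seq R[i], p = \prod_(z <- rs) ('X - z%:P).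
Proof.
move=> /monicP pm; have [rs] := closed_field_poly_normal p.
by rewrite pm scale1r => ->; exists rs.
Qed.

(** If every root were at distance at least [e] from [x], the product of these distances, which is
    the modulus of [p.[x]], would be at least [e] to the degree. *)
Lemma monic_near_root (R : realType) (p : {poly R[i]}) (x : R[i]) (e : R) :
  p \is monic -> 0 < e -> modulus p.[x] < e ^+ (size p).-1 ->
  exists2 z, root p z & modulus (x - z) < e.
Proof.
move=> /monic_split[rs ->] e0.
rewrite size_prod_XsubC /= horner_prod modulus_prod => lt_e.
have [/hasP[z zrs ze]|/hasPn far] := boolP (has (fun z => modulus (x - z) < e) rs).
  by exists z => //; rewrite root_prod_XsubC.
move: lt_e; rewrite ltNge => /negP[].
elim: rs far => [|z rs IH] far; first by rewrite big_nil expr0.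
rewrite big_cons exprS ler_pM ?(ltW e0) ?exprn_ge0 ?(ltW e0) //.
  by rewrite hornerXsubC leNgt far ?mem_head.
by apply: IH => y yrs; apply: far; rewrite inE yrs orbT.
Qed.

Lemma size_subC (R : realType) (f : {poly R[i]}) (w : R[i]) :
  (1 < size f)%N -> size (f - w%:P) = size f.
Proof.
by move=> sf; rewrite size_polyDl // size_polyN (leq_ltn_trans (size_polyC_leq1 _)).
Qed.

Lemma monic_subC (R : realType) (f : {poly R[i]}) (w : R[i]) :
  (1 < size f)%N -> f \is monic -> f - w%:P \is monic.
Proof.
move=> sf fm; rewrite monicE lead_coefDl -?monicE // size_polyN.
by rewrite (leq_ltn_trans (size_polyC_leq1 _)).
Qed.

Lemma root_subC (R : realType) (f : {poly R[i]}) (w z : R[i]) :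
  root (f - w%:P) z = (f.[z] == w).
Proof. by rewrite rootE !hornerE subr_eq0. Qed.

Lemma near_fiber (R : realType) (f : {poly R[i]}) (x w : R[i]) (e : R) :
  (1 < size f)%N -> f \is monic -> 0 < e ->
  modulus (f.[x] - w) < e ^+ (size f).-1 ->
  exists2 y, f.[y] = w & modulus (x - y) < e.
Proof.
move=> sf fm e0 lt_e.
have [|y] := monic_near_root (x := x) (monic_subC w sf fm) e0.
  by rewrite size_subC // !hornerE.
by rewrite root_subC => /eqP yw xy; exists y.
Qed.

Definition separated (R : realType) (f : {poly R[i]}) (w : R[i]) (r : R) :=
  forall y y', f.[y] = w -> f.[y'] = w -> y != y' -> 2 * r <= modulus (y - y').

Lemma fiber_separated (R : realType) (f : {poly R[i]}) (w : R[i]) :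
  (1 < size f)%N -> f \is monic -> exists2 r, 0 < r & separated f w r.
Proof.
move=> sf fm; have [rs frs] := monic_split (monic_subC w sf fm).
have [r r0 Hr] := seq_separated rs.
have inrs y : f.[y] = w -> y \in rs.
  by move=> fy; rewrite -root_prod_XsubC -frs root_subC fy.
by exists r => // y y' /inrs ? /inrs ?; exact: Hr.
Qed.

Lemma separated_le (R : realType) (f : {poly R[i]}) (w : R[i]) (r r' : R) :
  r' <= r -> separated f w r -> separated f w r'.
Proof. by move=> rr sr y y' fy fy' ne; have := sr y y' fy fy' ne; lra. Qed.

(* On the circle of radius rho about a point of the fiber over w, the value of
   f cannot be close to w: a nearby point of the fiber would violate the
   separation. *)
Lemma trapped (R : realType) (f : {poly R[i]}) (w z0 : R[i]) (rho a b : R)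
    (L : R -> R[i]) :
  (1 < size f)%N -> f \is monic -> 0 < rho -> separated f w rho -> f.[z0] = w ->
  ccont a b L ->
  (forall t, a <= t <= b -> modulus (f.[L t] - w) < rho ^+ (size f).-1) ->
  modulus (L a - z0) < rho ->
  forall t, a <= t <= b -> modulus (L t - z0) < rho.
Proof.
move=> sf fm rho0 sep fz0 cL fL La; apply: ccont_stays_inside => // t tab Lt.
have [y fy yL] := near_fiber sf fm rho0 (fL t tab).
have [yz|yz] := eqVneq y z0; first by move: yL; rewrite yz Lt ltxx.
have := sep _ _ fy fz0 yz; have := modulus_dist (L t) y z0.
by rewrite (modulusB y (L t)); lra.
Qed.

Lemma mul_XsubC_coef (R : realType) (q : {poly R[i]}) (z : R[i]) k :
  (q * ('X - z%:P))`_k.+1 = q`_k - z * q`_k.+1.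
Proof. by rewrite mulrBr coefB coefMX coefMC /= mulrC. Qed.

(* Dividing by 'X - z for a small root z shifts the coefficients by one index, up
   to an error controlled by z, so the k-th one stays away from 0. *)
Lemma few_roots (R : realType) (k D : nat) (M a : R) : 0 <= M -> 0 < a ->
  exists2 rho : R, 0 < rho <= 1 &
    forall p : {poly R[i]}, (size p <= D)%N -> (forall i, modulus p`_i <= M) ->
      a <= modulus p`_k ->
    forall zs : seq R[i], uniq zs ->
      (forall z, z \in zs -> modulus z < rho /\ root p z) -> (size zs <= k)%N.
Proof.
(* [D%:R * M] bounds the sum of the moduli of the coefficients of [p], hence also the coefficients
   of its quotient by a factor with a small root; the 1 keeps [B] positive. *)
elim: k M a => [|k IH] M a M0 a0; set B := D%:R * M + 1.
  have B0 : 0 < B by have := mulr_ge0 (ler0n R D) M0; rewrite /B; lra.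
  exists (Num.min 1 (a / B)).
    by rewrite lt_min ltr01 divr_gt0 // ge_min lexx.
  move=> p sp pM pa [//|z zs] _ /(_ z (mem_head _ _)) [].
  rewrite lt_min => /andP[z1 zB] /rootP pz.
  have : modulus p`_0 < a.
    have sp0 : (size p <= D.+1)%N by rewrite ltnW.
    move: pz; rewrite (horner_coef_wide _ sp0) big_ord_recl expr0 mulr1.
    move=> /eqP; rewrite addr_eq0 => /eqP ->; rewrite modulusN.
    apply: le_lt_trans (modulus_sum _ _) _.
    apply: (@le_lt_trans _ _ (\sum_(i < D) M * modulus z)).
      apply: ler_sum => i _; rewrite modulusM ler_pM ?modulus_ge0 //.
      by rewrite modulusX exprS ler_piMr ?modulus_ge0 ?exprn_ile1 ?modulus_ge0 // ltW.
    rewrite sumr_const card_ord -[X in X < _]mulr_natl mulrA.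
    apply: (@le_lt_trans _ _ (B * modulus z)).
      by rewrite ler_wpM2r ?modulus_ge0 // /B lerDl.
    by rewrite mulrC -ltr_pdivlMr.
  by rewrite ltNge pa.
have DM0 : 0 <= D%:R * M by rewrite mulr_ge0.
have B0 : 0 < B by rewrite /B; lra.
have a20 : 0 < a / 2 by lra.
have [rho /andP[rho0 rho1] Hrho] := IH (D%:R * M) (a / 2) DM0 a20.
exists (Num.min rho (a / 2 / B)).
  by rewrite lt_min rho0 divr_gt0 //= ge_min rho1.
move=> p sp pM pa [//|z zs] /= /andP[zzs uzs] Hz.
have [] := Hz z (mem_head _ _); rewrite lt_min => /andP[zrho zB].
move=> /factor_theorem[q pq].
have z1 : modulus z <= 1 by rewrite ltW // (lt_le_trans zrho).
have sq : (size q <= D)%N.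
  have [->|q0] := eqVneq q 0; first by rewrite size_poly0.
  apply: leq_trans sp; rewrite pq size_mul ?polyXsubC_eq0 //.
  by rewrite size_XsubC addn2 /= leqnSn.
have qE i : q`_i = p`_i.+1 + z * q`_i.+1 by rewrite pq mul_XsubC_coef subrK.
have qb n : forall i, (D <= i + n)%N -> modulus q`_i <= n%:R * M.
  elim: n => [|n IHn] i Di.
    rewrite nth_default ?modulus0 ?mul0r // (leq_trans sq) //.
    by rewrite addn0 in Di.
  rewrite qE (le_trans (modulus_triangle _ _)) // -[n.+1]addn1 natrD mulrDl mul1r addrC.
  rewrite lerD // modulusM -[leRHS]mul1r ler_pM ?modulus_ge0 //.
  by apply: IHn; rewrite addSnnS.
rewrite ltnS; apply: (Hrho q) => //.
- by move=> i; apply: qb; rewrite leq_addl.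
- have -> : q`_k = p`_k.+1 + z * q`_k.+1 by [].
  have h1 : modulus (z * q`_k.+1) <= a / 2.
    rewrite modulusM (@le_trans _ _ (modulus z * B)) //.
      rewrite ler_wpM2l ?modulus_ge0 // /B.
      by have := qb D k.+1 (leq_addl _ _); lra.
    by rewrite -ler_pdivlMr // ltW.
  have := modulus_triangle (p`_k.+1 + z * q`_k.+1) (- (z * q`_k.+1)).
  by rewrite addrK modulusN; lra.
- move=> y yzs; have [] := Hz y; first by rewrite inE yzs orbT.
  rewrite lt_min => /andP[yrho _]; rewrite pq rootM root_XsubC => /orP[|/eqP yz].
    by [].
  by rewrite -yz yzs in zzs.
Qed.

(** * Multiplicities and the number of points in nearby fibers *)

Lemma mup_factor (R : realType) (q : {poly R[i]}) (x : R[i]) : q != 0 ->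
  exists2 h, q = ('X - x%:P) ^+ mup x q * h & ~~ root h x.
Proof.
move=> q0; have := leqnn (mup x q); rewrite mup_geq // => /dvdpP[h qh].
exists h; first by rewrite mulrC.
apply/negP => /factor_theorem[g hg].
have := ltnn (mup x q); rewrite mup_geq // => /negP; apply.
by rewrite exprS {2}qh hg -mulrA dvdp_mulIr.
Qed.

Lemma mup_mul_XsubCX (R : realType) (h : {poly R[i]}) (x : R[i]) k :
  ~~ root h x -> mup x (('X - x%:P) ^+ k * h) = k.
Proof. by move=> hx; rewrite mupMl // mup_XsubCX eqxx. Qed.

Lemma mup_deriv (R : realType) (q : {poly R[i]}) (x : R[i]) : q != 0 ->
  root q x -> mup x q = (mup x q^`()).+1.
Proof.
move=> q0 qx; have [h qh hx] := mup_factor x q0.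
case E : (mup x q) qh => [|k] qh.
  by move: hx; rewrite qh expr0 mul1r in qx; rewrite qx.
(* At [x] the second factor takes the value (k + 1) h(x), nonzero in characteristic 0. *)
have -> : q^`() = ('X - x%:P) ^+ k * (k.+1%:R *: h + ('X - x%:P) * h^`()).
  rewrite qh derivM deriv_exp derivXsubC mul1r /= scaler_nat exprS.
  rewrite mulrDr mulrnAl mulrnAr -mulrA mulrCA.
  by [].
rewrite mup_mul_XsubCX // rootE !hornerE subrr mul0r addr0 mulf_neq0 //.
Qed.

Lemma mup_prod_XsubC (R : realType) (rs : seq R[i]) (z : R[i]) :
  mup z (\prod_(a <- rs) ('X - a%:P)) = count_mem z rs.
Proof.
elim: rs => [|a rs IH]; first by rewrite big_nil mupNroot // rootE hornerC oner_eq0.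
rewrite big_cons mupM ?polyXsubC_eq0 //; last first.
  by rewrite monic_neq0 // monic_prod_XsubC.
by rewrite IH -['X - _]expr1 mup_XsubCX /= eq_sym; case: eqP.
Qed.

Lemma sum_count_mem (T : eqType) (vs rs : seq T) :
  uniq vs -> {subset rs <= vs} -> (\sum_(v <- vs) count_mem v rs = size rs)%N.
Proof.
move=> uvs; elim: rs => [|x rs IH] sub; first by rewrite big1.
rewrite [size _]/= -add1n -IH => [|y yrs]; last by apply: sub; rewrite inE yrs orbT.
rewrite [RHS]addnC -[1%N](_ : count_mem x vs = 1%N); last first.
  by rewrite count_uniq_mem // sub ?mem_head.
rewrite -sum1_count [X in (_ + X)%N]big_mkcond -big_split /=.
by apply: eq_bigr => v _; rewrite addnC eq_sym; case: eqP.
Qed.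

(** After translation to 0, [f - f.[z0]%:P] is X^k times a polynomial that does not vanish at 0, so
    its coefficient of index k is nonzero. Subtracting a constant changes only the coefficient of
    index 0, and k > 0, so [few_roots] applies with a radius independent of [w]. *)
Lemma fiber_mult_bound (R : realType) (f : {poly R[i]}) (z0 : R[i]) :
  (1 < size f)%N ->
  exists2 rho : R, 0 < rho & forall (w : R[i]) (zs : seq R[i]), uniq zs ->
    (forall z, z \in zs -> modulus (z - z0) < rho /\ f.[z] = w) ->
    (size zs <= mup z0 (f - f.[z0]%:P))%N.
Proof.
move=> sf; set g := f - _; have g0 : g != 0 by rewrite -size_poly_gt0 size_subC // ltnW.
have [h gh hz] := mup_factor z0 g0.
have k0 : (0 < mup z0 g)%N by rewrite -XsubC_dvd // dvdp_XsubCl root_subC.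
set k := mup z0 g in gh k0 *.
pose G := g \Po ('X + z0%:P); pose H := h \Po ('X + z0%:P).
have GE : G = H * 'X^k.
  rewrite /G gh comp_polyM rmorphXn /= comp_polyD comp_polyX rmorphN /= comp_polyC.
  by rewrite addrK mulrC.
have H0 : H`_0 = h.[z0] by rewrite -horner_coef0 horner_comp !hornerE.
pose M0 := \sum_(i < size G) modulus G`_i.
have GM i : modulus G`_i <= M0.
  case: (ltnP i (size G)) => iG; last first.
    by rewrite nth_default // modulus0 sumr_ge0 // => j _; rewrite modulus_ge0.
  rewrite /M0 (bigD1 (Ordinal iG)) //= lerDl sumr_ge0 // => j _.
  by rewrite modulus_ge0.
have M00 : 0 <= M0 by apply: sumr_ge0 => j _; rewrite modulus_ge0.
have a0 : 0 < modulus h.[z0] by rewrite modulus_gt0.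
have [|rho /andP[rho0 rho1] Hrho] := few_roots k (size G).+1 (M := 2 * M0) _ a0.
  by rewrite mulr_ge0.
exists rho => // w [//|z1 zs] uzs Hzs.
pose c := w - f.[z0].
have Gx z : G.[z - z0] = f.[z] - f.[z0] by rewrite horner_comp !hornerE subrK.
(* The constant [c] is itself a value of [G] in the unit disc, whence the bound [2 * M0] on the
   coefficients of [G - c%:P]. *)
have cM : modulus c <= M0.
  have [z1rho z1w] := Hzs _ (mem_head _ _).
  rewrite /c -z1w -Gx horner_coef (le_trans (modulus_sum _ _)) // ler_sum // => i _.
  rewrite modulusM ler_piMr ?modulus_ge0 // modulusX exprn_ile1 ?modulus_ge0 //.
  by rewrite ltW // (lt_le_trans z1rho).
rewrite -(size_map (fun z => z - z0)).
apply: (Hrho (G - c%:P)).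
- apply: leq_trans (size_polyD _ _) _; rewrite size_polyN geq_max leqnSn /=.
  by rewrite (leq_trans (size_polyC_leq1 _)).
- move=> i; rewrite coefB (le_trans (modulus_triangle _ _)) // modulusN mulrDl mul1r.
  rewrite lerD // coefC; case: eqP => // _; by rewrite modulus0.
- rewrite coefB coefC gtn_eqF // subr0 GE coefMXn ltnn subnn H0.
  by [].
- by rewrite map_inj_uniq // => x y /addIr.
- move=> _ /mapP[z zzs ->]; have [zr zw] := Hzs z zzs; split=> //.
  by rewrite rootE hornerD Gx hornerN hornerC /c zw subrr.
Qed.

Lemma noncritical_mup (R : realType) (f : {poly R[i]}) (z : R[i]) :
  (1 < size f)%N -> f^`().[z] != 0 -> mup z (f - f.[z]%:P) = 1%N.
Proof.
move=> sf fz; rewrite mup_deriv; last by rewrite root_subC.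
  by rewrite derivB derivC subr0 mupNroot.
by rewrite -size_poly_gt0 size_subC // ltnW.
Qed.

(** This is [fiber_mult_bound] for multiplicity 1: two distinct points with the same value would be
    one too many. *)
Lemma local_injectivity (R : realType) (f : {poly R[i]}) (z0 : R[i]) :
  (1 < size f)%N -> f^`().[z0] != 0 ->
  exists2 rho : R, 0 < rho & forall x y, modulus (x - z0) < rho ->
    modulus (y - z0) < rho -> f.[x] = f.[y] -> x = y.
Proof.
move=> sf fz; have [rho rho0 H] := fiber_mult_bound z0 sf.
exists rho => // x y xr yr xy; apply/eqP/negPn/negP => ne.
have := H f.[y] [:: x; y]; rewrite /= inE ne noncritical_mup // => /(_ isT) h.
suff : (2 <= 1)%N by []; apply: h => z.
by rewrite !inE => /orP[] /eqP ->.
Qed.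

Lemma size_deriv_complex (R : realType) (f : {poly R[i]}) :
  (1 < size f)%N -> size f^`() = (size f).-1.
Proof.
move=> sf; have f0 : f != 0 by rewrite -size_poly_gt0 ltnW.
have sfE : (size f).-2.+1 = (size f).-1 by case: (size f) sf => [|[]].
have lead : f^`()`_(size f).-2 != 0.
  rewrite coef_deriv sfE -mulr_natr mulf_neq0 ?pnatr_eq0 ?lead_coef_eq0 //.
  by case: (size f) sf => [|[]].
apply/eqP; rewrite eqn_leq -ltnS prednK ?(ltnW sf) // lt_size_deriv //= -sfE.
by rewrite ltnNge; apply: contra lead => le; rewrite nth_default.
Qed.

Lemma deriv_neq0 (R : realType) (f : {poly R[i]}) : (1 < size f)%N -> f^`() != 0.
Proof.
by move=> sf; rewrite -size_poly_gt0 size_deriv_complex //; case: (size f) sf => [|[]].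
Qed.

Lemma critical_values_isolated (R : realType) (f : {poly R[i]}) (w0 : R[i]) :
  (1 < size f)%N ->
  exists2 eta : R, 0 < eta & forall z, modulus (f.[z] - w0) < eta ->
    f.[z] != w0 -> f^`().[z] != 0.
Proof.
move=> sf; have [rs fE] := closed_field_poly_normal f^`().
pose s := [seq z <- rs | f.[z] != w0].
have [|eta eta0 H] := @seq_pos_min R _ s (fun z => modulus (f.[z] - w0)).
  by move=> z; rewrite mem_filter => /andP[zw _]; rewrite modulus_gt0 subr_eq0.
exists eta => // z zeta zw; apply/negP => fz.
have zs : z \in s.
  rewrite mem_filter zw -root_prod_XsubC /=.
  have : root f^`() z by [].
  by rewrite fE rootZ // lead_coef_eq0 deriv_neq0.
by have := H z zs; rewrite leNgt zeta.
Qed.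

(* The upper bounds fiber_mult_bound at the points over f.[z0] add up to the
   degree, the number of points over w, so each of them is attained. *)
Lemma exact_fiber_count (R : realType) (f : {poly R[i]}) (z0 : R[i]) :
  (1 < size f)%N -> f \is monic ->
  exists2 rho1 : R, 0 < rho1 & forall rho, 0 < rho <= rho1 ->
  exists2 eta : R, 0 < eta & forall w, modulus (w - f.[z0]) < eta -> w != f.[z0] ->
  exists zs : seq R[i], [/\ uniq zs, size zs = mup z0 (f - f.[z0]%:P) &
    forall z, (z \in zs) = (f.[z] == w) && (modulus (z - z0) < rho)].
Proof.
move=> sf fm; set w0 := f.[z0].
have [ys0 fys] := monic_split (monic_subC w0 sf fm).
pose ys := undup ys0.
have ysP y : (y \in ys) = (f.[y] == w0).
  by rewrite mem_undup -root_prod_XsubC -fys root_subC.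
have [rhoy rhoyP] : exists rhoy : R[i] -> R, forall y, 0 < rhoy y /\
    forall (w : R[i]) (zs : seq R[i]), uniq zs ->
    (forall z, z \in zs -> modulus (z - y) < rhoy y /\ f.[z] = w) ->
    (size zs <= mup y (f - f.[y]%:P))%N.
  have Hy y : exists r, 0 < r /\
      forall (w : R[i]) (zs : seq R[i]), uniq zs ->
      (forall z, z \in zs -> modulus (z - y) < r /\ f.[z] = w) ->
      (size zs <= mup y (f - f.[y]%:P))%N.
    by have [r r0 H] := fiber_mult_bound y sf; exists r.
  by exists (fun y => projT1 (cid (Hy y))) => y; case: (cid (Hy y)).
have [rho1 rho10 Hrho1] := @seq_pos_min R _ ys rhoy (fun y _ => proj1 (rhoyP y)).
have [r1 r10 r1P] := critical_values_isolated w0 sf.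
exists rho1 => // rho /andP[rho0 rhor].
exists (Num.min r1 (rho ^+ (size f).-1)); first by rewrite lt_min r10 exprn_gt0.
move=> w; rewrite lt_min => /andP[wr1 wrho] ww0.
have [rs frs] := monic_split (monic_subC w sf fm).
have rsP z : (z \in rs) = (f.[z] == w).
  by rewrite -root_prod_XsubC -frs root_subC.
(* A multiple root would be a zero of f', but [w] is within [r1] of [w0] and different from it,
   hence not a critical value. *)
have urs : uniq rs.
  apply: count_mem_uniq => z; rewrite -mup_prod_XsubC -frs.
  case zrs: (z \in rs); last by rewrite mupNroot // root_subC -rsP zrs.
  have /eqP fz : f.[z] == w by rewrite -rsP.
  by rewrite -fz noncritical_mup //; apply: r1P; rewrite fz.
have srs : size rs = (size f).-1.
  by rewrite -(size_subC w sf) frs size_prod_XsubC.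
have sys : (\sum_(y <- ys) mup y (f - w0%:P) = (size f).-1)%N.
  rewrite -(size_subC w0 sf) [in RHS]fys size_prod_XsubC /=.
  rewrite -(sum_count_mem (undup_uniq ys0)) => [|y]; last by rewrite mem_undup.
  by apply: eq_bigr => y _; rewrite fys mup_prod_XsubC.
pose F y := [seq z <- rs | modulus (z - y) < rho].
have Fle y : y \in ys -> (size (F y) <= mup y (f - w0%:P))%N.
  move=> yys; have /eqP fy : f.[y] == w0 by rewrite -ysP.
  rewrite -fy; apply: (proj2 (rhoyP y) w); first by rewrite filter_uniq.
  move=> z; rewrite mem_filter rsP => /andP[zr /eqP fz]; split=> //.
  by rewrite (lt_le_trans zr) // (le_trans rhor) // Hrho1.
(* Seen from a point over [w], the value [w0] is close, so [near_fiber] places this point in the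
   disc of some [y] over [w0]: the [F y] cover the fiber. *)
have Fge : (size rs <= \sum_(y <- ys) size (F y))%N.
  have -> : (\sum_(y <- ys) size (F y) = size (flatten [seq F y | y <- ys]))%N.
    by rewrite size_flatten sumnE /shape -map_comp big_map.
  apply: uniq_leq_size urs _ => z; rewrite rsP => /eqP fz.
  have fz' : modulus (f.[z] - w0) < rho ^+ (size f).-1 by rewrite fz.
  have [y fy yz] := near_fiber sf fm rho0 fz'.
  apply/flattenP; exists (F y); first by rewrite map_f // ysP fy.
  by rewrite mem_filter yz rsP fz eqxx.
have z0ys : z0 \in ys by rewrite ysP.
exists (F z0); split; first by rewrite filter_uniq.
  apply/eqP; rewrite eqn_leq Fle //= leqNgt; apply/negP => lt.
  move: Fge; rewrite srs -sys leqNgt => /negP[].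
  rewrite !(big_rem z0 z0ys) /= -addSn leq_add // big_seq [leqRHS]big_seq.
  by apply: leq_sum => y /mem_rem /Fle.
by move=> z; rewrite mem_filter rsP andbC.
Qed.

(** * Lifts of paths *)

(** The base path [w] is arbitrary, so that reversed and affinely rescaled rays are covered too. *)
Definition lift (R : realType) (f : {poly R[i]}) (w : R -> R[i]) (a b : R)
    (L : R -> R[i]) :=
  ccont a b L /\ forall t, a <= t <= b -> f.[L t] = w t.

Lemma lift_sub (R : realType) (f : {poly R[i]}) (w : R -> R[i]) (a b a' b' : R)
    (L : R -> R[i]) :
  a <= a' -> b' <= b -> lift f w a b L -> lift f w a' b' L.
Proof.
move=> aa bb [cL fL]; split; first exact: ccont_sub cL.
by move=> t tab; apply: fL; lra.
Qed.

Lemma eq_lift (R : realType) (f : {poly R[i]}) (w : R -> R[i]) (a b : R)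
    (L M : R -> R[i]) :
  (forall t, a <= t <= b -> L t = M t) -> lift f w a b L -> lift f w a b M.
Proof.
move=> LM [cL fL]; split; first exact: eq_ccont cL.
by move=> t tab; rewrite -LM // fL.
Qed.

Lemma lift_glue (R : realType) (f : {poly R[i]}) (w : R -> R[i]) (a b c : R)
    (L M : R -> R[i]) :
  a <= b <= c -> L b = M b -> lift f w a b L -> lift f w b c M ->
  lift f w a c (fun t => if t <= b then L t else M t).
Proof.
move=> abc LM [cL fL] [cM fM]; split.
  apply: (ccont_glue abc).
    by apply: eq_ccont cL => t /andP[_ ->].
  apply: eq_ccont cM => t /andP[bt tc]; case: ifP => // tb.
  by have -> : t = b by apply/eqP; rewrite eq_le tb bt.
move=> t tac; case: (lerP t b) => tb; first by apply: fL; lra.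
by apply: fM; lra.
Qed.

Lemma lift_opp (R : realType) (f : {poly R[i]}) (w : R -> R[i]) (a b : R)
    (L : R -> R[i]) :
  lift f w a b L -> lift f (fun t => w (- t)) (- b) (- a) (fun t => L (- t)).
Proof.
move=> [cL fL]; split; first exact: ccont_opp.
by move=> t tab; apply: fL; lra.
Qed.

(** Agreement extends to the right by local injectivity and passes to limits by continuity. Local
    injectivity is used only before [b], so the lift may end at a zero of f'. *)
Lemma lift_unique (R : realType) (f : {poly R[i]}) (w : R -> R[i]) (a b : R)
    (L M : R -> R[i]) :
  (1 < size f)%N -> lift f w a b L -> lift f w a b M -> L a = M a ->
  (forall t, a <= t < b -> f^`().[L t] != 0) ->
  forall t, a <= t <= b -> L t = M t.
Proof.
move=> sf [cL fL] [cM fM] LMa nc t0 t0ab; have ab : a <= b by lra.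
apply: (real_induction (P := fun t => L t = M t) ab) t0ab => //.
  move=> t tab LM; have tab' : a <= t <= b by lra.
  have [r r0 inj] := local_injectivity sf (nc t tab).
  have [d d0 Hd] := cL t tab' r r0; have [d' d0' Hd'] := cM t tab' r r0.
  exists (Num.min d d'); first by rewrite lt_min d0.
  move=> u utb; rewrite -ltrBlDl lt_min => /andP[ud ud'].
  have uab : a <= u <= b by lra.
  have LMt : L t = M t by apply: LM; lra.
  apply: inj; last by rewrite fL // fM.
    by apply: Hd => //; rewrite ger0_norm //; lra.
  by rewrite LMt; apply: Hd' => //; rewrite ger0_norm //; lra.
move=> t tab LM; apply: (@ccont_eq_at_end _ a t) => //; first lra.
  by apply: ccont_sub cL; lra.
by apply: ccont_sub cM; lra.
Qed.

Lemma lift_unique_backward (R : realType) (f : {poly R[i]}) (w : R -> R[i])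
    (a b : R) (L M : R -> R[i]) :
  (1 < size f)%N -> lift f w a b L -> lift f w a b M -> L b = M b ->
  (forall t, a < t <= b -> f^`().[L t] != 0) ->
  forall t, a <= t <= b -> L t = M t.
Proof.
move=> sf lL lM LMb nc t tab.
have := @lift_unique R f _ (- b) (- a) _ _ sf (lift_opp lL) (lift_opp lM).
rewrite !opprK => /(_ LMb) h; have := h _ (- t); rewrite !opprK; apply; last lra.
by move=> u uab; apply: nc; lra.
Qed.

(** Close to time [b] the curve is near the fiber over [w b]. This fiber is finite and separated, so
    the curve is trapped near a single point [y] of it, which may be a zero of f'. *)
Lemma lift_limit (R : realType) (f : {poly R[i]}) (w : R -> R[i]) (a b : R)
    (L : R -> R[i]) :
  (1 < size f)%N -> f \is monic -> a < b -> ccont a b w ->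
  (forall c, a <= c < b -> lift f w a c L) ->
  exists y, lift f w a b (fun t => if t < b then L t else y).
Proof.
move=> sf fm ab cw lL.
have bab : a <= b <= b by rewrite lexx ltW.
have [r r0 sep] := fiber_separated (w b) sf fm.
have close e : 0 < e -> exists2 t1, a <= t1 < b &
    forall t, t1 <= t < b -> modulus (f.[L t] - w b) < e ^+ (size f).-1.
  move=> e0; have [d d0 Hd] := cw b bab _ (exprn_gt0 (size f).-1 e0).
  pose m := Num.min d (b - a).
  have m0 : 0 < m by rewrite lt_min d0; lra.
  have [md ma] : m <= d /\ m <= b - a by split; rewrite /m ge_min lexx ?orbT.
  exists (b - m / 2); first lra.
  move=> t tb; have [_ ->] := lL t ltac:(lra); last lra.
  by apply: Hd; rewrite ?ltr_norml; lra.
have [t1 t1ab Ht1] := close r r0.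
have [y fy L1y] := near_fiber sf fm r0 (Ht1 t1 ltac:(lra)).
have Ly t : t1 <= t < b -> modulus (L t - y) < r.
  move=> tb; have [cL _] := lL t ltac:(lra).
  apply: (@trapped R f (w b) y r t1 t) => //; last lra.
    by apply: ccont_sub cL; lra.
  by move=> u ut; apply: Ht1; lra.
(* At each smaller scale there is a point of the fiber close to [L t]; separation forces it to be
   [y]. *)
have tends e : 0 < e -> exists2 t2, a <= t2 < b &
    forall t, t2 <= t < b -> modulus (L t - y) < e.
  move=> e0; pose e' := Num.min e r.
  have e'0 : 0 < e' by rewrite lt_min e0.
  have [e'e e'r] : e' <= e /\ e' <= r by split; rewrite /e' ge_min lexx ?orbT.
  have [t2 t2ab Ht2] := close e' e'0.
  exists (Num.max t1 t2).
    by rewrite le_max gt_max; apply/andP; split; [|apply/andP]; rewrite ?orbT; lra.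
  move=> t; rewrite ge_max => /andP[/andP[tt1 tt2] tb].
  have [y' fy' Ly'] := near_fiber sf fm e'0 (Ht2 t ltac:(lra)).
  have [<-|ne] := eqVneq y' y; first exact: lt_le_trans e'e.
  have := sep _ _ fy' fy ne; have := modulus_dist (L t) y' y.
  by rewrite (modulusB y' (L t)); have := Ly t ltac:(lra); lra.
exists y; split=> [t tab e e0|t tab]; last first.
  case: (ltrP t b) => tb; last first.
    by have -> : t = b by lra.
  by have [_ h] := lL t ltac:(lra); apply: h; lra.
case: (ltrP t b) => tb.
  have [cL _] := lL ((t + b) / 2) ltac:(lra).
  have [d d0 Hd] := cL t ltac:(lra) e e0.
  exists (Num.min d ((b - t) / 2)); first by rewrite lt_min d0; lra.
  move=> u uab; rewrite lt_min => /andP[ud]; rewrite ltr_norml => ub.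
  by rewrite ifT; [apply: Hd => //|]; lra.
have [t2 t2ab Ht2] := tends e e0.
exists (b - t2); first lra.
move=> u uab; rewrite ltr_norml => ub; case: ifP => uv; last by rewrite subrr modulus0.
by apply: Ht2; lra.
Qed.

(** A local inverse of [f] at [z] is applied to [w]: [near_fiber] gives preimages near [z],
    [local_injectivity] makes them unique, and [near_fiber] at a smaller scale makes them
    continuous. *)
Lemma lift_local (R : realType) (f : {poly R[i]}) (w : R -> R[i]) (a b : R)
    (z : R[i]) :
  (1 < size f)%N -> f \is monic -> a < b -> ccont a b w -> f.[z] = w a ->
  f^`().[z] != 0 ->
  exists c, exists2 L, a < c <= b &
    [/\ lift f w a c L, L a = z & forall t, a <= t <= c -> f^`().[L t] != 0].
Proof.
move=> sf fm ab cw fz f'z.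
have f'z0 : 0 < modulus f^`().[z] by rewrite modulus_gt0.
have [r1 r10 Hr1] := ccont_poly f^`() z f'z0.
have [r2 r20 inj] := local_injectivity sf f'z.
pose r := Num.min r1 r2; have r0 : 0 < r by rewrite lt_min r10.
have [rr1 rr2] : r <= r1 /\ r <= r2 by split; rewrite /r ge_min lexx ?orbT.
have aab : a <= a <= b by rewrite lexx ltW.
have [d d0 Hd] := cw a aab _ (exprn_gt0 (size f).-1 r0).
pose c := a + Num.min (d / 2) (b - a).
have m0 : 0 < Num.min (d / 2) (b - a) by rewrite lt_min; apply/andP; split; lra.
have [md mb] : Num.min (d / 2) (b - a) <= d / 2 /\ Num.min (d / 2) (b - a) <= b - a.
  by split; rewrite ge_min lexx ?orbT.
have ex t : a <= t <= c -> exists x, f.[x] = w t /\ modulus (x - z) < r.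
  move=> tac; have wt : modulus (f.[z] - w t) < r ^+ (size f).-1.
    rewrite fz modulusB; apply: Hd; first by rewrite /c in tac; lra.
    by rewrite ger0_norm; rewrite /c in tac; lra.
  by have [x fx zx] := near_fiber sf fm r0 wt; exists x; rewrite modulusB.
pose L t := xget z [set x | f.[x] = w t /\ modulus (x - z) < r].
have LP t : a <= t <= c -> f.[L t] = w t /\ modulus (L t - z) < r.
  by move=> tac; rewrite /L; case: xgetP => [x _ //|]; have [x xP] := ex t tac => /(_ x).
have Linj t x : a <= t <= c -> f.[x] = w t -> modulus (x - z) < r -> x = L t.
  move=> tac fx xz; have [fL Lz] := LP t tac.
  by apply: inj; rewrite ?fx ?fL //; exact: lt_le_trans rr2.
exists c, L; first by rewrite /c; lra.
split; last 1 first.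
- move=> t tac; have [_ Lz] := LP t tac.
  have := Hr1 (L t) (lt_le_trans Lz rr1); apply: contraTneq => ->.
  by rewrite sub0r modulusN ltxx.
- split; last by move=> t /LP[].
  move=> t tac e e0; have [fL Lz] := LP t tac.
  (* The second bound keeps a point within [e'] of [L t] in the disc about [z] where [f] is
     injective. *)
  pose e' := Num.min e (r - modulus (L t - z)).
  have e'0 : 0 < e' by rewrite lt_min e0 subr_gt0.
  have tab : a <= t <= b by rewrite /c in tac; lra.
  have [d' d'0 Hd'] := cw t tab _ (exprn_gt0 (size f).-1 e'0).
  exists d' => // u uac ut.
  have wu : modulus (f.[L t] - w u) < e' ^+ (size f).-1.
    by rewrite fL modulusB; apply: Hd' => //; rewrite /c in uac; lra.
  have [x fx] := near_fiber sf fm e'0 wu.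
  rewrite lt_min => /andP[xe xr].
  have xz : modulus (x - z) < r.
    by have := modulus_dist (L t) x z; rewrite (modulusB x (L t)); lra.
  by rewrite -(Linj u x) // modulusB.
- by rewrite -(Linj a z) ?subrr ?modulus0 // /c; lra.
Qed.

Definition noncritical_on (R : realType) (f : {poly R[i]}) (a b : R)
    (L : R -> R[i]) :=
  forall t, a <= t < b -> f^`().[L t] != 0.

(** Either some lift reaches a zero of f', and it is the required one, or no lift does, and then
    real induction extends lifts up to [b]. *)
Lemma maximal_lift (R : realType) (f : {poly R[i]}) (w : R -> R[i]) (a b : R)
    (z : R[i]) :
  (1 < size f)%N -> f \is monic -> a <= b -> ccont a b w -> f.[z] = w a ->
  exists c, exists2 L, a <= c <= b &
    [/\ lift f w a c L, L a = z, noncritical_on f a c L &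
        c = b \/ f^`().[L c] = 0].
Proof.
move=> sf fm ab cw fz.
pose Q c L := [/\ lift f w a c L, L a = z & noncritical_on f a c L].
have [[c [L [cab QL Lc]]]|none] :=
  pselect (exists c L, [/\ a <= c <= b, Q c L & f^`().[L c] = 0]).
  by case: QL => *; exists c, L => //; split=> //; right.
suff [L [lL La nL]] : exists L, Q b L.
  by exists b, L; rewrite ?lexx ?ab //; split=> //; left.
have bab : a <= b <= b by rewrite lexx ab.
apply: (real_induction (P := fun t => exists L, Q t L) ab _ _ _ bab).
- exists (fun=> z); split=> //; last by move=> t; lra.
  split; first by move=> t _ e e0; exists 1 => // u _ _; rewrite subrr modulus0.
  by move=> t tab; have -> : t = a by lra.
- move=> t tab Pt; have [L [lL La nL]] := Pt t ltac:(lra).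
  have Lt : f^`().[L t] != 0.
    by apply/eqP => Lt; apply: none; exists t, L; split=> //; lra.
  have [c [M tc [lM Mt nM]]] : exists c, exists2 M, t < c <= b &
      [/\ lift f w t c M, M t = L t & forall u, t <= u <= c -> f^`().[M u] != 0].
    apply: lift_local => //; first lra; first by apply: ccont_sub cw; lra.
    by apply: (proj2 lL); lra.
  exists (c - t); first lra.
  move=> u utb uc; exists (fun v => if v <= t then L v else M v); split.
  + apply: lift_glue => //; first lra.
    by apply: lift_sub lM; lra.
  + by rewrite ifT //; lra.
  + move=> v vau; case: (lerP v t) => vt; last by apply: nM; lra.
    case: (ltrP v t) => vt'; first by apply: nL; lra.
    by have -> : v = t by lra.
- move=> t tab Pt.
  (* A lift on [a, u] is chosen separately for each [u < t]; by uniqueness these lifts are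
     compatible, so the diagonal [G] is a lift on every [a, c] with [c < t], to which [lift_limit]
     adds the value at [t]. *)
  pose l u := xget (fun=> z) [set L | Q u L].
  have lQ u : a <= u < t -> Q u (l u).
    by move=> ut; rewrite /l; case: xgetP => //; have [L QL] := Pt u ut => /(_ L).
  pose G u := l u u.
  have Gl c u : a <= u <= c -> c < t -> G u = l c u.
    move=> uc ct; have [l1 a1 n1] := lQ u ltac:(lra); have [l2 a2 n2] := lQ c ltac:(lra).
    apply: (lift_unique sf l1 _ _ n1); last lra.
      by apply: lift_sub l2; lra.
    by rewrite a1 a2.
  have lG c : a <= c < t -> lift f w a c G.
    move=> cat; have [l1 _ _] := lQ c ltac:(lra).
    by apply: eq_lift l1 => u uc; rewrite (Gl c) //; lra.
  have [||y ly] := lift_limit sf fm _ _ lG; first lra.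
    by apply: ccont_sub cw; lra.
  exists (fun u => if u < t then G u else y); split=> //.
    by have at_ : a < t by [lra]; have [_ la _] := lQ a ltac:(lra); rewrite at_ -la.
  move=> u ut; rewrite ifT; last lra.
  have [_ _ n1] := lQ ((u + t) / 2) ltac:(lra).
  by rewrite (Gl ((u + t) / 2)); [apply: n1|..]; lra.
Qed.

(** Agreement at the noncritical time [c] propagates in both directions. The time [a] may be
    critical: this is how edges with a common source are compared. *)
Lemma lift_unique_from (R : realType) (f : {poly R[i]}) (w : R -> R[i])
    (a b c : R) (L M : R -> R[i]) :
  (1 < size f)%N -> lift f w a b L -> lift f w a b M -> a < c <= b ->
  L c = M c -> f^`().[L c] != 0 -> (forall t, a < t < b -> f^`().[L t] != 0) ->
  forall t, a <= t <= b -> L t = M t.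
Proof.
move=> sf lL lM cab LMc Lc nc t tab; case: (lerP t c) => tc.
  apply: (@lift_unique_backward R f w a c) => //; last lra.
  - by apply: lift_sub lL; lra.
  - by apply: lift_sub lM; lra.
  - move=> u uac; have [->//|uc] := eqVneq u c; apply: nc.
    by have : u < c by [rewrite lt_neqAle uc; lra]; lra.
apply: (@lift_unique R f w c b) => //; last lra.
- by apply: lift_sub lL; lra.
- by apply: lift_sub lM; lra.
- by move=> u uac; apply: nc; lra.
Qed.

(** * Derivatives along curves *)

Definition rcont (R : realType) (a b : R) (h : R -> R) :=
  forall t, a <= t <= b -> forall e, 0 < e ->
  exists2 d, 0 < d & forall u, a <= u <= b -> `|u - t| < d -> `|h u - h t| < e.

Lemma rcontP (R : realType) (a b : R) (h : R -> R) :
  {within [set` `[a, b]], continuous h} <-> rcont a b h.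
Proof.
split.
  move=> /subspace_continuousP ch t tab e e0.
  have tab' : [set` `[a, b]] t by rewrite /= in_itv.
  have /cvgrPdist_lt/(_ e e0) := ch t tab'.
  rewrite near_withinE => /nbhs_ballP[d /= d0 Hd].
  exists d => // u uab ut; rewrite distrC; apply: Hd; last by rewrite /= in_itv.
  by rewrite /ball /= distrC.
move=> ch; apply/subspace_continuousP => t; rewrite /= in_itv /= => tab.
apply/cvgrPdist_lt => e e0; rewrite near_withinE; apply/nbhs_ballP.
have [d d0 Hd] := ch t tab e e0; exists d => //= u ut.
rewrite in_itv /= => uab; rewrite distrC; apply: Hd => //.
by rewrite distrC.
Qed.

Lemma ccontP (R : realType) (a b : R) (g : R -> R[i]) :
  ccont a b g <-> {within [set` `[a, b]], continuous (re_part g)} /\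
                  {within [set` `[a, b]], continuous (im_part g)}.
Proof.
have ReB (x y : R[i]) : complex.Re x - complex.Re y = complex.Re (x - y).
  by case: x y => ? ? [].
have ImB (x y : R[i]) : complex.Im x - complex.Im y = complex.Im (x - y).
  by case: x y => ? ? [].
split=> [cg|[/rcontP cr /rcontP ci]].
  split; apply/rcontP => t tab e e0; have [d d0 Hd] := cg t tab e e0;
    exists d => // u uab ut; apply: le_lt_trans (Hd u uab ut).
    by rewrite /re_part ReB Re_le_modulus.
  by rewrite /im_part ImB Im_le_modulus.
move=> t tab e e0; have e20 : 0 < e / 2 by lra.
have [d d0 Hd] := cr t tab _ e20; have [d' d'0 Hd'] := ci t tab _ e20.
exists (Num.min d d'); first by rewrite lt_min d0.
move=> u uab; rewrite lt_min => /andP[ud ud'].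
have := Hd u uab ud; have := Hd' u uab ud'; rewrite /re_part /im_part ReB ImB.
by have := modulus_le_ReIm (g u - g t); lra.
Qed.

(** Between consecutive exceptional points this is the mean value theorem; continuity carries the
    constant value across them. *)
Lemma constant_off_finite (R : realType) (a b : R) (S : seq R) (Q : R -> R) :
  a <= b -> rcont a b Q ->
  (forall t, a < t < b -> t \notin S -> is_derive t 1 Q 0) ->
  forall t, a <= t <= b -> Q t = Q a.
Proof.
move=> ab cQ dQ; apply: real_induction => //.
  move=> t tab Pt.
  (* The exceptional points to the right of [t] are at distance at least [d], so none lies strictly
     between [t] and [u]. *)
  have [|d d0 Hd] := @seq_pos_min R _ [seq s <- S | t < s] (fun s => s - t).
    by move=> s; rewrite mem_filter subr_gt0 => /andP[].
  exists d => // u utb ud; rewrite -(Pt t) ?lexx; last lra.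
  have tu : t < u by lra.
  have [||c ctu] := @MVT R Q (fun=> 0) t u tu.
  - move=> x; rewrite in_itv /= => xtu; apply: dQ; first lra.
    apply/negP => xS; have := Hd x; rewrite mem_filter xS andbT => /(_ ltac:(lra)).
    lra.
  - apply/rcontP => x xtu e e0; have [|d' d'0 Hd'] := cQ x _ e e0; first lra.
    by exists d' => // y ytu; apply: Hd'; lra.
  - by rewrite mul0r => /eqP; rewrite subr_eq0 => /eqP.
move=> t tab Pt; apply/eqP; rewrite -subr_eq0 -normr_eq0; apply/negPn/negP => n0.
have p0 : 0 < `|Q t - Q a| by rewrite lt_neqAle eq_sym n0 normr_ge0.
have [|d d0 Hd] := cQ t _ _ p0; first lra.
pose m := Num.min d (t - a).
have [md ma] : m <= d /\ m <= t - a by split; rewrite /m ge_min lexx ?orbT.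
have m0 : 0 < m by rewrite lt_min d0; lra.
have := Hd (t - m / 2); rewrite (Pt (t - m / 2)); last lra.
rewrite [`|Q a - _|]distrC ltxx => H; suff : false by []; apply: H; first lra.
by rewrite ltr_norml; lra.
Qed.

Definition cderive (R : realType) (g : R -> R[i]) (t : R) (v : R[i]) :=
  is_derive t 1 (re_part g) (complex.Re v) /\
  is_derive t 1 (im_part g) (complex.Im v).

Lemma cderiveM (R : realType) (g h : R -> R[i]) (t : R) (v w : R[i]) :
  cderive g t v -> cderive h t w ->
  cderive (fun s => g s * h s) t (v * h t + g t * w).
Proof.
move=> [gr gi] [hr hi]; split.
  have -> : re_part (fun s => g s * h s) =
            re_part g * re_part h - im_part g * im_part h.
    apply/funext => s; rewrite /re_part /im_part /=.
    rewrite -[LHS]/(complex.Re (g s * h s)) !fctE.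
    by case: (g s) (h s) => ? ? [].
  apply: is_derive_eq (is_deriveB (is_deriveM gr hr) (is_deriveM gi hi)) _.
  rewrite /re_part /im_part /= /GRing.scale /=.
  by case: v w (g t) (h t) {gr gi hr hi} => ? ? [? ?] [? ?] [? ?] /=; ring.
have -> : im_part (fun s => g s * h s) =
          re_part g * im_part h + im_part g * re_part h.
  apply/funext => s; rewrite /re_part /im_part /= !fctE.
  by case: (g s) (h s) => ? ? [].
apply: is_derive_eq (is_deriveD (is_deriveM gr hi) (is_deriveM gi hr)) _.
rewrite /re_part /im_part /= /GRing.scale /=.
by case: v w (g t) (h t) {gr gi hr hi} => ? ? [? ?] [? ?] [? ?] /=; ring.
Qed.

Lemma cderiveD_cst (R : realType) (g : R -> R[i]) (t : R) (v c : R[i]) :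
  cderive g t v -> cderive (fun s => g s + c) t v.
Proof.
move=> [gr gi]; split.
  have -> : re_part (fun s => g s + c) = re_part g + cst (complex.Re c).
    apply/funext => s; rewrite /re_part !fctE /=.
    by case: (g s) c => ? ? [].
  by apply: is_derive_eq; rewrite addr0.
have -> : im_part (fun s => g s + c) = im_part g + cst (complex.Im c).
  apply/funext => s; rewrite /im_part !fctE /=.
  by case: (g s) c => ? ? [].
by apply: is_derive_eq; rewrite addr0.
Qed.

Lemma cderive_cst (R : realType) (c : R[i]) (t : R) : cderive (fun=> c) t 0.
Proof. by split; exact: is_derive_cst. Qed.

Lemma cderive_horner (R : realType) (p : {poly R[i]}) (g : R -> R[i]) (t : R)
    (v : R[i]) :
  cderive g t v -> cderive (fun s => p.[g s]) t (p^`().[g t] * v).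
Proof.
move=> dg; elim/poly_ind: p => [|p c IH].
  rewrite deriv0 horner0 mul0r.
  have -> : (fun s => (0 : {poly R[i]}).[g s]) = (fun=> 0).
    by apply/funext => s; rewrite horner0.
  exact: cderive_cst.
have -> : (fun s => (p * 'X + c%:P).[g s]) = (fun s => p.[g s] * g s + c).
  by apply/funext => s; rewrite hornerMXaddC.
have -> : (p * 'X + c%:P)^`().[g t] * v = p^`().[g t] * v * g t + p.[g t] * v.
  by rewrite derivMXaddC !hornerE; ring.
exact/cderiveD_cst/cderiveM.
Qed.

Lemma is_derive_modulus (R : realType) (F : R -> R[i]) (t : R) (v : R[i]) :
  F t != 0 -> cderive F t v ->
  is_derive t 1 (fun s => modulus (F s))
    ((complex.Re (F t) * complex.Re v + complex.Im (F t) * complex.Im v)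
       / modulus (F t)).
Proof.
move=> Ft [dr di].
have -> : (fun s => modulus (F s)) =
    Num.sqrt \o (re_part F * re_part F + im_part F * im_part F).
  by apply/funext => s; rewrite modulusE /= !fctE -!expr2.
have pos : 0 < (re_part F * re_part F + im_part F * im_part F) t.
  by rewrite !fctE -!expr2 -[X in 0 < X]sqr_modulus exprn_gt0 // modulus_gt0.
have d1 := is_derive1_sqrt pos.
have mE : Num.sqrt ((re_part F * re_part F + im_part F * im_part F) t) = modulus (F t).
  by rewrite modulusE !fctE -!expr2.
have m0 : modulus (F t) != 0 by rewrite gt_eqF ?modulus_gt0.
have dS := is_deriveD (is_deriveM dr dr) (is_deriveM di di).
apply: is_derive_eq (is_derive1_comp d1 dS) _.
rewrite mE /GRing.scale /= /re_part /im_part.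
by field.
Qed.

(** [f] maps the horizontal and vertical lines through [z] to curves of velocity f' and i f'; the
    two partial derivatives of |f| are therefore the coordinates of f conj(f') / |f|. *)
Lemma gradient_modulusE (R : realType) (f : {poly R[i]}) (z : R[i]) :
  f.[z] != 0 ->
  gradient_modulus f z = (modulus f.[z])^-1%:C%C * (f.[z] * (f^`().[z])^*%C).
Proof.
move=> fz; case: z fz => x y fz.
have dx : cderive (fun s : R => s +i* y)%C x 1.
  by split; [exact: is_derive_id|exact: is_derive_cst].
have dy : cderive (fun s : R => x +i* s)%C y 'i%C.
  by split; [exact: is_derive_cst|exact: is_derive_id].
have gx := is_derive_modulus (F := fun s => f.[(s +i* y)%C]) fz (cderive_horner f dx).
have gy := is_derive_modulus (F := fun s => f.[(x +i* s)%C]) fz (cderive_horner f dy).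
rewrite /gradient_modulus !derive1E /= (@derive_val _ _ _ _ _ _ _ gx).
rewrite (@derive_val _ _ _ _ _ _ _ gy) mulr1.
case: (f.[_]) (f^`().[_]) => a b [c d].
apply/eqP; rewrite eq_complex /=; apply/andP; split; apply/eqP; ring.
Qed.

Lemma is_derive_quotient (R : realType) (g : R -> R) (t v : R) :
  (forall e, 0 < e -> exists2 d, 0 < d &
     forall h, h != 0 -> `|h| < d -> `|(g (t + h) - g t) / h - v| < e) ->
  is_derive t 1 g v.
Proof.
move=> H.
have cv : (fun h => h^-1 *: ((g \o shift t) (h *: 1) - g t)) @ 0^' --> v.
  apply/cvgrPdist_lt => e e0; have [d d0 Hd] := H e e0.
  rewrite near_withinE; apply/nbhs_ballP; exists d => //= h.
  rewrite /ball /= sub0r normrN => hd h0.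
  rewrite distrC /GRing.scale /= mulr1 [h + t]addrC mulrC.
  exact: Hd.
apply: DeriveDef; first by apply/cvg_ex; exists v.
exact: cvg_lim cv.
Qed.

(** * Lifts of rays and reparametrization *)

Definition ray (R : realType) (w : R[i]) (t : R) : R[i] := (1 - t)%:C%C * w.

Lemma modulus_ray (R : realType) (w : R[i]) (t : R) :
  t <= 1 -> modulus (ray w t) = (1 - t) * modulus w.
Proof. by move=> t1; rewrite modulusM modulus_real ger0_norm // subr_ge0. Qed.

Lemma ray_sub (R : realType) (w : R[i]) (s t : R) : ray w s - ray w t = (t - s)%:C%C * w.
Proof. by rewrite /ray -mulrBl -rmorphB; congr (_%:C%C * _); ring. Qed.

Lemma ccont_ray (R : realType) (w : R[i]) (a b : R) : ccont a b (ray w).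
Proof.
move=> t _ e e0; have B0 : 0 < modulus w + 1 by have := modulus_ge0 w; lra.
exists (e / (modulus w + 1)); first exact: divr_gt0.
move=> u _ ut; rewrite ray_sub modulusM modulus_real distrC.
rewrite ltr_pdivlMr // in ut; apply: le_lt_trans ut.
by rewrite ler_wpM2l // lerDl.
Qed.

(** Write f - f(L t) = q (X - L t). Then the difference quotient of [L] at [t] is exactly - w / q(L
    (t + h)), and q(L t) = f'(L t). *)
Lemma lift_cderive (R : realType) (f : {poly R[i]}) (w : R[i]) (a b t : R)
    (L : R -> R[i]) :
  lift f (ray w) a b L -> a < t < b -> f^`().[L t] != 0 ->
  cderive L t (- w / f^`().[L t]).
Proof.
move=> [cL fL] tab f't; have tab' : a <= t <= b by lra.
have /factor_theorem[q qE] : root (f - f.[L t]%:P) (L t) by rewrite root_subC.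
have fq x : f.[x] - f.[L t] = q.[x] * (x - L t).
  by have := congr1 (fun p => p.[x]) qE; rewrite !hornerE.
have qt : q.[L t] = f^`().[L t].
  have := congr1 (fun p => p^`().[L t]) qE.
  rewrite derivB derivC subr0 => ->.
  by rewrite derivM derivXsubC !hornerE subrr mulr0 add0r.
have q0 : 0 < modulus q.[L t] by rewrite qt modulus_gt0.
pose v := - w / f^`().[L t].
have key e : 0 < e -> exists2 d, 0 < d & forall h, h != 0 -> `|h| < d ->
    modulus ((h^-1)%:C%C * (L (t + h) - L t) - v) < e.
  move=> e0; pose W := modulus w + 1.
  have W0 : 0 < W by have := modulus_ge0 w; rewrite /W; lra.
  set Q := modulus q.[L t] in q0 *.
  (* The first bound keeps |q| above [Q / 2] at [L (t + h)]; given this, the second one makes the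
     two quotients of [- w] differ by less than [e]. *)
  have r0 : 0 < Num.min (Q / 2) (e * (Q / 2 * Q) / W).
    by rewrite lt_min !(divr_gt0, mulr_gt0).
  have [r rpos Hr] := ccont_poly q (L t) r0.
  have [d d0 Hd] := cL t tab' r rpos.
  exists (Num.min d (Num.min (t - a) (b - t))).
    by rewrite !lt_min d0; apply/andP; split=> //; apply/andP; split; lra.
  move=> h h0; rewrite !lt_min !ltr_norml => /and3P[hd ha hb].
  have thab : a <= t + h <= b by lra.
  have th : modulus (L (t + h) - L t) < r.
    by apply: Hd => //; rewrite [t + h]addrC addrK ltr_norml.
  have := Hr _ th; rewrite lt_min => /andP[q1 q2].
  have qh : Q / 2 < modulus q.[L (t + h)].
    have := modulus_sub_le q.[L (t + h)] q.[L t]; rewrite ler_norml -/Q.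
    lra.
  have qh0 : q.[L (t + h)] != 0 by rewrite -modulus_gt0; lra.
  have qt0 : q.[L t] != 0 by rewrite qt.
  have hC : (h%:C)%C != 0 :> R[i] by rewrite -modulus_gt0 modulus_real normr_gt0.
  have -> : (h^-1)%:C%C * (L (t + h) - L t) - v =
      w * (q.[L (t + h)] - q.[L t]) / (q.[L (t + h)] * q.[L t]).
    have : q.[L (t + h)] * (L (t + h) - L t) = - h%:C%C * w.
      rewrite -fq !fL // ray_sub; congr (_ * w).
      by rewrite -rmorphN; congr (_%:C%C); ring.
    rewrite mulrC => /(canRL (mulfK qh0)) ->.
    rewrite /v -qt fmorphV; field.
    by rewrite qh0 qt0 hC.
  rewrite !modulusM modulusV modulusM ltr_pdivrMr; last first.
    by rewrite mulr_gt0 // modulus_gt0.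
  apply: (@le_lt_trans _ _ (W * modulus (q.[L (t + h)] - q.[L t]))).
    by rewrite ler_wpM2r ?modulus_ge0 // /W lerDl.
  rewrite -ltr_pdivlMl // mulrC.
  apply: lt_le_trans q2 _.
  by rewrite ler_pM2r ?invr_gt0 // ler_pM2l // -/Q ler_pM2r // ltW.
have ReC (x : R) (y z : R[i]) :
    complex.Re (x%:C%C * (y - z)) = x * (complex.Re y - complex.Re z).
  by case: y z => ? ? [? ?] /=; rewrite mul0r subr0.
have ImC (x : R) (y z : R[i]) :
    complex.Im (x%:C%C * (y - z)) = x * (complex.Im y - complex.Im z).
  by case: y z => ? ? [? ?] /=; rewrite mul0r addr0.
have ReB (x y : R[i]) : complex.Re (x - y) = complex.Re x - complex.Re y.
  by case: x y => ? ? [].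
have ImB (x y : R[i]) : complex.Im (x - y) = complex.Im x - complex.Im y.
  by case: x y => ? ? [].
rewrite -/v; split; apply: is_derive_quotient => e /key[d d0 Hd]; exists d => // h h0 hd;
    apply: le_lt_trans (Hd h h0 hd); rewrite mulrC.
  by rewrite -ReC -ReB Re_le_modulus.
by rewrite -ImC -ImB Im_le_modulus.
Qed.

Lemma mul_conjc (R : realType) (z : R[i]) : z * z^*%C = (modulus z ^+ 2)%:C%C.
Proof.
rewrite sqr_modulus; case: z => a b.
by apply/eqP; rewrite eq_complex /=; apply/andP; split; apply/eqP; ring.
Qed.

Lemma cderive_velocity (R : realType) (g : R -> R[i]) (t : R) (v : R[i]) :
  cderive g t v -> velocity g t = v.
Proof.
move=> [dr di]; rewrite /velocity !derive1E.
by rewrite (@derive_val _ _ _ _ _ _ _ dr) (@derive_val _ _ _ _ _ _ _ di); case: v {dr di}.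
Qed.

Lemma lift_descent_path (R : realType) (f : {poly R[i]}) (w : R[i]) (T : R)
    (L : R -> R[i]) :
  w != 0 -> 0 < T <= 1 -> lift f (ray w) 0 T L ->
  (forall t, 0 < t < T -> f^`().[L t] != 0) -> descent_path f (Curve 0 T L).
Proof.
move=> w0 /andP[T0 T1] lL nc; have w0' : 0 < modulus w by rewrite modulus_gt0.
split=> //=; have [cL fL] := lL; have [cr ci] := (proj1 (ccontP 0 T L)) cL.
split=> //.
  exists [::] => t; rewrite interior_itv_bnd /= in_itv /= => tT _.
  have f't := nc t tT; have dL := lift_cderive lL tT f't.
  have [dr di] := dL.
  split; [exact: (@ex_derive _ _ _ _ _ _ _ dr)|exact: (@ex_derive _ _ _ _ _ _ _ di)|].
  move=> ft _; rewrite (cderive_velocity dL) gradient_modulusE //.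
  have m0 : 0 < modulus f.[L t] by rewrite modulus_gt0.
  have m'0 : 0 < modulus f^`().[L t] by rewrite modulus_gt0.
  have t10 : 0 < 1 - t by lra.
  (* The velocity is - w / f' and the gradient is f conj(f') / |f|, where f = (1 - t) w; this is the
     ratio of their lengths. *)
  exists (modulus f.[L t] / ((1 - t) * modulus f^`().[L t] ^+ 2)).
    by rewrite divr_gt0 // mulr_gt0 // exprn_gt0.
  rewrite mulrA -rmorphM /= mulrA.
  have -> : modulus f.[L t] / ((1 - t) * modulus f^`().[L t] ^+ 2) / modulus f.[L t] =
      ((1 - t) * modulus f^`().[L t] ^+ 2)^-1.
    by field; rewrite !gt_eqF.
  rewrite fmorphV rmorphM /= -mul_conjc fL; last lra.
  have tC : (1 - t)%:C%C != 0 :> R[i] by rewrite -modulus_gt0 modulus_real gtr0_norm.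
  have cC : (f^`().[L t])^*%C != 0 by rewrite conjc_eq0.
  rewrite /ray; move: (_%:C)%C tC (_^*)%C cC => k k0 c c0.
  by field; rewrite k0 c0 f't.
move=> t u; rewrite !in_itv /= => tT uT tu.
rewrite !fL // !modulus_ray ?ltr_pM2r //; lra.
Qed.

(** The inverse exists by the intermediate value theorem. It is continuous because it is monotone:
    near [s] it is enclosed between its values at [phi (t - e)] and [phi (t + e)], or by the
    end-points of the interval. *)
Lemma increasing_inverse (R : realType) (a b : R) (phi : R -> R) :
  a < b -> rcont a b phi ->
  (forall t u, a <= t -> u <= b -> t < u -> phi t < phi u) ->
  exists psi : R -> R, [/\ rcont (phi a) (phi b) psi,
    (forall s, phi a <= s <= phi b -> a <= psi s <= b /\ phi (psi s) = s),
    (forall t, a <= t <= b -> psi (phi t) = t) &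
    (forall s u, phi a <= s -> u <= phi b -> s < u -> psi s < psi u)].
Proof.
move=> ab cphi inc.
have le_inc t u : a <= t -> u <= b -> t <= u -> phi t <= phi u.
  by move=> at_ ub; rewrite le_eqVlt => /orP[/eqP ->|/(inc _ _ at_ ub)/ltW].
have pab : phi a <= phi b by apply: le_inc; lra.
pose psi s := xget a [set t | a <= t <= b /\ phi t = s].
have psiP s : phi a <= s <= phi b -> a <= psi s <= b /\ phi (psi s) = s.
  move=> sab; rewrite /psi; case: xgetP => [x _ //|none].
  have [||c] := @IVT R phi a b s (ltW ab); first exact/rcontP.
    by rewrite min_l // max_r.
  by rewrite in_itv /= => cab cs; case: (none c).
have psi_phi t : a <= t <= b -> psi (phi t) = t.
  move=> tab; have [|pt pp] := psiP (phi t).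
    by apply/andP; split; apply: le_inc; lra.
  case: (ltgtP (psi (phi t)) t) => // lt.
    by have := inc (psi (phi t)) t ltac:(lra) ltac:(lra) lt; rewrite pp ltxx.
  by have := inc t (psi (phi t)) ltac:(lra) ltac:(lra) lt; rewrite pp ltxx.
have psi_inc s u : phi a <= s -> u <= phi b -> s < u -> psi s < psi u.
  move=> as_ ub su; have [ps es] := psiP s ltac:(lra).
  have [pu eu] := psiP u ltac:(lra).
  rewrite ltNge; apply/negP => le.
  have := le_inc (psi u) (psi s) ltac:(lra) ltac:(lra) le.
  by rewrite es eu; lra.
exists psi; split=> // s sab e e0.
have [ps es] := psiP s sab; set t := psi s in ps es *.
have [dl dl0 Hl] : exists2 d, 0 < d &
    forall u, phi a <= u <= phi b -> s - d < u -> t - e < psi u.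
  case: (ltrP a (t - e)) => ta.
    have lt : phi (t - e) < s by rewrite -es; apply: inc; lra.
    exists (s - phi (t - e)); first lra.
    move=> u uab su; rewrite -(psi_phi (t - e)); last lra.
    by apply: psi_inc; [apply: le_inc| |]; lra.
  case: (ltrP (t - e) a) => ta'.
    by exists 1 => // u uab _; have [? _] := psiP u uab; lra.
  have lt : phi a < s by rewrite -es; apply: inc; lra.
  exists (s - phi a); first lra.
  move=> u uab su; have -> : t - e = psi (phi a) by rewrite psi_phi; lra.
  by apply: psi_inc; lra.
have [dr dr0 Hr] : exists2 d, 0 < d &
    forall u, phi a <= u <= phi b -> u < s + d -> psi u < t + e.
  case: (ltrP (t + e) b) => tb.
    have lt : s < phi (t + e) by rewrite -es; apply: inc; lra.
    exists (phi (t + e) - s); first lra.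
    move=> u uab su; rewrite -(psi_phi (t + e)); last lra.
    by apply: psi_inc; [|apply: le_inc|]; lra.
  case: (ltrP b (t + e)) => tb'.
    by exists 1 => // u uab _; have [? _] := psiP u uab; lra.
  have lt : s < phi b by rewrite -es; apply: inc; lra.
  exists (phi b - s); first lra.
  move=> u uab su; have -> : t + e = psi (phi b) by rewrite psi_phi; lra.
  by apply: psi_inc; lra.
exists (Num.min dl dr); first by rewrite lt_min dl0.
move=> u uab; rewrite lt_min !ltr_norml => /andP[ul ur].
by have := Hl u uab ltac:(lra); have := Hr u uab ltac:(lra); lra.
Qed.

Lemma same_pathE (R : realType) (c d : curve R) :
  same_path c d <-> exists phi : R -> R,
    [/\ rcont (lo c) (hi c) phi,
        (forall t u, lo c <= t -> u <= hi c -> t < u -> phi t < phi u),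
        phi (lo c) = lo d, phi (hi c) = hi d &
        forall t, lo c <= t <= hi c -> c t = d (phi t)].
Proof.
have domE t : (t \in dom c) = (lo c <= t <= hi c) by rewrite in_itv.
split=> -[phi [cp ip lp hp pE]]; exists phi; split=> //; try exact/rcontP.
- by move=> t u ct uc tu; apply: ip; rewrite ?domE //; lra.
- by move=> t u; rewrite !domE => tc uc; apply: ip; lra.
Qed.

Lemma same_path_sym (R : realType) (c d : curve R) :
  lo c < hi c -> same_path c d -> same_path d c.
Proof.
move=> ab /same_pathE[phi [cp ip lp hp pE]]; apply/same_pathE.
have [psi [cs sP sp si]] := increasing_inverse ab cp ip.
exists psi; rewrite -lp -hp; split=> //.
- by apply: sp; lra.
- by apply: sp; lra.
- by move=> t tab; have [ps es] := sP t tab; rewrite pE // es.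
Qed.

Lemma same_path_trans (R : realType) (c d e : curve R) :
  same_path c d -> same_path d e -> same_path c e.
Proof.
move=> /same_pathE[phi [cp ip lp hp pE]] /same_pathE[psi [cs is_ ls hs sE]].
apply/same_pathE.
have range t : lo c <= t <= hi c -> lo d <= phi t <= hi d.
  move=> tc; rewrite -lp -hp; apply/andP; split.
    have : lo c <= t by lra.
    by rewrite le_eqVlt => /orP[/eqP -> //|lt]; apply/ltW/ip; lra.
  have : t <= hi c by lra.
  by rewrite le_eqVlt => /orP[/eqP -> //|lt]; apply/ltW/ip; lra.
exists (psi \o phi); split=> /=; rewrite ?lp ?hp //.
- move=> t tc ep ep0; have [d1 d10 Hd1] := cs _ (range t tc) _ ep0.
  have [d2 d20 Hd2] := cp t tc _ d10.
  by exists d2 => // u uc ut; apply: Hd1; [exact: range|exact: Hd2].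
- move=> t u ct uc tu; apply: is_; last exact: ip.
    by have := range t ltac:(lra); lra.
  by have := range u ltac:(lra); lra.
- by move=> t tc; rewrite pE // sE // range.
Qed.

Lemma same_path_refl (R : realType) (c d : curve R) :
  lo c = lo d -> hi c = hi d -> (forall t, lo c <= t <= hi c -> c t = d t) ->
  same_path c d.
Proof.
move=> l h cd; apply/same_pathE; exists id; split=> //.
by move=> t _ e e0; exists e.
Qed.

Lemma same_path_ends (R : realType) (c d : curve R) :
  lo c < hi c -> same_path c d -> source c = source d /\ target c = target d.
Proof.
move=> ab /same_pathE[phi [_ _ lp hp pE]].
by split; rewrite /source /target pE ?lp ?hp //; lra.
Qed.

Lemma rcont_modulus (R : realType) (a b : R) (F : R -> R[i]) :
  ccont a b F -> rcont a b (fun t => modulus (F t)).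
Proof.
move=> cF t tab e e0; have [d d0 Hd] := cF t tab e e0.
by exists d => // u uab ut; apply: le_lt_trans (modulus_sub_le _ _) _; exact: Hd.
Qed.

Lemma rcont_div (R : realType) (a b : R) (g h : R -> R) :
  rcont a b g -> rcont a b h -> (forall t, a <= t <= b -> h t != 0) ->
  rcont a b (fun t => g t / h t).
Proof.
move=> /rcontP/subspace_continuousP cg /rcontP/subspace_continuousP ch h0.
apply/rcontP/subspace_continuousP => t tab.
apply: cvgM; first exact: cg.
apply: cvgV; last exact: ch.
by apply: h0; move: tab; rewrite /= in_itv.
Qed.

(** The velocity is a multiple of f conj(f'), and multiplying it by f' gives a real multiple of f.
    At a zero of f' the chain rule gives 0, hence [mu = 0]. *)
Lemma descent_horner_derive (R : realType) (f : {poly R[i]}) (I : interval R)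
    (g : R -> R[i]) :
  steepest_descent f I g ->
  exists S : seq R, forall t, interior [set` I] t -> t \notin S -> f.[g t] != 0 ->
    exists mu : R, cderive (fun s => f.[g s]) t (- mu%:C%C * f.[g t]).
Proof.
move=> [_ _ [S HS] _]; exists S => t tI tS ft; have [dr di vel] := HS t tI tS.
have dg : cderive g t (velocity g t).
  by split; rewrite /velocity /= derive1E; [exact: (derivableP dr)|exact: (derivableP di)].
have dF := cderive_horner f dg.
have [f't|f't] := eqVneq f^`().[g t] 0.
  by exists 0; rewrite oppr0 mul0r; rewrite f't mul0r in dF.
have [lam lam0 vE] := vel ft f't.
exists (lam * (modulus f.[g t])^-1 * modulus f^`().[g t] ^+ 2).
suff -> : - (lam / modulus f.[g t] * modulus f^`().[g t] ^+ 2)%:C%C * f.[g t] =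
    f^`().[g t] * velocity g t by [].
rewrite vE gradient_modulusE //.
have -> : (lam / modulus f.[g t] * modulus f^`().[g t] ^+ 2)%:C%C =
    lam%:C%C * ((modulus f.[g t])^-1%:C%C * (f^`().[g t] * (f^`().[g t])^*%C)) :> R[i].
  by rewrite mul_conjc -!rmorphM mulrA.
ring.
Qed.

(* Off a finite set, the derivative of f o c is a real multiple of f o c; hence
   Im (f o c * conj w) / |f o c| has derivative 0, where w = f (c (lo c)). *)
Lemma descent_on_ray (R : realType) (f : {poly R[i]}) (c : curve R) :
  descent_path f c -> f.[source c] != 0 ->
  forall t, lo c <= t <= hi c ->
    f.[c t] = (modulus f.[c t] / modulus f.[source c])%:C%C * f.[source c].
Proof.
case: c => a b g [/= ab sd]; rewrite /source /=; set w := f.[g a] => w0.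
have [S HS] := descent_horner_derive sd.
have [cr ci _ dec] := sd.
have cF : ccont a b (fun s => f.[g s]) by apply/ccont_horner/ccontP.
have w0' : 0 < modulus w by rewrite modulus_gt0.
have dec' t u : a <= t -> u <= b -> t < u -> modulus f.[g u] < modulus f.[g t].
  by move=> at_ ub tu; apply: dec => //; rewrite /dom in_itv /=; lra.
have Fpos t : a <= t < b -> 0 < modulus f.[g t].
  by move=> tab; apply: le_lt_trans (modulus_ge0 f.[g b]) _; apply: dec'; lra.
have Fle t : a <= t <= b -> modulus f.[g t] <= modulus w.
  move=> /andP[]; rewrite le_eqVlt => /orP[/eqP <- //|at_ tb].
  by apply/ltW/dec'.
pose G s := f.[g s] * w^*%C.
have cG : ccont a b G.
  move=> t tab e e0; have [d d0 Hd] := cF t tab (e / modulus w) (divr_gt0 e0 w0').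
  exists d => // u uab ut; rewrite /G -mulrBl modulusM.
  have -> : modulus w^*%C = modulus w.
    by rewrite !modulusE; case: (w) => ? ? /=; rewrite sqrrN.
  by rewrite -ltr_pdivlMr //; exact: Hd.
have modG t : modulus (G t) = modulus f.[g t] * modulus w.
  rewrite modulusM; congr (_ * _).
  by rewrite !modulusE; case: (w) => ? ? /=; rewrite sqrrN.
(* The time [b] is set aside and recovered by continuity at the end: [f] may vanish there, and [r]
   divides by |f|. *)
have ImG t : a <= t < b -> complex.Im (G t) = 0.
  move=> tab; pose r s := im_part G s / modulus f.[g s].
  have at_ : a <= t by lra.
  have cr' : rcont a t r.
    have ct : ccont a t (fun s => f.[g s]) by apply: ccont_sub cF; lra.
    have cGt : ccont a t G by apply: ccont_sub cG; lra.
    apply: rcont_div; last by move=> s sab; rewrite gt_eqF // Fpos; lra.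
      by apply/rcontP; have [] := (proj1 (ccontP a t G)) cGt.
    exact: rcont_modulus.
  have : r t = r a.
    apply: (constant_off_finite (S := S) at_ cr'); last lra.
    move=> s sat sS; have Fs : f.[g s] != 0 by rewrite -modulus_gt0 Fpos; lra.
    have [|mu dF] := HS s _ sS Fs.
      by rewrite /dom interior_itv_bnd /= in_itv /=; lra.
    have dm := is_derive_modulus Fs dF.
    have [_ dI] := cderiveM dF (cderive_cst w^*%C s).
    have m0 : modulus f.[g s] != 0 by rewrite gt_eqF // modulus_gt0.
    have dV := is_deriveV m0 dm.
    have -> : r = im_part G * (fun s => (modulus f.[g s])^-1) by [].
    apply: is_derive_eq; rewrite /GRing.scale /= mulr0 addr0.
    have -> : complex.Im (- mu%:C%C * f.[g s] * w^*%C) = - mu * im_part G s.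
      rewrite /im_part /G.
      by case: (w) (f.[g s]) => w1 w2 [x y] /=; ring.
    have -> : complex.Re f.[g s] * complex.Re (- mu%:C%C * f.[g s]) +
        complex.Im f.[g s] * complex.Im (- mu%:C%C * f.[g s]) =
        - mu * modulus f.[g s] ^+ 2.
      by rewrite sqr_modulus; case: (f.[g s]) => x y /=; ring.
    by field.
  have -> : r a = 0.
    rewrite /r /im_part /G; have -> : complex.Im (w * w^*%C) = 0 by rewrite mul_conjc.
    by rewrite mul0r.
  have m0 : modulus f.[g t] != 0 by rewrite gt_eqF // Fpos.
  by rewrite /r => /eqP; rewrite mulf_eq0 invr_eq0 (negPf m0) orbF => /eqP.
have Gpos t : a <= t < b -> G t = (modulus f.[g t] * modulus w)%:C%C.
  move=> tab; pose K := modulus w ^+ 2.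
  have GE s : a <= s < b -> G s = (complex.Re (G s))%:C%C.
    by move=> /ImG; case: (G s) => x y /= ->.
  have absG s : a <= s < b -> `|complex.Re (G s)| = modulus f.[g s] * modulus w.
    by move=> sab; rewrite -modG [in RHS]GE // modulus_real.
  have tat : a <= t <= t by lra.
  have K0 : 0 < K by rewrite exprn_gt0.
  (* [G] is real, starts at [K] and satisfies 0 < |G| <= K, so it avoids the points 0 and 2 K where
     the circle of centre [K] and radius [K] crosses the real axis. Remaining inside this circle, it
     is positive. *)
  have inside : modulus (G t - K%:C%C) < K.
    apply: (@ccont_stays_inside R a t) tat.
    - by apply: ccont_sub cG; lra.
    - by rewrite /G -/w mul_conjc subrr modulus0.
    move=> s sat; rewrite GE -?rmorphB ?modulus_real; last lra.
    have := absG s ltac:(lra); have := Fpos s ltac:(lra); have := Fle s ltac:(lra).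
    set x := complex.Re _; set m := modulus f.[_] => mw m0 xm.
    have : 0 < m * modulus w <= K.
      by rewrite mulr_gt0 //= /K expr2 ler_pM2r.
    rewrite -xm; case: (lerP 0 x) => x0.
      rewrite (ger0_norm x0) => ?.
      by case: (lerP 0 (x - K)) => h; rewrite ?(ger0_norm h) ?(ltr0_norm h); lra.
    by rewrite (ltr0_norm x0) => ?; rewrite ltr0_norm; lra.
  have := absG t tab; rewrite [G t]GE //= => <-.
  rewrite gtr0_norm //; move: inside; rewrite GE // -rmorphB modulus_real ltr_norml.
  lra.
have wC : w^*%C != 0 by rewrite conjc_eq0.
have Fray t : a <= t < b -> f.[g t] = (modulus f.[g t] / modulus w)%:C%C * w.
  move=> tab; apply: (mulIf wC); rewrite -mulrA mul_conjc -rmorphM -[LHS]/(G t) Gpos //.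
  by congr (_%:C%C); field; rewrite gt_eqF.
move=> t tab; case: (ltrP t b) => tb; first by apply: Fray; lra.
have -> : t = b by lra.
apply: (@ccont_eq_at_end R a b (fun s => f.[g s])
  (fun s => (modulus f.[g s] / modulus w)%:C%C * w)) => // s sab e e0.
have [d d0 Hd] := rcont_modulus cF sab e0; exists d => // u uab us.
rewrite -mulrBl -rmorphB modulusM modulus_real -mulrBl normrM normfV.
by rewrite (gtr0_norm w0') divfK ?gt_eqF //; exact: Hd.
Qed.

(* The parameter of the canonical form is the relative loss of modulus. *)
Lemma descent_canonical (R : realType) (f : {poly R[i]}) (c : curve R) :
  descent_path f c -> f.[source c] != 0 ->
  exists T L, [/\ 0 < T <= 1, lift f (ray f.[source c]) 0 T L, L 0 = source c &
    same_path c (Curve 0 T L)].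
Proof.
move=> dc w0; have onray := descent_on_ray dc w0.
case: c dc w0 onray => a b g [/= ab sd]; rewrite /source /=; set w := f.[g a] => w0 onray.
have [cr ci _ dec] := sd.
have cg : ccont a b g by apply/ccontP.
have w0' : 0 < modulus w by rewrite modulus_gt0.
have dec' t u : a <= t -> u <= b -> t < u -> modulus f.[g u] < modulus f.[g t].
  by move=> at_ ub tu; apply: dec => //; rewrite /dom in_itv /=; lra.
pose th t := 1 - modulus f.[g t] / modulus w.
have cth : rcont a b th.
  move=> t tab e e0; have ew0 : 0 < e * modulus w by rewrite mulr_gt0.
  have [d d0 Hd] := rcont_modulus (ccont_horner f cg) tab ew0.
  exists d => // u uab ut; 
  have -> : th u - th t = (modulus f.[g t] - modulus f.[g u]) / modulus w.
    by rewrite /th; ring.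
  by rewrite normrM normfV (gtr0_norm w0') ltr_pdivrMr // distrC; exact: Hd.
have ith t u : a <= t -> u <= b -> t < u -> th t < th u.
  move=> at_ ub tu; rewrite /th ltrD2l ltrN2 ltr_pM2r ?invr_gt0 //.
  exact: dec'.
have [psi [cpsi psiP psith psii]] := increasing_inverse ab cth ith.
have tha : th a = 0 by rewrite /th divff ?subrr // gt_eqF.
rewrite tha in cpsi psiP psii.
exists (th b), (g \o psi); split.
- apply/andP; split; first by rewrite -tha; apply: ith; rewrite ?lexx.
  by rewrite /th gerBl divr_ge0 ?modulus_ge0.
- split.
    move=> s sab e e0; have [ps _] := psiP s sab.
    have [d d0 Hd] := cg _ ps e e0; have [d' d'0 Hd'] := cpsi s sab d d0.
    exists d' => // u uab us; apply: Hd; last exact: Hd'.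
    by have [] := psiP u uab.
  move=> s sab; have [ps es] := psiP s sab.
  rewrite /= onray // -/w /ray; congr (_%:C%C * _).
  by rewrite -[in RHS]es /th opprB addrC subrK.
- by rewrite /= -tha psith // lexx ltW.
- apply/same_pathE; exists th; split=> // t tab.
  by rewrite /= psith.
Qed.

(** * Edges issued from a point *)

(** The points over [ray f.[z0] t] near [z0] stand for the germs of lifts issued from [z0]: the
    backward lift from such a point ends over [f.[z0]] near [z0], and separation leaves only [z0].
    All small [t] are treated, because a lift to be identified may be defined only for a short
    time. *)
Lemma descent_germs (R : realType) (f : {poly R[i]}) (z0 : R[i]) :
  (1 < size f)%N -> f \is monic -> f.[z0] != 0 ->
  exists2 rho1, 0 < rho1 & forall rho, 0 < rho <= rho1 ->
  exists2 t1, 0 < t1 < 1 & forall t, 0 < t <= t1 ->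
  [/\ exists zs : seq R[i], [/\ uniq zs, size zs = mup z0 (f - f.[z0]%:P) &
        forall z, (z \in zs) = (f.[z] == ray f.[z0] t) && (modulus (z - z0) < rho)],
      forall y, f.[y] = ray f.[z0] t -> modulus (y - z0) < rho ->
        exists L, [/\ lift f (ray f.[z0]) 0 t L, L 0 = z0 & L t = y],
      forall L, lift f (ray f.[z0]) 0 t L -> L 0 = z0 -> modulus (L t - z0) < rho &
      forall z, f.[z] = ray f.[z0] t -> f^`().[z] != 0].
Proof.
move=> sf fm; set w0 := f.[z0] => w0n; have w0p : 0 < modulus w0 by rewrite modulus_gt0.
have [r1 r10 sep] := fiber_separated w0 sf fm.
have [r2 r20 count] := exact_fiber_count z0 sf fm.
have [eta1 eta10 crit] := critical_values_isolated w0 sf.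
exists (Num.min r1 r2); first by rewrite lt_min r10.
move=> rho /andP[rho0]; rewrite le_min => /andP[rr1 rr2].
have [|eta2 eta20 cnt] := count rho; first by rewrite rho0.
(* Other values within [m] of [w0] are not critical ([eta1]) and have the exact number of preimages
   ([eta2]); the third bound keeps curves trapped in the disc. *)
pose m := Num.min (Num.min eta1 eta2) (rho ^+ (size f).-1).
have m0 : 0 < m by rewrite !lt_min eta10 eta20 exprn_gt0.
have [m1 m2 m3] : [/\ m <= eta1, m <= eta2 & m <= rho ^+ (size f).-1].
  by rewrite /m !ge_min !lexx ?orbT.
exists (Num.min (1 / 2) (m / modulus w0 / 2)).
  rewrite lt_min gt_min; apply/andP; split; last by apply/orP; left; lra.
  by apply/andP; split; [lra|rewrite !divr_gt0].
move=> t; rewrite le_min => /andP[t0 /andP[t12 tm]].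
have near u : 0 <= u <= t -> modulus (ray w0 u - w0) < m.
  move=> ut; have -> : ray w0 u - w0 = ray w0 u - ray w0 0.
    by rewrite /ray subr0 mul1r.
  rewrite ray_sub modulusM modulus_real sub0r normrN ger0_norm; last lra.
  rewrite -ltr_pdivlMr //; have : 0 < m / modulus w0 by rewrite divr_gt0.
  lra.
have rayne u : 0 < u -> ray w0 u != w0.
  move=> u0; rewrite -subr_eq0; have -> : ray w0 u - w0 = (- u)%:C%C * w0.
    by rewrite /ray rmorphN rmorphB rmorph1; ring.
  by rewrite -modulus_gt0 modulusM mulr_gt0 // modulus_real normrN gtr0_norm.
have nc u z : 0 < u <= t -> f.[z] = ray w0 u -> f^`().[z] != 0.
  move=> ut fz; apply: crit; last by rewrite fz rayne; lra.
  by rewrite fz (lt_le_trans _ m1) // near; lra.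
have trap a b L : ccont a b L ->
    (forall s, a <= s <= b -> exists2 u, 0 <= u <= t & f.[L s] = ray w0 u) ->
    modulus (L a - z0) < rho -> forall s, a <= s <= b -> modulus (L s - z0) < rho.
  move=> cL fL; apply: (@trapped R f w0 z0 rho a b) => //.
    exact: separated_le sep.
  by move=> s /fL[u ut ->]; rewrite (lt_le_trans (near u ut)).
split; last by move=> z; apply: nc; lra.
- apply: cnt; last by rewrite rayne.
  by rewrite (lt_le_trans _ m2) // near; lra.
- move=> y fy yz.
  (* The ray is run backwards, from time [- t] to time 0. No critical value occurs before time 0, so
     the lift gets there. *)
  have [|||c [L' tc [lL' L't nL' cend]]] :=
    @maximal_lift R f (fun s => ray w0 (- s)) (- t) 0 y sf fm.
  + lra.
  + have := ccont_opp (@ccont_ray R w0 0 t); rewrite oppr0.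
    by [].
  + by rewrite opprK.
  have c0 : c = 0.
    case: cend => // Lc; apply/eqP/negPn/negP => cn0.
    have /negP[] := nc (- c) (L' c) ltac:(lra) ltac:(by apply: (proj2 lL'); lra).
    by rewrite Lc.
  rewrite {}c0 in tc lL' nL' *.
  have L'0 : L' 0 = z0.
    have fL'0 : f.[L' 0] = w0.
      by rewrite (proj2 lL') ?oppr0 /ray ?subr0 ?mul1r //; lra.
    have L'0z : modulus (L' 0 - z0) < rho.
      apply: (trap (- t) 0 L'); [exact: (proj1 lL')| |by rewrite L't|lra].
      by move=> s st; exists (- s); [lra|apply: (proj2 lL')].
    have [//|ne] := eqVneq (L' 0) z0.
    suff : false by []; have := sep _ _ fL'0 erefl ne; lra.
  exists (fun s => L' (- s)); split.
  + have := lift_opp lL'; rewrite oppr0 opprK.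
    rewrite (_ : (fun s => ray w0 (- - s)) = ray w0) //.
    by apply/funext => s; rewrite opprK.
  + by rewrite oppr0.
  + by [].
- move=> L [cL fL] L0; apply: (trap 0 t L) => //; last lra.
    by move=> s st; exists s => //; exact: fL.
  by rewrite L0 subrr modulus0.
Qed.

(** The canonical form of an edge. When [f.[z0]] is nonzero, the ray vanishes at time 1 only, so the
    zeros of f' are the only ones to exclude before [T]. *)
Definition is_edge (R : realType) (f : {poly R[i]}) (z0 : R[i]) (T : R)
    (L : R -> R[i]) :=
  [/\ 0 < T <= 1, lift f (ray f.[z0]) 0 T L, L 0 = z0,
      (forall t, 0 < t < T -> f^`().[L t] != 0) &
      f.[L T] = 0 \/ f^`().[L T] = 0].

Lemma edge_end (R : realType) (f : {poly R[i]}) (z0 : R[i]) (T : R)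
    (L : R -> R[i]) :
  f.[z0] != 0 -> is_edge f z0 T L -> forall t, 0 < t < T -> f.[L t] != 0.
Proof.
move=> w0 [T01 [_ fL] _ _ _] t tT; rewrite fL; last lra.
rewrite -modulus_gt0 modulus_ray; last lra.
by rewrite mulr_gt0 ?modulus_gt0 //; lra.
Qed.

(** Uniqueness of lifts propagates the agreement from [t] over the shorter edge; its end is a zero
    of f or f', which cannot be interior to the longer one. *)
Lemma is_edge_agree (R : realType) (f : {poly R[i]}) (z : R[i]) (T T' t : R)
    (L L' : R -> R[i]) :
  (1 < size f)%N -> f.[z] != 0 -> is_edge f z T L -> is_edge f z T' L' ->
  0 < t < T -> t < T' -> L t = L' t ->
  T = T' /\ forall u, 0 <= u <= T -> L u = L' u.
Proof.
move=> sf f0 e1 e2 tT tT' Lt.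
wlog TT' : T T' L L' e1 e2 tT tT' Lt / T <= T'.
  move=> H; case: (lerP T T') => TT'; first exact: H.
  have [TE agree] := H T' T L' L e2 e1 ltac:(lra) ltac:(lra) (esym Lt) (ltW TT').
  by split=> [//|u uT]; rewrite agree // TE.
have end2 := edge_end f0 e2.
have [T01 lL L0 nL endL] := e1; have [T'01 lL' L'0 nL' _] := e2.
have agree : forall u, 0 <= u <= T -> L u = L' u.
  apply: (@lift_unique_from R f (ray f.[z]) 0 T t) => //; try lra.
    by apply: lift_sub lL'; lra.
  exact: nL.
split=> //; apply/eqP; rewrite eq_le TT' /= leNgt; apply/negP => TT.
have LT : L T = L' T by apply: agree; lra.
have TT0 : 0 < T < T' by lra.
by case: endL; rewrite LT => /eqP; rewrite ?(negPf (end2 _ TT0)) ?(negPf (nL' _ TT0)).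
Qed.

Lemma lift_follows_edge (R : realType) (f : {poly R[i]}) (z : R[i]) (T T' t : R)
    (L M : R -> R[i]) :
  (1 < size f)%N -> is_edge f z T L -> lift f (ray f.[z]) 0 T' M ->
  0 < t < T -> t <= T' -> M t = L t ->
  forall u, 0 <= u <= T' -> u <= T -> M u = L u.
Proof.
move=> sf [T01 lL L0 nL endL] lM tT tT' MLt u uT' uT.
pose b := Num.min T' T.
have [bT' bT] : b <= T' /\ b <= T by rewrite /b !ge_min !lexx orbT.
have tb : t <= b by rewrite le_min; apply/andP; split; lra.
have ub : u <= b by rewrite le_min; apply/andP; split; lra.
have ub0 : 0 <= u <= b by lra.
apply/esym; move: u {uT' uT ub} ub0.
apply: (@lift_unique_from R f (ray f.[z]) 0 b t L M sf).
- by apply: lift_sub lL; lra.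
- by apply: lift_sub lM; lra.
- lra.
- exact: esym.
- exact: nL.
- by move=> v vb; apply: nL; lra.
Qed.

Lemma lift_extends_to_edge (R : realType) (f : {poly R[i]}) (z : R[i]) (t : R)
    (L : R -> R[i]) :
  (1 < size f)%N -> f \is monic -> 0 < t < 1 -> lift f (ray f.[z]) 0 t L ->
  L 0 = z -> (forall u, 0 < u <= t -> f^`().[L u] != 0) ->
  exists T M, [/\ is_edge f z T M, t < T & M t = L t].
Proof.
move=> sf fm t01 lL L0 nL.
have [|||c [M tc [lM Mt nM cend]]] := @maximal_lift R f (ray f.[z]) t 1 (L t) sf fm.
- lra.
- exact: ccont_ray.
- by apply: (proj2 lL); lra.
have f't : f^`().[L t] != 0 by apply: nL; lra.
have tltc : t < c.
  rewrite lt_neqAle; apply/andP; split; last lra.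
  by apply/eqP => cE; case: cend => [|/eqP]; [lra|rewrite -cE Mt (negPf f't)].
have abc : 0 <= t <= c by lra.
have lG := lift_glue abc (esym Mt) lL lM.
have t0 : 0 <= t by lra.
exists c, (fun u => if u <= t then L u else M u); split=> //; last by rewrite lexx.
split=> //; first lra.
- by rewrite t0.
- move=> u uc; case: (lerP u t) => ut; [apply: nL|apply: nM]; lra.
rewrite leNgt tltc /=; case: cend => [cE|]; [left|by right].
by rewrite (proj2 lM) ?cE /ray ?subrr ?mul0r //; lra.
Qed.

Lemma descent_edges (R : realType) (f : {poly R[i]}) (z0 : R[i]) (k : nat) :
  (1 < size f)%N -> f \is monic -> f.[z0] != 0 -> k = mup z0 (f - f.[z0]%:P) ->
  exists T : 'I_k -> R, exists L : 'I_k -> R -> R[i],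
  [/\ forall i, is_edge f z0 (T i) (L i),
      forall i j t, 0 < t < T i -> t < T j -> L i t = L j t -> i = j &
      forall T' M, 0 < T' <= 1 -> lift f (ray f.[z0]) 0 T' M -> M 0 = z0 ->
        exists i, forall t, 0 <= t <= T' -> t <= T i -> M t = L i t].
Proof.
move=> sf fm w0 kE; have [rho rho0 H] := descent_germs sf fm w0.
have [|t1 t11 germ] := H rho; first by rewrite rho0 lexx.
have [[zs [uzs szs zsP]] back _ _] := germ t1 ltac:(lra).
have full y : f.[y] = ray f.[z0] t1 -> modulus (y - z0) < rho ->
    exists T L, [/\ is_edge f z0 T L, L t1 = y & t1 < T].
  move=> fy yz; have [L [lL L0 L1]] := back y fy yz.
  have nL u : 0 < u <= t1 -> f^`().[L u] != 0.
    by move=> ut; have [_ _ _ nc] := germ u ut; apply/nc/(proj2 lL); lra.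
  have [T [M [eM tT Mt]]] := lift_extends_to_edge sf fm t11 lL L0 nL.
  by exists T, M; rewrite Mt L1.
have zsN (i : 'I_k) : zs`_i \in zs by rewrite mem_nth // szs -kE.
have ex (i : 'I_k) : exists p : R * (R -> R[i]),
    [/\ is_edge f z0 p.1 p.2, p.2 t1 = zs`_i & t1 < p.1].
  have := zsN i; rewrite zsP => /andP[/eqP fy yz].
  by have [T [L HTL]] := full _ fy yz; exists (T, L).
pose T i := (projT1 (cid (ex i))).1; pose L i := (projT1 (cid (ex i))).2.
have TL i : [/\ is_edge f z0 (T i) (L i), L i t1 = zs`_i & t1 < T i].
  by rewrite /T /L; case: (cid _).
have disj i j t : 0 < t < T i -> t < T j -> L i t = L j t -> i = j.
  move=> ti tj Lt; have [ei Li1 t1i] := TL i; have [ej Lj1 t1j] := TL j.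
  have [_ agree] := is_edge_agree sf w0 ei ej ti tj Lt.
  have : L i t1 = L j t1 by apply: agree; lra.
  rewrite Li1 Lj1 => /eqP; rewrite nth_uniq // ?szs -?kE // => /eqP ij.
  exact: val_inj.
exists T, L; split=> // [i|T' M T'01 lM M0]; first by have [] := TL i.
(* [M] may stop before [t1], so the fiber is counted again at the time [t]: the [k] edges give [k]
   distinct points there, hence all of them, and [M t] is one of these. *)
pose t := Num.min T' t1.
have [tT' tt1] : t <= T' /\ t <= t1 by rewrite /t !ge_min !lexx orbT.
have t0 : 0 < t by rewrite lt_min; apply/andP; split; lra.
have t01 : 0 < t <= t1 by rewrite t0.
have [[zs' [uzs' szs' zsP']] _ stay' _] := germ t t01.
have tT i : 0 < t < T i by have [_ _ ti] := TL i; rewrite t0 (le_lt_trans tt1).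
have t0t : 0 <= t <= t by rewrite lexx ltW.
have zs'_lift N : lift f (ray f.[z0]) 0 t N -> N 0 = z0 -> N t \in zs'.
  by move=> lN N0; rewrite zsP' (proj2 lN t t0t) eqxx stay'.
have mem i : L i t \in zs'.
  have [[Ti lLi Li0 _ _] _ _] := TL i; apply: zs'_lift => //.
  by apply: lift_sub lLi => //; have /andP[_ /ltW] := tT i.
have Mmem : M t \in zs' by apply: zs'_lift => //; exact: lift_sub lM.
have inj : injective (fun i => L i t).
  move=> i j /= Lt; apply: (disj i j t) => //.
  by have /andP[] := tT j.
pose ls := [seq L i t | i <- enum 'I_k].
have uls : uniq ls by rewrite map_inj_uniq // enum_uniq.
have sls : {subset ls <= zs'} by move=> _ /mapP[i _ ->].
have [_ ls_zs'] : (size ls = size zs') * (ls =i zs').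
  by apply: uniq_min_size => //; rewrite szs' -kE size_map size_enum_ord.
move: Mmem; rewrite -ls_zs' => /mapP[i _ Mt]; exists i => u uT' uTi.
have [ei _ _] := TL i.
exact: (lift_follows_edge sf ei lM (tT i) tT' Mt).
Qed.

(** * Connectedness *)

Definition stop (R : realType) (f : {poly R[i]}) (z : R[i]) : Prop :=
  f.[z] = 0 \/ f^`().[z] = 0.

(** A relation and not a function: a zero of f' that is not a zero of f reaches itself as well as
    the ends of all its edges. The points reached are compared only modulo an equivalence containing
    the edges. *)
Definition reach (R : realType) (f : {poly R[i]}) (z v : R[i]) : Prop :=
  (stop f z /\ v = z) \/
  (f.[z] != 0 /\ exists T L, is_edge f z T L /\ L T = v).

Lemma not_stop (R : realType) (f : {poly R[i]}) (z : R[i]) :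
  ~ stop f z -> f.[z] != 0 /\ f^`().[z] != 0.
Proof. by move=> h; split; apply/eqP => e; apply: h; [left|right]. Qed.

Lemma reach_exists (R : realType) (f : {poly R[i]}) (z : R[i]) :
  (1 < size f)%N -> f \is monic -> exists v, reach f z v.
Proof.
move=> sf fm; have [sz|/not_stop[fz f'z]] := pselect (stop f z).
  by exists z; left.
have [|||c [L c01 [lL L0 nL cend]]] := @maximal_lift R f (ray f.[z]) 0 1 z sf fm.
- exact: ler01.
- exact: ccont_ray.
- by rewrite /ray subr0 mul1r.
have c0 : 0 < c.
  rewrite lt_neqAle; apply/andP; split; last lra.
  apply/eqP => cE; case: cend => [|/eqP]; first lra.
  by rewrite -cE L0 (negPf f'z).
exists (L c); right; split=> //; exists c, L; split=> //; split=> //.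
- by apply/andP; split; lra.
- by move=> t tc; apply: nL; lra.
- case: cend => [cE|]; [left|by right].
  by rewrite (proj2 lL) ?cE /ray ?subrr ?mul0r //; lra.
Qed.

Lemma is_edge_unique (R : realType) (f : {poly R[i]}) (z : R[i]) (T T' : R)
    (L L' : R -> R[i]) :
  (1 < size f)%N -> f.[z] != 0 -> f^`().[z] != 0 ->
  is_edge f z T L -> is_edge f z T' L' -> T <= T' -> L T = L' T'.
Proof.
move=> sf fz f'z eL eL' TT'; have end' := edge_end fz eL'.
have [T01 lL L0 nL endL] := eL; have [T'01 lL' L'0 nL' _] := eL'.
have agree : forall t, 0 <= t <= T -> L t = L' t.
  apply: (@lift_unique R f (ray f.[z]) 0 T) => //; first by apply: lift_sub lL'; lra.
    by rewrite L0.
  move=> t tT; have [->|t0] := eqVneq t 0; first by rewrite L0.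
  apply: nL; apply/andP; split; last lra.
  by rewrite lt_neqAle eq_sym t0; lra.
have LT : L T = L' T by apply: agree; lra.
move: TT'; rewrite le_eqVlt => /orP[/eqP <- //|TT'].
have TT0 : 0 < T < T' by lra.
by case: endL; rewrite LT => /eqP; rewrite ?(negPf (end' _ TT0)) ?(negPf (nL' _ TT0)).
Qed.

Lemma lift_affine (R : realType) (f : {poly R[i]}) (w : R -> R[i]) (a b k c : R)
    (L : R -> R[i]) :
  0 < k -> lift f w a b L ->
  lift f (fun u => w (k * u + c)) ((a - c) / k) ((b - c) / k) (fun u => L (k * u + c)).
Proof.
move=> k0 [cL fL].
have range u : (a - c) / k <= u <= (b - c) / k -> a <= k * u + c <= b.
  rewrite ler_pdivrMr // ler_pdivlMr // [u * k]mulrC; lra.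
split; last by move=> u /range; exact: fL.
move=> t /range tab e e0; have [d d0 Hd] := cL _ tab e e0.
exists (d / k); first exact: divr_gt0.
move=> u /range uab; rewrite ltr_pdivlMr // => ut; apply: Hd => //.
have -> : k * u + c - (k * t + c) = (u - t) * k by ring.
by rewrite normrM (gtr0_norm k0).
Qed.

Lemma ray_ray (R : realType) (w : R[i]) (s t : R) :
  ray (ray w t) s = ray w (t + s * (1 - t)).
Proof. by rewrite /ray mulrA -rmorphM; congr (_%:C%C * _); ring. Qed.

(** The edge from [M t] has its own time scale; the affine change of time u -> (u - t) / (1 - t)
    puts it on the ray of [z], where it can be glued to [M]. *)
Lemma reach_step (R : realType) (f : {poly R[i]}) (z v : R[i]) (t : R)
    (M : R -> R[i]) :
  f.[z] != 0 -> 0 < t < 1 -> lift f (ray f.[z]) 0 t M -> M 0 = z ->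
  (forall u, 0 < u <= t -> f^`().[M u] != 0) -> reach f (M t) v -> reach f z v.
Proof.
move=> fz t01 lM M0 nM.
have f't : f^`().[M t] != 0 by apply: nM; lra.
have fMt : f.[M t] = ray f.[z] t by apply: (proj2 lM); lra.
have ft : f.[M t] != 0.
  rewrite fMt -modulus_gt0 modulus_ray; last lra.
  by rewrite mulr_gt0 ?modulus_gt0 //; lra.
case=> [[[/eqP|/eqP]]|[_ [T [L [[T01 lL L0 nL endL] LT]]]]];
  rewrite ?(negPf ft) ?(negPf f't) //.
right; split=> //.
pose k := (1 - t)^-1; have k0 : 0 < k by rewrite invr_gt0; lra.
have kt : k * (1 - t) = 1 by rewrite mulVf //; lra.
pose c := - k * t.
have := lift_affine c k0 lL; rewrite fMt.
have -> : (fun u => ray (ray f.[z] t) (k * u + c)) = ray f.[z].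
  apply/funext => u; rewrite ray_ray; congr (ray _ _).
  have -> : t + (k * u + c) * (1 - t) = t + (k * (1 - t)) * (u - t) by rewrite /c; ring.
  by rewrite kt; ring.
have -> : (0 - c) / k = t by rewrite /c; field; rewrite gt_eqF.
have kV : k^-1 = 1 - t by rewrite /k invrK.
have -> : (T - c) / k = t + T * (1 - t).
  by rewrite -kV /c; field; rewrite gt_eqF.
set T' := t + T * (1 - t); set L' := fun u => _ => lL'.
have T0 : 0 < T * (1 - t) by rewrite mulr_gt0; lra.
have T1 : T * (1 - t) <= 1 - t by rewrite ler_piMl; lra.
have L't : L' t = M t.
  rewrite -L0 /L'; congr (L _); rewrite /c; ring.
have L'T : L' T' = L T.
  rewrite /L'; congr (L _).
  have -> : k * T' + c = (k * (1 - t)) * T by rewrite /T' /c; ring.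
  by rewrite kt mul1r.
have lG := lift_glue (b := t) (a := 0) (c := T') (L := M) (M := L')
  ltac:(rewrite /T'; lra) (esym L't) lM lL'.
exists T', (fun u => if u <= t then M u else L' u); split; last first.
  by rewrite ifF ?L'T //; rewrite /T'; lra.
split=> //.
- by rewrite /T'; lra.
- have t0 : 0 <= t by lra.
  by rewrite t0.
- move=> u uT; case: (lerP u t) => ut; first by apply: nM; lra.
  have uk : k * u + c = k * (u - t) by rewrite /c; ring.
  apply: nL; rewrite uk mulr_gt0 ?subr_gt0 //=.
  rewrite -[T]mul1r -kt -mulrA ltr_pM2l // mulrC -/T'.
  by rewrite /T' in uT; lra.
- by rewrite ifF ?L'T //; rewrite /T'; lra.
Qed.

(** Keeping [K] abstract separates the analysis from the graph; it will be instantiated with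
    connectedness of vertices, extended by equality to all points. *)
Record edge_equivalence (R : realType) (f : {poly R[i]})
    (K : R[i] -> R[i] -> Prop) : Prop := EdgeEquivalence {
  edge_equivalence_refl : forall x, K x x;
  edge_equivalence_sym : forall x y, K x y -> K y x;
  edge_equivalence_trans : forall y x z, K x y -> K y z -> K x z;
  edge_equivalence_edge : forall z T L, f.[z] != 0 -> f^`().[z] = 0 ->
    is_edge f z T L -> K z (L T) }.

Lemma reach_equivalent (R : realType) (f : {poly R[i]}) (K : R[i] -> R[i] -> Prop)
    (z v v' : R[i]) :
  (1 < size f)%N -> edge_equivalence f K -> reach f z v -> reach f z v' -> K v v'.
Proof.
move=> sf [Kr Ks Kt Ke].
have [f't|f't] := eqVneq f^`().[z] 0.
  have Kz u : reach f z u -> K z u.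
    by case=> [[_ ->]//|[fz [T [L [eL <-]]]]]; exact: Ke.
  by move=> /Kz/Ks h /Kz; exact: Kt.
case=> [[sz ->]|[fz [T [L [eL <-]]]]].
  by case=> [[_ ->]//|[fz _]]; case: sz => /eqP; rewrite ?(negPf fz) ?(negPf f't).
case=> [[[]/eqP]|[_ [T' [L' [eL' <-]]]]]; rewrite ?(negPf fz) ?(negPf f't) //.
case: (lerP T T') => TT'; first by rewrite (is_edge_unique sf fz f't eL eL').
by rewrite (is_edge_unique sf fz f't eL' eL) // ltW.
Qed.

Definition locally_equivalent (R : realType) (f : {poly R[i]})
    (K : R[i] -> R[i] -> Prop) (z0 : R[i]) : Prop :=
  exists2 r : R, 0 < r & forall z v v0, modulus (z - z0) < r ->
    reach f z v -> reach f z0 v0 -> K v v0.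

(** A descent starting near a zero of f with a small value is trapped in a disc, and the zero is the
    only point of this disc with small value where it can stop. *)
Lemma locally_equivalent_root (R : realType) (f : {poly R[i]})
    (K : R[i] -> R[i] -> Prop) (z0 : R[i]) :
  (1 < size f)%N -> f \is monic -> edge_equivalence f K -> f.[z0] = 0 ->
  locally_equivalent f K z0.
Proof.
move=> sf fm eK fz0; have [Kr _ _ _] := eK.
have [rho rho0 sep] := fiber_separated 0 sf fm.
have [eta eta0 crit] := critical_values_isolated 0 sf.
pose m := Num.min eta (rho ^+ (size f).-1).
have m0 : 0 < m by rewrite lt_min eta0 exprn_gt0.
have [m1 m2] : m <= eta /\ m <= rho ^+ (size f).-1 by rewrite /m !ge_min !lexx orbT.
have [r r0 Hr] := ccont_poly f z0 m0.
exists (Num.min r rho); first by rewrite lt_min r0.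
move=> z v v0; rewrite lt_min => /andP[zr zrho] zv z0v0.
have -> : v0 = z0 by case: z0v0 => [[_ ->]//|[/eqP]].
suff -> : v = z0 by exact: Kr.
have fzm : modulus f.[z] < m by have := Hr z zr; rewrite fz0 subr0.
have inside x : modulus (x - z0) < rho -> modulus f.[x] < m -> stop f x -> x = z0.
  move=> xr xm sx; have fx : f.[x] = 0.
    apply/eqP/negPn/negP => fx; case: sx => /eqP; first by rewrite (negPf fx).
    by apply/negP/crit => //; rewrite subr0 (lt_le_trans xm).
  have [//|ne] := eqVneq x z0.
  suff : false by []; have := sep _ _ fx fz0 ne; lra.
case: zv => [[sz ->]|[fz [T [L [[T01 lL L0 nL endL] <-]]]]]; first exact: inside.
have fL t : 0 <= t <= T -> modulus f.[L t] < m.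
  move=> tT; rewrite (proj2 lL) // modulus_ray; last lra.
  by apply: le_lt_trans fzm; rewrite ler_piMl ?modulus_ge0 //; lra.
apply: inside => //; last by apply: fL; lra.
apply: (@trapped R f 0 z0 rho 0 T) => //; last 1 first.
- lra.
- exact: (proj1 lL).
- by move=> t tT; rewrite subr0 (lt_le_trans (fL t tT)).
- by rewrite L0.
Qed.

Lemma critical_points_isolated (R : realType) (f : {poly R[i]}) (z0 : R[i]) :
  (1 < size f)%N ->
  exists2 r : R, 0 < r & forall z, modulus (z - z0) < r -> f^`().[z] = 0 -> z = z0.
Proof.
move=> sf; have [rs fE] := closed_field_poly_normal f^`().
have [|r r0 Hr] := @seq_pos_min R _ [seq z <- rs | z != z0] (fun z => modulus (z - z0)).
  by move=> z; rewrite mem_filter => /andP[ne _]; rewrite modulus_gt0 subr_eq0.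
exists r => // z zr fz; apply/eqP/negPn/negP => ne.
have : r <= modulus (z - z0); last by rewrite leNgt zr.
apply: Hr; rewrite mem_filter ne -root_prod_XsubC /=.
have : root f^`() z by apply/rootP.
by rewrite fE rootZ // lead_coef_eq0 deriv_neq0.
Qed.

Lemma modulus_ray_sub (R : realType) (w w' : R[i]) (t u : R) :
  0 <= u <= t -> t <= 1 ->
  modulus (ray w' u - w) <= modulus (w' - w) + t * modulus w.
Proof.
move=> ut t1; have u0 : 0 <= u by lra.
have u1 : 0 <= 1 - u by lra.
have -> : ray w' u - w = (1 - u)%:C%C * (w' - w) - u%:C%C * w.
  by rewrite /ray rmorphB rmorph1; ring.
apply: le_trans (modulus_triangle _ _) _.
rewrite modulusN !modulusM !modulus_real (ger0_norm u0) (ger0_norm u1).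
rewrite lerD // ?ler_piMl ?ler_wpM2r ?modulus_ge0 //; lra.
Qed.

(* A descent starting near z0 stays near z0 for a short time, and then either
   has met z0 or is close to one of the finitely many points reached from z0. *)
Lemma locally_equivalent_step (R : realType) (f : {poly R[i]})
    (K : R[i] -> R[i] -> Prop) (z0 : R[i]) :
  (1 < size f)%N -> f \is monic -> edge_equivalence f K -> f.[z0] != 0 ->
  (forall y, modulus f.[y] < modulus f.[z0] -> locally_equivalent f K y) ->
  locally_equivalent f K z0.
Proof.
move=> sf fm eK fz0 lower; have [Kr Ks Kt _] := eK.
have [rho1 rho10 germs] := descent_germs sf fm fz0.
have [rc rc0 crit] := critical_points_isolated z0 sf.
have [rs rs0 sep] := fiber_separated f.[z0] sf fm.
pose rho := Num.min rho1 (Num.min rc rs).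
have rho0 : 0 < rho by rewrite !lt_min rho10 rc0.
have [rho_1 rho_c rho_s] : [/\ rho <= rho1, rho <= rc & rho <= rs].
  by rewrite /rho !ge_min !lexx !orbT.
have [|t1 t11 germ] := germs rho; first by rewrite rho0.
set w0 := f.[z0] in fz0 lower germ sep *.
have w0p : 0 < modulus w0 by rewrite modulus_gt0.
(* With half of [rho], a point within [e <= sg] of the trapped descent is still within [rho] of
   [z0], where [back] applies. *)
set d := (size f).-1; pose sg := rho / 2.
have sg0 : 0 < sg by rewrite /sg; lra.
have [sg_c sg_s] : sg <= rc /\ sg <= rs by rewrite /sg; split; lra.
have sgd : 0 < sg ^+ d by rewrite exprn_gt0.
(* Following a ray for the time [t] costs at most a quarter of [sg ^+ d], and so will replacing [w0]
   by [f.[z]]; together they stay below the trapping bound. *)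
pose t := Num.min t1 (sg ^+ d / 4 / modulus w0).
have t0 : 0 < t by rewrite lt_min !divr_gt0 // andbT; lra.
have [tt1 tsg] : t <= t1 /\ t <= sg ^+ d / 4 / modulus w0.
  by rewrite /t !ge_min !lexx orbT.
have twsg : t * modulus w0 <= sg ^+ d / 4 by rewrite -ler_pdivlMr.
have [[zs [_ _ zsP]] back _ _] := germ t ltac:(lra).
have zsK y : y \in zs -> exists2 r : R, 0 < r & forall x v vy, modulus (x - y) < r ->
    reach f x v -> reach f y vy -> K v vy /\ K vy vy.
  rewrite zsP => /andP[/eqP fy _]; have [|r r0 Hr] := lower y.
    rewrite fy modulus_ray; last lra.
    by rewrite mulrBl mul1r gtrBl mulr_gt0.
  by exists r => // x v vy xr xv yv; split=> //; exact: Hr xv yv.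
(* A radius of local equivalence at each point of [zs]; the default 1 makes [ry] positive
   everywhere. *)
pose ry y := if pselect (y \in zs) is left yzs then projT1 (cid2 (zsK y yzs)) else 1.
have ry0 y : 0 < ry y by rewrite /ry; case: pselect => // yzs; case: (cid2 _).
have ryP y x v vy : y \in zs -> modulus (x - y) < ry y ->
    reach f x v -> reach f y vy -> K v vy.
  move=> yzs; rewrite /ry; case: pselect => // yzs'.
  case: (cid2 _) => r r0 Hr /= xr xv yv.
  by have [] := Hr x v vy xr xv yv.
have [r' r'0 Hr'] := @seq_pos_min R _ zs ry (fun y _ => ry0 y).
pose e := Num.min r' sg.
have e0 : 0 < e by rewrite lt_min r'0.
have [er esg] : e <= r' /\ e <= sg by rewrite /e !ge_min !lexx orbT.
pose m := Num.min (Num.min (e ^+ d) (sg ^+ d / 4)) (modulus w0).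
have m0 : 0 < m by rewrite !lt_min exprn_gt0 //= w0p andbT; lra.
have [me msg mw] : [/\ m <= e ^+ d, m <= sg ^+ d / 4 & m <= modulus w0].
  by rewrite /m !ge_min !lexx !orbT.
have t_lt1 : t < 1 by lra.
have [r r0 Hr] := ccont_poly f z0 m0.
move=> {rho10 rs0 tsg rho_1 t11}.
exists (Num.min r sg); first by rewrite lt_min r0.
move=> z v v0; rewrite lt_min => /andP[zr zsg] zv z0v0.
have [zz0|zz0] := eqVneq z z0.
  by rewrite zz0 in zv; exact: (reach_equivalent sf eK zv z0v0).
have fzm := Hr z zr; rewrite -/w0 in fzm.
have fz : f.[z] != 0.
  rewrite -modulus_gt0; have := modulus_sub_le f.[z] w0; rewrite ler_norml; lra.
have f'z : f^`().[z] != 0.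
  by apply: contra_neqN zz0 => /eqP f'z; apply: crit => //; exact: lt_le_trans sg_c.
have [|||c [L c0t [lL L0 nL cend]]] := @maximal_lift R f (ray f.[z]) 0 t z sf fm.
- exact: ltW.
- exact: ccont_ray.
- by rewrite /ray subr0 mul1r.
have stay s : 0 <= s <= c -> modulus (L s - z0) < sg.
  apply: (@trapped R f w0 z0 sg 0 c) => //.
  - exact: separated_le sep.
  - exact: (proj1 lL).
  - move=> u uc; rewrite (proj2 lL) //.
    apply: le_lt_trans (@modulus_ray_sub R w0 f.[z] t u _ (ltW t_lt1)) _; first lra.
    rewrite -/d; lra.
  - by rewrite L0.
move=> {twsg sgd msg mw m0 rho_s Hr zr r0 w0p}.
have c0 : 0 < c.
  rewrite lt_neqAle; apply/andP; split; last lra.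
  apply/eqP => cE; case: cend => [|/eqP]; first lra.
  by rewrite -cE L0 (negPf f'z).
(* A zero of f' met in the disc can only be [z0], and then [z] reaches [z0] itself. *)
have [f'c|f'c] := eqVneq f^`().[L c] 0.
  have c0c : 0 <= c <= c by rewrite lexx ltW.
  have Lc : L c = z0 by apply: crit => //; exact: lt_le_trans (stay c c0c) sg_c.
  have zz : reach f z z0.
    right; split=> //; exists c, L; split=> //; split=> //; last by right.
      lra.
    by move=> u uc; apply: nL; lra.
  have z0z0 : reach f z0 z0 by left; split=> //; right; rewrite -Lc.
  apply: (Kt z0 _ _ (reach_equivalent sf eK zv zz)).
  exact: (reach_equivalent sf eK z0z0 z0v0).
move=> {crit rho_c rc0 zsg}.
have cE : c = t by case: cend => // /eqP; rewrite (negPf f'c).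
rewrite {c}cE in lL nL stay f'c c0 c0t cend *.
have t0t : 0 <= t <= t by rewrite lexx ltW.
have fLt : f.[L t] = ray f.[z] t by exact: (proj2 lL).
have fLty : modulus (f.[L t] - ray w0 t) < e ^+ d.
  rewrite fLt /ray -mulrBr modulusM modulus_real ger0_norm; last lra.
  have : (1 - t) * modulus (f.[z] - w0) <= modulus (f.[z] - w0).
    by rewrite ler_piMl ?modulus_ge0 //; lra.
  lra.
(* A descent from [z0] passes through [y], and |f| is smaller at [y] than at [z0]; local equivalence
   at [y] compares it with the descent through [L t]. *)
have [y fy Ly] := near_fiber sf fm e0 fLty.
have yz0 : modulus (y - z0) < rho.
  have := modulus_dist (L t) y z0; rewrite (modulusB y (L t)).
  by have := stay t t0t; rewrite /sg in esg *; lra.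
move=> {me fzm fLty esg}.
have yzs : y \in zs by rewrite zsP fy eqxx.
have [v1 v1P] := reach_exists (L t) sf fm.
have [vy vyP] := reach_exists y sf fm.
have zv1 : reach f z v1.
  apply: (reach_step fz _ lL L0 _ v1P); first by rewrite t0.
  move=> u ut; have [->//|ne] := eqVneq u t.
  by move: ut => /andP[u0 ut]; apply: nL; rewrite (ltW u0) lt_neqAle ne.
have z0vy : reach f z0 vy.
  have [L' [lL' L'0 L't]] := back y fy yz0.
  rewrite -L't in vyP.
  apply: (reach_step fz0 _ lL' L'0 _ vyP); first by rewrite t0.
  move=> u /andP[u0 ut].
  have [|_ _ _ nc] := germ u; first by rewrite u0 (le_trans ut).
  by apply/nc/(proj2 lL'); rewrite ltW.
apply: (Kt v1 _ _ (reach_equivalent sf eK zv zv1)).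
apply: (Kt vy _ _ _ (reach_equivalent sf eK z0vy z0v0)).
apply: (ryP y (L t)) => //; apply: lt_le_trans Ly (le_trans er _); exact: Hr'.
Qed.

Lemma open_of_boxes (R : realType) (A : set (R * R)) :
  (forall p, A p -> exists2 e : R, 0 < e & forall q : R * R,
     `|q.1 - p.1| < e -> `|q.2 - p.2| < e -> A q) -> open A.
Proof.
move=> H; rewrite openE => p /H[e e0 He]; apply/nbhs_ballP; exists e => //= q [q1 q2].
by apply: He; rewrite distrC.
Qed.

Lemma modulus_box (R : realType) (p q : R * R) (e : R) :
  `|q.1 - p.1| < e / 2 -> `|q.2 - p.2| < e / 2 ->
  modulus ((q.1 +i* q.2)%C - (p.1 +i* p.2)%C) < e.
Proof.
by move=> h1 h2; have := modulus_le_ReIm ((q.1 +i* q.2)%C - (p.1 +i* p.2)%C) => /=; lra.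
Qed.

(** With [e >= 1] and [e > M], also M < e^deg f, so every point of the sublevel set is within [e] of
    one of the finitely many roots. *)
Lemma sublevel_bounded (R : realType) (f : {poly R[i]}) (M : R) :
  (1 < size f)%N -> f \is monic ->
  exists B : R, forall z, modulus f.[z] <= M -> modulus z <= B.
Proof.
move=> sf fm; have [rs fE] := monic_split fm.
pose e := Num.max M 0 + 1.
have e1 : 1 <= e by rewrite /e lerDr le_max lexx orbT.
have Me : M < e by rewrite /e ltr_pwDr // le_max lexx.
exists (\sum_(y <- rs) modulus y + e) => z fz.
have : modulus (f.[z] - 0) < e ^+ (size f).-1.
  rewrite subr0 (le_lt_trans fz) // (lt_le_trans Me) // ler_eXnr //.
  by case: (size f) sf => [|[]].
have e0 : 0 < e by lra.
move=> /(near_fiber sf fm e0)[y /eqP fy zy].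
have yrs : y \in rs by rewrite -root_prod_XsubC -fE.
have : modulus y <= \sum_(y <- rs) modulus y.
  by rewrite (big_rem y yrs) /= lerDl sumr_ge0 // => x _; exact: modulus_ge0.
by have := modulus_triangle (z - y) y; rewrite subrK; lra.
Qed.

(* A point that is not locally equivalent and minimizes the modulus of f would
   contradict locally_equivalent_step. *)
Lemma everywhere_locally_equivalent (R : realType) (f : {poly R[i]})
    (K : R[i] -> R[i] -> Prop) (z : R[i]) :
  (1 < size f)%N -> f \is monic -> edge_equivalence f K -> locally_equivalent f K z.
Proof.
move=> sf fm eK; have [//|nlc] := pselect (locally_equivalent f K z).
have [Kr Ks Kt _] := eK.
pose pt (p : R * R) : R[i] := (p.1 +i* p.2)%C.
(* The counterexamples in a sublevel set form a closed set, local equivalence being an open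
   condition; it is also bounded, so |f| attains its minimum on it. *)
pose S := [set p | ~ locally_equivalent f K (pt p) /\ modulus f.[pt p] <= modulus f.[z]].
have [B HB] := sublevel_bounded (modulus f.[z]) sf fm.
have S0 : S !=set0.
  exists (complex.Re z, complex.Im z); rewrite /S /pt /=.
  by have -> : (complex.Re z +i* complex.Im z)%C = z by case: (z).
have cS : compact S.
  apply: (@subclosed_compact _ S (`[- B, B] `*` `[- B, B])).
  - rewrite -[S]setCK; apply: open_closedC; apply: open_of_boxes => p.
    rewrite /S /= => /not_andP[/contrapT[r r0 Hr]|/negP].
      exists (r / 4); first lra.
      move=> q h1 h2 [nq _]; apply: nq.
      have qp : modulus (pt q - pt p) < r / 2 by apply: modulus_box; lra.
      exists (r / 2); first lra.
      move=> x v v0 xq xv qv0; have [v1 v1P] := reach_exists (pt p) sf fm.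
      apply: (Kt v1).
        by apply: (Hr x) => //; have := modulus_dist (pt q) x (pt p); lra.
      by apply/Ks/(Hr (pt q)) => //; lra.
    rewrite -ltNge -subr_gt0 => gt0.
    have [r r0 Hr] := ccont_poly f (pt p) gt0.
    exists (r / 2); first lra.
    move=> q h1 h2 [_]; have := Hr (pt q) (modulus_box h1 h2).
    have := modulus_sub_le f.[pt q] f.[pt p]; rewrite ler_norml; lra.
  - by apply: compact_setX; exact: segment_compact.
  - move=> p [_ /HB pB]; rewrite /= !in_itv /= -!ler_norml.
    have h1 : `|p.1| <= modulus (pt p) := Re_le_modulus (pt p).
    have h2 : `|p.2| <= modulus (pt p) := Im_le_modulus (pt p).
    by split; lra.
have [|p0 + p0min] := @compact_EVT_min _ R (fun p => modulus f.[pt p]) S S0 cS.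
  apply: continuous_subspaceT => p; apply/cvgrPdist_lt => e e0.
  have [r r0 Hr] := ccont_poly f (pt p) e0.
  have r20 : 0 < r / 2 by lra.
  suff : nbhs_ball p (fun q => `|modulus f.[pt p] - modulus f.[pt q]| < e).
    by move/nbhs_ballP.
  exists (r / 2) => //= q [q1 q2].
  rewrite distrC; apply: le_lt_trans (modulus_sub_le _ _) _; apply: Hr.
  by apply: modulus_box; rewrite distrC.
rewrite inE => -[np0 p0z]; case: np0.
have [f0|f0] := eqVneq f.[pt p0] 0; first exact: locally_equivalent_root.
apply: locally_equivalent_step => // y yp0.
have [//|ny] := pselect (locally_equivalent f K y).
have yE : pt (complex.Re y, complex.Im y) = y by rewrite /pt /=; case: (y).
have yS : S (complex.Re y, complex.Im y) by rewrite /S /= yE; split=> //; lra.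
by have := p0min _ (mem_set yS); rewrite yE leNgt yp0.
Qed.

(** The class of the points reached is constant along the segment from [x] to [y], and [x] and [y]
    reach themselves. *)
Lemma stops_equivalent (R : realType) (f : {poly R[i]}) (K : R[i] -> R[i] -> Prop)
    (x y : R[i]) :
  (1 < size f)%N -> f \is monic -> edge_equivalence f K -> stop f x -> stop f y ->
  K x y.
Proof.
move=> sf fm eK sx sy; have [Kr Ks Kt _] := eK.
pose z (t : R) := x + t%:C%C * (y - x).
have zB s t : modulus (z s - z t) = `|s - t| * modulus (y - x).
  rewrite -modulus_real -modulusM rmorphB /z; congr modulus; ring.
have z1 : z 1 = y by rewrite /z rmorph1 mul1r addrC subrK.
suff h : forall t, 0 <= t <= 1 -> forall v v', reach f x v -> reach f (z t) v' -> K v v'.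
  by apply: (h 1); rewrite ?lexx ?ler01 ?z1 //; left.
have near t : exists2 d : R, 0 < d & forall u, `|u - t| < d ->
    forall v v', reach f (z u) v -> reach f (z t) v' -> K v v'.
  have [r r0 Hr] := everywhere_locally_equivalent (z t) sf fm eK.
  have B0 : 0 < modulus (y - x) + 1 by have := modulus_ge0 (y - x); lra.
  exists (r / (modulus (y - x) + 1)); first exact: divr_gt0.
  move=> u; rewrite ltr_pdivlMr // => ut v v'; apply: Hr; rewrite zB.
  by apply: le_lt_trans ut; rewrite ler_wpM2l // lerDl.
apply: real_induction => //.
- by move=> v v'; rewrite /z mul0r addr0; exact: (reach_equivalent sf eK).
- move=> t t01 Pt; have [d d0 Hd] := near t; exists d => // u ut ud v v' xv uv'.
  have [v1 v1P] := reach_exists (z t) sf fm.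
  apply: (Kt v1); first by apply: (Pt t) => //; lra.
  by apply/Ks/(Hd u) => //; rewrite ger0_norm; lra.
- move=> t t01 Pt v v' xv tv'; have [d d0 Hd] := near t.
  pose m := Num.min d t.
  have m0 : 0 < m by rewrite lt_min d0; lra.
  have [md mt] : m <= d /\ m <= t by rewrite /m !ge_min !lexx orbT.
  have [v1 v1P] := reach_exists (z (t - m / 2)) sf fm.
  apply: (Kt v1); first by apply: (Pt (t - m / 2)) => //; lra.
  by apply: (Hd (t - m / 2)) => //; rewrite ltr_norml; lra.
Qed.

(** * Trees *)

(* A vertex other than v0 determines the last edge of a shortest path from v0 to
   it, and distinct vertices determine distinct edges. *)
Lemma card_connected (V E : finType) (src tgt : E -> V) (F : pred E) (v0 : V) :
  (forall x, connect (fun x y => [exists e, F e && joins src tgt e x y]) v0 x) ->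
  (#|V| <= #|F|.+1)%N.
Proof.
set r := fun x y => _ => conn.
(* Tuples make the existence of a path of length [n] a boolean, so that [ex_minn] gives the distance
   to [v0]. *)
have ex x : exists n, [exists p : n.-tuple V, path r v0 p && (last v0 p == x)].
  have /connectP[p rp ->] := conn x.
  by exists (size p); apply/existsP; exists (in_tuple p); rewrite rp eqxx.
pose dist x := ex_minn (ex x).
have dist_le p : path r v0 p -> (dist (last v0 p) <= size p)%N.
  move=> rp; rewrite /dist; case: ex_minnP => n _; apply.
  by apply/existsP; exists (in_tuple p); rewrite rp eqxx.
have parent x : x != v0 -> exists e, F e /\
    exists2 u, (dist u < dist x)%N & joins src tgt e u x.
  move=> xv0; rewrite {2}/dist; case: ex_minnP => n /existsP[p /andP[rp /eqP px]] _.
  have sp := size_tuple p; case: {p}(p : seq V) / (lastP p) rp px sp => [_ /= px|q y].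
    by rewrite px eqxx in xv0.
  rewrite last_rcons rcons_path size_rcons => /andP[rq].
  rewrite {1}/r => /existsP[e /andP[Fe je]] yx <-.
  by exists e; split=> //; exists (last v0 q); rewrite ?ltnS ?dist_le // -yx.
have v0E : exists pe : V -> option E, forall x, x != v0 -> exists e,
    [/\ pe x = Some e, F e &
        exists2 u, (dist u < dist x)%N & joins src tgt e u x].
  exists (fun x => [pick e |
    F e && [exists u, (dist u < dist x)%N && joins src tgt e u x]]).
  move=> x /parent[e [Fe [u du je]]].
  case: pickP => [e' /andP[Fe' /existsP[u' /andP[d' j']]]|].
    by exists e'; split=> //; exists u'.
  by move=> /(_ e)/negbT/negP[]; rewrite Fe /=; apply/existsP; exists u; rewrite du.
have [pe peP] := v0E.
have -> : #|V| = #|predC1 v0|.+1 by rewrite cardC1 prednK //; apply/card_gt0P; exists v0.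
rewrite ltnS -(card_in_imset (f := pe)).
  have <- : #|imset (@Some E) (mem F)| = #|F| by apply: card_imset => a b [].
 
  apply/subset_leq_card/fintype.subsetP => _ /imsetP[x xv0 ->].
  by have [e [-> Fe _]] := peP x xv0; apply: imset_f.
move=> x y xv0 yv0 pxy.
have [e [pex Fe [u du /orP ju]]] := peP x xv0.
have [e' [pey _ [u' du' /orP ju']]] := peP y yv0.
move: pey; rewrite -pxy pex => -[ee]; rewrite -{e'}ee in ju'.
have [//|xy] := eqVneq x y.
(* Distinct vertices with the same parent edge would be its two ends, each closer to [v0] than the
   other. *)
suff [xu yu] : x = u' /\ y = u.
  by rewrite xu yu in du du'; have := ltn_trans du du'; rewrite ltnn.
case: ju => /andP[/eqP s1 /eqP t1]; case: ju' => /andP[/eqP s2 /eqP t2].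
- by move: xy; rewrite -t1 -t2 eqxx.
- by rewrite -t1 -t2 -s1 -s2.
- by rewrite -t1 -t2 -s1 -s2.
- by move: xy; rewrite -s1 -s2 eqxx.
Qed.

(** Removing an edge [e0] of a cycle leaves the graph connected, and [card_connected] then asks for
    more edges than remain. *)
Lemma tree_of_card (V E : finType) (src tgt : E -> V) :
  (forall x y, connect (Defs.adjacent src tgt) x y) -> #|V| = #|E|.+1 ->
  is_tree src tgt.
Proof.
move=> conn cVE; split=> // -[//|[v0 e0] w]; apply/negP => /and4P[_ _ /= /andP[e0w _]].
set J := fun x y : V * E => _ => /= Jw.
pose r := fun x y => [exists e, (e != e0) && joins src tgt e x y].
have rs : connect_sym r.
  by apply: sym_connect_sym => x y; apply: eq_existsb => e; rewrite /joins orbC.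
have along s a : path J a (rcons s (v0, e0)) -> e0 \notin unzip2 (a :: s) ->
    connect r a.1 v0.
  elim: s a => [|b s IH] a /=.
    rewrite andbT inE eq_sym => ja ae; apply: connect1; apply/existsP; exists a.2.
    by rewrite ae.
  move=> /andP[jab jb]; rewrite inE negb_or => /andP[ae be].
  apply: connect_trans (IH b jb be); apply: connect1; apply/existsP; exists a.2.
  by rewrite eq_sym ae.
(* The rest of the cycle joins the other end of [e0] to [v0] without using [e0]; when the cycle is a
   loop, both ends are [v0]. *)
have [v1 j01 c10] : exists2 v1, joins src tgt e0 v0 v1 & connect r v1 v0.
  case: w e0w Jw => [|a s] e0w /= /andP[ja js]; first by exists v0.
  by exists a.1 => //; exact: along js e0w.
have adj x y : Defs.adjacent src tgt x y -> connect r x y.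
  move=> /existsP[e je]; have [ee|ne] := eqVneq e e0; last first.
    by apply: connect1; apply/existsP; exists e; rewrite ne.
  rewrite ee in je; case/orP: j01 => /andP[/eqP s1 /eqP t1];
    case/orP: je => /andP[/eqP <- /eqP <-]; rewrite s1 t1 // rs //.
have connr x y : connect r x y.
  by apply: (connect_sub adj).
have := @card_connected V E src tgt (predC1 e0) v0 (connr v0).
rewrite cVE cardC1 ltnS; case: #|E| (fintype0 e0) => [|n _]; last by rewrite ltnn.
by move=> /(_ erefl).
Qed.

(** * Continuation of local paths *)

Lemma ray_inj (R : realType) (w : R[i]) (s t : R) : w != 0 -> ray w s = ray w t -> s = t.
Proof. by move=> w0 /(mulIf w0) [] h; lra. Qed.

(** Applying [f] to both lifts shows that the reparametrization preserves the ray, which is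
    injective in time: it is the identity. *)
Lemma same_path_lifts (R : realType) (f : {poly R[i]}) (w : R[i]) (T T' : R)
    (L L' : R -> R[i]) :
  w != 0 -> 0 < T -> lift f (ray w) 0 T L -> lift f (ray w) 0 T' L' ->
  same_path (Curve 0 T L) (Curve 0 T' L') ->
  T = T' /\ forall t, 0 <= t <= T -> L t = L' t.
Proof.
move=> w0 T0 lL lL' /same_pathE[/= phi [cp ip p0 pT pE]].
have range t : 0 <= t <= T -> 0 <= phi t <= T'.
  move=> /andP[]; rewrite le_eqVlt => /orP[/eqP <-|t0] tT.
    by rewrite p0 lexx /= -pT -p0 ltW // ip.
  rewrite -p0 ltW /=; last exact: ip.
  move: tT; rewrite le_eqVlt => /orP[/eqP ->|tT]; first by rewrite pT.
  by rewrite -pT ltW // ip // ltW.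
have pid t : 0 <= t <= T -> phi t = t.
  move=> tT; apply: (ray_inj w0); rewrite -(proj2 lL') ?range // -pE //.
  exact: (proj2 lL).
have TT : 0 <= T <= T by rewrite lexx ltW.
by split=> [|t tT]; [rewrite -(pid T) // pT|rewrite pE // pid].
Qed.

Lemma initial_part_same_path (R : realType) (c d d' : curve R) :
  initial_part c d -> same_path d d' -> initial_part c d'.
Proof.
move=> [u ud cu] /same_pathE[phi [cp ip lp hp pE]].
exists (phi u).
  rewrite -lp -hp ip //=; try lra.
  have /andP[_] := ud; rewrite le_eqVlt => /orP[/eqP -> //|uh].
  by apply/ltW/ip; lra.
apply: (same_path_trans cu); apply/same_pathE; exists phi; split=> //=.
- move=> t tu e e0; have [|a a0 Ha] := cp t _ e e0; first lra.
  by exists a => // v vu; apply: Ha; lra.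
- by move=> t v lt vu tv; apply: ip; lra.
- by move=> t tu; apply: pE; lra.
Qed.

Lemma initial_part_lifts (R : realType) (f : {poly R[i]}) (w : R[i]) (T T' : R)
    (L L' : R -> R[i]) (c d : curve R) :
  w != 0 -> 0 < T -> lo c < hi c ->
  lift f (ray w) 0 T L -> lift f (ray w) 0 T' L' ->
  same_path c (Curve 0 T L) -> same_path d (Curve 0 T' L') -> initial_part c d ->
  T <= T' /\ forall t, 0 <= t <= T -> L t = L' t.
Proof.
move=> w0 T0 lhc lL lL' cL dL' cd.
have [u /= u0T' cu] := initial_part_same_path cd dL'.
have lL'u : lift f (ray w) 0 u L' by apply: lift_sub lL'; lra.
have Lu := same_path_trans (same_path_sym lhc cL) cu.
have [-> agree] := same_path_lifts w0 T0 lL lL'u Lu.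
by split=> //; lra.
Qed.

Lemma initial_part_refl (R : realType) (c : curve R) : lo c < hi c -> initial_part c c.
Proof. by move=> lh; exists (hi c); [rewrite lh lexx|exact: same_path_refl]. Qed.

Lemma initial_part_source (R : realType) (c d : curve R) :
  lo c < hi c -> initial_part c d -> source c = source d.
Proof. by move=> lh [u _ /(same_path_ends lh)[-> _]]. Qed.

Lemma same_path_param (R : realType) (c : curve R) (T : R) (L : R -> R[i]) :
  lo c < hi c -> 0 < T -> same_path c (Curve 0 T L) ->
  (forall t, 0 <= t <= T -> exists2 u, lo c <= u <= hi c & L t = c u) /\
  (forall t, 0 < t < T -> exists2 u, lo c < u < hi c & L t = c u) /\
  (forall t, 0 <= t < T -> exists2 u, lo c <= u < hi c & L t = c u).
Proof.
move=> lh T0 /(same_path_sym lh)/same_pathE[/= phi [_ ip p0 pT pE]].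
have pl t : 0 <= t <= T -> lo c <= phi t.
  move=> /andP[]; rewrite le_eqVlt => /orP[/eqP <-|t0 tT]; first by rewrite p0.
  by rewrite -p0 ltW // ip.
have pr t : 0 <= t <= T -> phi t <= hi c.
  move=> /andP[t0]; rewrite le_eqVlt => /orP[/eqP ->|tT]; first by rewrite pT.
  by rewrite -pT ltW // ip.
split; first by move=> t tT; exists (phi t); [rewrite pl ?pr|exact: pE].
split=> t tT; exists (phi t); try (by apply: pE; lra).
  by apply/andP; split; [rewrite -p0|rewrite -pT]; apply: ip; lra.
by rewrite pl /=; [rewrite -pT ip //; lra|lra].
Qed.

Lemma first_exit (R : realType) (T r : R) (L : R -> R[i]) (z : R[i]) :
  0 <= T -> ccont 0 T L -> modulus (L 0 - z) < r -> r <= modulus (L T - z) ->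
  exists t, [/\ 0 < t <= T, modulus (L t - z) = r &
    forall u, 0 <= u < t -> modulus (L u - z) < r].
Proof.
move=> T0 cL L0 LT; have [//|none] := pselect (exists t, [/\ 0 < t <= T,
  modulus (L t - z) = r & forall u, 0 <= u < t -> modulus (L u - z) < r]).
have TT : 0 <= T <= T by rewrite T0 lexx.
suff : modulus (L T - z) < r by rewrite ltNge LT.
apply: (real_induction (P := fun t => modulus (L t - z) < r) T0) TT => //.
  move=> t tT Pt; have h : 0 < r - modulus (L t - z) by rewrite subr_gt0; apply: Pt; lra.
  have [|d d0 Hd] := cL t _ _ h; first lra.
  exists d => // u ut ud; have : modulus (L u - L t) < r - modulus (L t - z).
    by apply: Hd; [lra|rewrite ger0_norm; lra].
  by have := modulus_dist (L t) (L u) z; lra.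
move=> t tT Pt; rewrite ltNge; apply/negP => rt.
apply: none; exists t; split=> [//||u ut]; last by apply: Pt; lra.
apply/eqP; rewrite eq_le rt andbT leNgt; apply/negP => tr.
have h : 0 < modulus (L t - z) - r by rewrite subr_gt0.
have [|d d0 Hd] := cL t _ _ h; first lra.
pose m := Num.min d t.
have m0 : 0 < m by rewrite lt_min d0; lra.
have [md mt] : m <= d /\ m <= t by rewrite /m !ge_min !lexx orbT.
have : modulus (L (t - m / 2) - L t) < modulus (L t - z) - r.
  by apply: Hd; [lra|rewrite ltr_norml; lra].
have : modulus (L (t - m / 2) - z) < r by apply: Pt; lra.
have := modulus_dist (L (t - m / 2)) (L t) z.
rewrite (modulusB (L t) (L (t - m / 2))); lra.
Qed.

Lemma issued_canonical (R : realType) (f : {poly R[i]}) (z0 : R[i]) (r : R)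
    (c : curve R) :
  f.[z0] != 0 -> issued_in_disc f z0 r c ->
  exists T L, [/\ 0 < T <= 1, lift f (ray f.[z0]) 0 T L, L 0 = z0,
    same_path c (Curve 0 T L) &
    (forall t, 0 <= t < T -> modulus (L t - z0) < r) /\ L T = target c].
Proof.
move=> f0 [dc sc inr]; have lh := proj1 dc.
have [|T [L [T01 lL L0 sL]]] := descent_canonical dc; first by rewrite sc.
rewrite sc in lL L0; exists T, L; split=> //.
have T0 : 0 < T by lra.
have [_ [_ par]] := same_path_param lh T0 sL.
split=> [t tT|]; first by have [u /inr ? ->] := par t tT.
by have [_ ->] := same_path_ends lh sL.
Qed.

Lemma edge_stop (R : realType) (f : {poly R[i]}) (z : R[i]) (T t : R)
    (L : R -> R[i]) :
  f.[z] != 0 -> is_edge f z T L -> 0 < t < T -> ~ stop f (L t).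
Proof.
move=> f0 e tT; have fn := edge_end f0 e tT; have [_ _ _ nL _] := e.
by case=> /eqP; rewrite ?(negPf fn) ?(negPf (nL t tT)).
Qed.

(* Following the second edge backwards from the meeting point lifts the ray of
   the first one, so it passes through the source of the first edge. *)
Lemma edges_meet (R : realType) (f : {poly R[i]}) (z z' : R[i]) (T T' x y : R)
    (L L' : R -> R[i]) :
  (1 < size f)%N -> f.[z] != 0 -> f.[z'] != 0 -> f^`().[z] = 0 ->
  is_edge f z T L -> is_edge f z' T' L' -> 0 < x < T -> 0 < y < T' -> x <= y ->
  L x = L' y -> z = z' /\ x = y.
Proof.
move=> sf f0 f0' fz e e' xT yT' xy Lxy.
have [T01 lL L0 nL _] := e; have [T'01 lL' L'0 nL' _] := e'.
have x1 : 0 < 1 - x by lra.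
(* Comparing values at the meeting point gives f(z) = k f(z'), with k <= 1. The change of time u ->
   k u + 1 - k turns the ray of [z'] into that of [z], and sends time 0 to time [1 - k] on the
   second edge. *)
pose k := (1 - y) / (1 - x).
have k0 : 0 < k by rewrite divr_gt0 //; lra.
have kx : k * (1 - x) = 1 - y by rewrite /k divfK // gt_eqF.
have k1 : k <= 1 by rewrite /k ler_pdivrMr //; lra.
have fxy : ray f.[z] x = ray f.[z'] y.
  by rewrite -(proj2 lL) -?(proj2 lL') ?Lxy //; lra.
have fk : f.[z] = k%:C%C * f.[z'].
  have xC : (1 - x)%:C%C != 0 :> R[i] by rewrite -modulus_gt0 modulus_real gtr0_norm.
  apply: (mulfI xC); rewrite -[LHS]/(ray f.[z] x) fxy mulrA -rmorphM.
  by rewrite [_ * k]mulrC kx.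
have lL'y : lift f (ray f.[z']) (1 - k) y L' by apply: lift_sub lL'; lra.
have lM := lift_affine (1 - k) k0 lL'y.
have E0 : (1 - k - (1 - k)) / k = 0 by rewrite subrr mul0r.
have Ex : (y - (1 - k)) / k = x.
  have -> : y - (1 - k) = k * x by lra.
  by rewrite mulrC mulKf // gt_eqF.
have Ew : (fun u => ray f.[z'] (k * u + (1 - k))) = ray f.[z].
  apply/funext => u; rewrite fk /ray mulrA -rmorphM; congr (_%:C%C * _); ring.
rewrite E0 Ex Ew in lM.
have lLx : lift f (ray f.[z]) 0 x L by apply: lift_sub lL; lra.
have Mx : L x = L' (k * x + (1 - k)) by rewrite Lxy; congr L'; lra.
have := lift_unique_backward sf lLx lM Mx.
move=> /(_ (fun t tx => nL t ltac:(lra)) 0 ltac:(lra)); rewrite mulr0 add0r L0 => zE.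
have kx0 : 0 < k * x by rewrite mulr_gt0 //; lra.
(* Otherwise [z], a zero of f', would lie inside the second edge. *)
have k1E : 1 - k = 0.
  apply/eqP/negPn/negP => kn; have kp : 0 < 1 - k by rewrite lt_neqAle eq_sym kn; lra.
  by apply: (@edge_stop R f z' T' (1 - k) L') => //; [lra|rewrite -zE; right].
have kE : k = 1 by lra.
by split; [rewrite zE k1E|rewrite kE mul1r in kx; lra].
Qed.

(** The end is a zero of f or f', and differs from [z0] because |f| has strictly decreased. *)
Lemma edge_leaves_disc (R : realType) (f : {poly R[i]}) (z0 : R[i]) (r T : R)
    (L : R -> R[i]) :
  f.[z0] != 0 -> (forall z, stop f z -> z != z0 -> r < modulus (z - z0)) ->
  is_edge f z0 T L -> r < modulus (L T - z0).
Proof.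
move=> f0 far [T01 [_ fL] L0 nL endL]; apply: far; first by case: endL; [left|right].
apply/eqP => LT; have w0 : 0 < modulus f.[z0] by rewrite modulus_gt0.
have TT : 0 <= T <= T by lra.
have := congr1 (@modulus R) (fL T TT); rewrite LT modulus_ray; last lra.
have : 0 < T * modulus f.[z0] by rewrite mulr_gt0 //; lra.
lra.
Qed.

(** Each edge of [descent_edges] is cut at its first exit from the disc. *)
Lemma exists_paths_in_disc (R : realType) (f : {poly R[i]}) (z0 : R[i]) (r : R)
    (k : nat) :
  (1 < size f)%N -> f \is monic -> f.[z0] != 0 -> k = mup z0 (f - f.[z0]%:P) ->
  0 < r -> (forall z, stop f z -> z != z0 -> r < modulus (z - z0)) ->
  exists loc : 'I_k -> curve R, paths_in_disc f z0 r loc.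
Proof.
move=> sf fm f0 kE r0 far; have [T [L [edge disj cover]]] := descent_edges sf fm f0 kE.
have ex i : exists t, [/\ 0 < t <= T i, modulus (L i t - z0) = r &
    forall u, 0 <= u < t -> modulus (L i u - z0) < r].
  have [T01 [cL _] L0 _ _] := edge i; apply: first_exit => //; first lra.
    by rewrite L0 subrr modulus0.
  exact: ltW (edge_leaves_disc f0 far (edge i)).
pose tau i := projT1 (cid (ex i)).
have tauP i : [/\ 0 < tau i <= T i, modulus (L i (tau i) - z0) = r &
    forall u, 0 <= u < tau i -> modulus (L i u - z0) < r].
  by rewrite /tau; case: cid.
have lT i : lift f (ray f.[z0]) 0 (tau i) (L i).
  have [T01 lL _ _ _] := edge i; have [ti _ _] := tauP i.
  by apply: lift_sub lL; lra.
exists (fun i => Curve 0 (tau i) (L i)); split=> [i|c ic].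
  have [T01 lL L0 nL endL] := edge i; have [ti outi ini] := tauP i.
  split=> //; split=> //; apply: (lift_descent_path f0 _ (lT i)); first lra.
  by move=> t tti; apply: nL; lra.
have lhc := proj1 (let: And3 d _ _ := ic in d).
have [T' [M [T'01 lM M0 cM [inM _]]]] := issued_canonical f0 ic.
have [i agree] := cover T' M T'01 lM M0.
have [T01 lL L0 nL endL] := edge i; have [ti outi ini] := tauP i.
have T't : T' <= tau i.
  rewrite leNgt; apply/negP => tT'; have := inM (tau i) ltac:(lra).
  by rewrite agree ?outi ?ltxx //; lra.
exists i; split.
  exists T' => /=; first lra.
  by apply: (same_path_trans cM); apply: same_path_refl => //= t tT'; apply: agree; lra.
move=> j icj; have lhj : same_path (Curve 0 (tau j) (L j)) (Curve 0 (tau j) (L j)).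
  exact: same_path_refl.
have [tj _ _] := tauP j.
have T'0 : 0 < T' by lra.
have [T'tj agree'] := initial_part_lifts f0 T'0 lhc lM (lT j) cM lhj icj.
have LL : L i (T' / 2) = L j (T' / 2) by rewrite -agree ?agree' //; lra.
exact: (disj i j (T' / 2) ltac:(lra) ltac:(lra) LL).
Qed.

Lemma continuation_is_edge (R : realType) (f : {poly R[i]}) (V : set R[i])
    (z0 : R[i]) (r : R) (c d : curve R) :
  (forall z, V z <-> stop f z) -> f.[z0] != 0 -> issued_in_disc f z0 r c ->
  continuation f V c d ->
  exists T L, is_edge f z0 T L /\ same_path d (Curve 0 T L).
Proof.
move=> VE f0 [dc sc _] [dd cd inV tV].
have sd : source d = z0 by rewrite -sc (initial_part_source (proj1 dc) cd).
have lhd := proj1 dd.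
have [|T [L [T01 lL L0 sL]]] := descent_canonical dd; first by rewrite sd.
rewrite sd in lL L0; exists T, L; split=> //.
have T0 : 0 < T by lra.
have [_ [par _]] := same_path_param lhd T0 sL.
split=> //.
  move=> t tT; apply/eqP => ft; have [u uh Lu] := par t tT.
  by apply: (inV u uh); apply/VE; rewrite -Lu; right.
have [_ tE] := same_path_ends lhd sL.
by move/VE: tV; rewrite tE; case; [left|right].
Qed.

Lemma edge_continuation (R : realType) (f : {poly R[i]}) (V : set R[i])
    (z0 : R[i]) (T : R) (L : R -> R[i]) (c : curve R) :
  (forall z, V z <-> stop f z) -> f.[z0] != 0 -> is_edge f z0 T L ->
  initial_part c (Curve 0 T L) -> continuation f V c (Curve 0 T L).
Proof.
move=> VE f0 e ic; have [T01 lL L0 nL endL] := e; split=> //.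
- exact: (lift_descent_path f0 T01 lL nL).
- by move=> t tT /VE; apply: edge_stop e _.
- by apply/VE; case: endL; [left|right].
Qed.

Lemma continuation_exists (R : realType) (f : {poly R[i]}) (V : set R[i])
    (z0 : R[i]) (r : R) (c : curve R) :
  (1 < size f)%N -> f \is monic -> f.[z0] != 0 -> (forall z, V z <-> stop f z) ->
  (forall z, stop f z -> z != z0 -> r < modulus (z - z0)) ->
  issued_in_disc f z0 r c -> exists d, continuation f V c d.
Proof.
move=> sf fm f0 VE far ic; have [T [L [edge _ cover]]] := descent_edges sf fm f0 erefl.
have [T' [M [T'01 lM M0 cM [inM _]]]] := issued_canonical f0 ic.
have [i agree] := cover T' M T'01 lM M0.
have [T01 lL L0 nL endL] := edge i.
have T'T : T' <= T i.
  rewrite leNgt; apply/negP => TT'; have := inM (T i) ltac:(lra).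
  rewrite agree; [|lra..]; apply/negP; rewrite -leNgt; apply/ltW.
  exact: (edge_leaves_disc f0 far (edge i)).
exists (Curve 0 (T i) (L i)); apply: (edge_continuation VE f0 (edge i)).
exists T' => /=; first lra.
by apply: (same_path_trans cM); apply: same_path_refl => //= t tT'; apply: agree; lra.
Qed.

Lemma continuation_agree (R : realType) (f : {poly R[i]}) (V : set R[i])
    (z0 : R[i]) (r T : R) (L : R -> R[i]) (c d : curve R) :
  f.[z0] != 0 -> issued_in_disc f z0 r c -> continuation f V c d ->
  is_edge f z0 T L -> same_path d (Curve 0 T L) ->
  forall T' M, 0 < T' -> lift f (ray f.[z0]) 0 T' M -> same_path c (Curve 0 T' M) ->
  T' <= T /\ forall t, 0 <= t <= T' -> M t = L t.
Proof.
move=> f0 [dc _ _] [_ cd _ _] [_ lL _ _ _] dL T' M T'0 lM cM.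
exact: (initial_part_lifts f0 T'0 (proj1 dc) lM lL cM dL cd).
Qed.

Lemma continuation_unique (R : realType) (f : {poly R[i]}) (V : set R[i])
    (z0 : R[i]) (r : R) (c d d' : curve R) :
  (1 < size f)%N -> f.[z0] != 0 -> (forall z, V z <-> stop f z) ->
  issued_in_disc f z0 r c -> continuation f V c d -> continuation f V c d' ->
  same_path d d'.
Proof.
move=> sf f0 VE ic cd cd'.
have [T [L [e dL]]] := continuation_is_edge VE f0 ic cd.
have [T' [L' [e' dL']]] := continuation_is_edge VE f0 ic cd'.
have [U [M [U01 lM M0 cM _]]] := issued_canonical f0 ic.
have U0 : 0 < U by lra.
have [UT ML] := continuation_agree f0 ic cd e dL U0 lM cM.
have [UT' ML'] := continuation_agree f0 ic cd' e' dL' U0 lM cM.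
have LL : L (U / 2) = L' (U / 2) by rewrite -ML ?ML' //; lra.
have [TE agree] := is_edge_agree sf f0 e e' (t := U / 2) ltac:(lra) ltac:(lra) LL.
have lhd' : lo d' < hi d' by case: cd' => [[]].
apply: same_path_trans dL _; apply: same_path_trans (same_path_sym lhd' dL').
by apply: same_path_refl => //=.
Qed.

(** The two edges coincide, and both local paths follow this edge until they first meet the circle;
    so they are the same path, and the uniqueness clause of [paths_in_disc] identifies the
    indices. *)
Lemma continuation_inj (R : realType) (f : {poly R[i]}) (V : set R[i])
    (z0 : R[i]) (r T T' t : R) (L L' : R -> R[i]) (k : nat)
    (loc : 'I_k -> curve R) (i j : 'I_k) (d d' : curve R) :
  (1 < size f)%N -> f.[z0] != 0 -> (forall z, V z <-> stop f z) ->
  paths_in_disc f z0 r loc ->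
  continuation f V (loc i) d -> continuation f V (loc j) d' ->
  is_edge f z0 T L -> is_edge f z0 T' L' ->
  same_path d (Curve 0 T L) -> same_path d' (Curve 0 T' L') ->
  0 < t < T -> t < T' -> L t = L' t -> i = j.
Proof.
move=> sf f0 VE [iss uniq_] cd cd' e e' dL dL' tT tT' Lt.
have [TE agree] := is_edge_agree sf f0 e e' tT tT' Lt.
have [[ici outi] [icj outj]] := (iss i, iss j).
have [U [M [U01 lM M0 cM [inM MU]]]] := issued_canonical f0 ici.
have [U' [M' [U'01 lM' M'0 cM' [inM' MU']]]] := issued_canonical f0 icj.
have U0 : 0 < U by lra.
have U'0 : 0 < U' by lra.
have [UT ML] := continuation_agree f0 ici cd e dL U0 lM cM.
have [UT' ML'] := continuation_agree f0 icj cd' e' dL' U'0 lM' cM'.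
have MM u : 0 <= u <= U -> u <= U' -> M u = M' u.
  by move=> uU uU'; rewrite ML ?ML' ?agree //; lra.
have UU' : U = U'.
  apply/eqP; rewrite eq_le !leNgt; apply/andP; split; apply/negP => lt.
    by have := inM U' ltac:(lra); rewrite MM ?MU' ?outj ?ltxx //; lra.
  by have := inM' U ltac:(lra); rewrite -MM ?MU ?outi ?ltxx //; lra.
have [lhi lhj] : lo (loc i) < hi (loc i) /\ lo (loc j) < hi (loc j).
  by case: ici => [[]]; case: icj => [[]].
have sij : same_path (loc i) (loc j).
  apply: same_path_trans cM _; apply: same_path_trans (same_path_sym lhj cM').
  by apply: same_path_refl => //= u uU; apply: MM; lra.
have [k0 [_ k0P]] := uniq_ (loc i) ici.
rewrite -(k0P i (initial_part_refl lhi)); apply: k0P.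
by apply: initial_part_same_path sij; exact: initial_part_refl.
Qed.

(** A short initial part of the edge stays in the disc, so it begins one of the local paths; the
    continuation of that path shares this part with the edge, hence coincides with it. This shows
    that the given paths account for all edges. *)
Lemma edge_is_continuation (R : realType) (f : {poly R[i]}) (V : set R[i])
    (z0 : R[i]) (r T : R) (L : R -> R[i]) (k : nat) (loc : 'I_k -> curve R) :
  (1 < size f)%N -> f.[z0] != 0 -> (forall z, V z <-> stop f z) -> 0 < r ->
  paths_in_disc f z0 r loc -> is_edge f z0 T L ->
  exists i, forall d, continuation f V (loc i) d -> target d = L T.
Proof.
move=> sf f0 VE r0 [iss uniq_] e; have [T01 lL L0 nL endL] := e.
have [|d d0 Hd] := (proj1 lL) 0 _ r r0; first lra.
pose t := Num.min (T / 2) (d / 2).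
have t0 : 0 < t by rewrite lt_min; apply/andP; split; lra.
have [tT td] : t <= T / 2 /\ t <= d / 2 by rewrite /t !ge_min !lexx orbT.
have lt : lift f (ray f.[z0]) 0 t L by apply: lift_sub lL; lra.
pose c := Curve 0 t L.
have ic : issued_in_disc f z0 r c.
  split=> //=.
    apply: (lift_descent_path f0 _ lt); first lra.
    by move=> u ut; apply: nL; lra.
  by move=> u ut; rewrite -L0; apply: Hd; [lra|rewrite ltr_norml; lra].
have [i [ici _]] := uniq_ c ic; exists i => c' cc'.
have [iic _] := iss i.
have [T' [L' [e' dL']]] := continuation_is_edge VE f0 iic cc'.
have lhc' : lo c' < hi c' by case: cc' => [[]].
have [U [M [U01 lM M0 cM _]]] := issued_canonical f0 iic.
have U0 : 0 < U by lra.
have [UT' ML'] := continuation_agree f0 iic cc' e' dL' U0 lM cM.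
have cc : same_path c (Curve 0 t L) by exact: same_path_refl.
have [tU LM] := initial_part_lifts f0 t0 (t0 : lo c < hi c) lt lM cc cM ici.
have LL : L (t / 2) = L' (t / 2) by rewrite LM ?ML' //; lra.
have [TE agree] := is_edge_agree sf f0 e e' (t := t / 2) ltac:(lra) ltac:(lra) LL.
have [_ ->] := same_path_ends lhc' dL'; rewrite /target /= -TE agree //; lra.
Qed.

(** * Intersections of edges *)

Lemma same_path_at (R : realType) (c d : curve R) (t : R) :
  lo c < hi c -> same_path c d -> lo c <= t <= hi c ->
  exists s, [/\ lo d <= s <= hi d, c t = d s, s = lo d -> t = lo c &
    s = hi d -> t = hi c].
Proof.
move=> lh /same_pathE[phi [_ ip lp hp pE]] tc; exists (phi t).
have ld : lo d < hi d by rewrite -lp -hp ip // lexx.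
split; last 3 first.
- exact: pE.
- move=> E; apply/eqP; rewrite eq_le; apply/andP; split; last lra.
  rewrite leNgt; apply/negP => lt; have := ip (lo c) t (lexx _) ltac:(lra) lt.
  by rewrite lp E ltxx.
- move=> E; apply/eqP; rewrite eq_le; apply/andP; split; first lra.
  rewrite leNgt; apply/negP => lt; have := ip t (hi c) ltac:(lra) (lexx _) lt.
  by rewrite hp E ltxx.
apply/andP; split.
  have /andP[+ _] := tc; rewrite le_eqVlt => /orP[/eqP <-|lt]; first by rewrite lp.
  by rewrite -lp ltW // ip //; lra.
have /andP[_] := tc; rewrite le_eqVlt => /orP[/eqP ->|lt]; first by rewrite hp.
by rewrite -hp ltW // ip //; lra.
Qed.

Lemma meet_only_at_ends_same_path (R : realType) (c d c' d' : curve R) :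
  lo c < hi c -> lo d < hi d -> same_path c c' -> same_path d d' ->
  meet_only_at_ends c' d' -> meet_only_at_ends c d.
Proof.
move=> lc ld cc dd H t u tc ud; move: tc ud; rewrite !in_itv /= => tc ud ctu.
have [s [sc cs s1 s2]] := same_path_at lc cc tc.
have [v [vd dv v1 v2]] := same_path_at ld dd ud.
have E : c' s = d' v by rewrite -cs -dv.
have [hs hv] := H s v sc vd E.
by split; [case: hs => [/s1|/s2]|case: hv => [/v1|/v2]]; auto.
Qed.

(** The ends of an edge are zeros of f or f' and its interior points are not, so an end never meets
    an interior point; two interior points are handled by [edges_meet]. *)
Lemma edges_meet_only_at_ends (R : realType) (f : {poly R[i]}) (z z' : R[i])
    (T T' : R) (L L' : R -> R[i]) :
  (1 < size f)%N -> f.[z] != 0 -> f.[z'] != 0 -> f^`().[z] = 0 -> f^`().[z'] = 0 ->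
  is_edge f z T L -> is_edge f z' T' L' ->
  (forall t, z = z' -> 0 < t < T -> t < T' -> L t <> L' t) ->
  meet_only_at_ends (Curve 0 T L) (Curve 0 T' L').
Proof.
move=> sf f0 f0' fz fz' e e' ne t u; rewrite !in_itv /= => tT uT' Ltu.
have ends x X M y : is_edge f y X M -> f^`().[y] = 0 -> 0 <= x <= X ->
    (x = 0 \/ x = X) /\ stop f (M x) \/ 0 < x < X.
  move=> [_ _ M0 _ endM] fy /andP[]; rewrite le_eqVlt => /orP[/eqP <-|x0].
    by left; split; [left|right; rewrite M0].
  rewrite le_eqVlt => /orP[/eqP ->|xX]; last by right; rewrite x0.
  by left; split; [right|case: endM; [left|right]].
have [[ht st]|it] := ends t T L z e fz tT.
  have [[hu _]//|iu] := ends u T' L' z' e' fz' uT'.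
  by case: (edge_stop f0' e' iu); rewrite -Ltu.
have [[_ su]|iu] := ends u T' L' z' e' fz' uT'.
  by case: (edge_stop f0 e it); rewrite Ltu.
case: (lerP t u) => tu.
  have [zz tuE] := edges_meet sf f0 f0' fz e e' it iu tu Ltu.
  by case: (ne t zz it); [rewrite tuE; case/andP: iu|rewrite Ltu tuE].
have [zz tuE] := edges_meet sf f0' f0 fz' e' e iu it (ltW tu) (esym Ltu).
by move: tu; rewrite tuE ltxx.
Qed.

(** * Degree counts and the tree of descent paths *)

Lemma sum_mup_stops (R : realType) (f : {poly R[i]}) (vs : seq R[i]) :
  (1 < size f)%N -> uniq vs -> (forall z, root f^`() z -> z \in vs) ->
  (\sum_(v <- vs) mup v f^`() = (size f).-2)%N.
Proof.
move=> sf uvs sub; have f'0 := deriv_neq0 sf.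
have [rs fE] := closed_field_poly_normal f^`().
have lc0 : lead_coef f^`() != 0 by rewrite lead_coef_eq0.
have szE := size_deriv_complex sf.
have mE v : mup v f^`() = count_mem v rs.
  rewrite fE -mul_polyC mupMr ?mup_prod_XsubC //.
  by rewrite rootE hornerC.
under eq_bigr do rewrite mE.
rewrite sum_count_mem // => [|z zrs].
  have := congr1 (size \o polyseq) fE => /=.
  by rewrite szE size_scale // size_prod_XsubC => ->.
by apply: sub; rewrite fE rootZ // root_prod_XsubC.
Qed.

Lemma mup_of_prod (R : realType) (s : nat) (alpha : 'I_s -> R[i]) (n : 'I_s -> nat)
    (i : 'I_s) :
  injective alpha -> mup (alpha i) (\prod_(i < s) ('X - (alpha i)%:P) ^+ n i) = n i.
Proof.
move=> inj; rewrite (bigD1 i) //= mup_mul_XsubCX // /root horner_prod.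
apply/prodf_neq0 => j ji; rewrite horner_exp hornerXsubC expf_eq0 subr_eq0.
by rewrite (inj_eq inj) eq_sym (negPf ji) andbF.
Qed.

Theorem mainTheorem2 (R : realType) (s p : nat) (alpha : 'I_s -> R[i])
    (n : 'I_s -> nat) (f : {poly R[i]}) (beta : 'I_p -> R[i]) (m : 'I_p -> nat)
    (s_ge2 : (2 <= s)%N)
    (alpha_inj : injective alpha)
    (n_gt0 : forall i, (0 < n i)%N)
    (fE : f = \prod_(i < s) ('X - (alpha i)%:P) ^+ n i)
    (beta_inj : injective beta)
    (betaE : forall z : R[i], (exists j, beta j = z) <->
                              (root f^`() z /\ forall i, alpha i <> z))
    (mE : forall j, m j = mup (beta j) f^`()) :
  let E := {j : 'I_p & 'I_(m j).+1} in
  let AB := range (vertex alpha beta) in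
  (\sum_(j < p) m j = s - 1)%N /\
  (exists2 r0 : R, 0 < r0 & forall r : R, 0 < r < r0 ->
     (forall j, exists loc : 'I_(m j).+1 -> curve R,
        paths_in_disc f (beta j) r loc) /\
     (forall loc : (forall j, 'I_(m j).+1 -> curve R),
        (forall j, paths_in_disc f (beta j) r (loc j)) ->
        (forall j k,
           (exists c, continuation f AB (loc j k) c) /\
           (forall c d, continuation f AB (loc j k) c ->
              continuation f AB (loc j k) d -> same_path c d)) /\
        (forall gamma : E -> curve R,
           (forall e, continuation f AB (loc (tag e) (tagged e)) (gamma e)) ->
           [/\ (#|{: E}| = \sum_(j < p) (m j).+1)%N,
               (\sum_(j < p) (m j).+1 = s + p - 1)%N,
               (forall e e', same_path (gamma e) (gamma e') -> e = e'),
               (forall e e', e <> e' ->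
                  meet_only_at_ends (gamma e) (gamma e')) &
               exists2 tgt : E -> 'I_s + 'I_p,
                 (forall e, source (gamma e) = beta (tag e) /\
                            target (gamma e) = vertex alpha beta (tgt e)) &
                 is_tree (fun e : E => inr (tag e)) tgt]))).
Proof.
move=> E AB.
have fm : f \is monic.
  by rewrite fE; apply: monic_prod => i _; rewrite monic_exp ?monicXsubC.
have szf : size f = (\sum_(i < s) n i).+1.
  rewrite fE size_prod; last by move=> i _; rewrite expf_neq0 ?polyXsubC_eq0.
  rewrite (eq_bigr (fun i => n i + 1)%N) => [|i _]; last by rewrite size_exp_XsubC addn1.
  by rewrite big_split /= sum1_card subSn ?leq_addl // addnK.
have sum_ge : (s <= \sum_(i < s) n i)%N.
  by rewrite -{1}(card_ord s) -sum1_card leq_sum.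
have sf : (1 < size f)%N by rewrite szf ltnS (leq_trans _ sum_ge) // ltnW.
have f0 : f != 0 by rewrite monic_neq0.
have rootf z : f.[z] = 0 <-> exists i, alpha i = z.
  rewrite fE horner_prod; split.
    move/eqP/prodf_eq0 => [i _]; rewrite horner_exp hornerXsubC expf_eq0 subr_eq0.
    by move=> /andP[_ /eqP ->]; exists i.
  move=> [i <-]; rewrite (bigD1 i) //= horner_exp hornerXsubC subrr expr0n.
  by rewrite eqn0Ngt n_gt0 mul0r.
have fbeta j : f.[beta j] != 0.
  have [_ nalpha] := (proj1 (betaE (beta j))) (ex_intro _ j erefl).
  by apply/eqP => /rootf; case=> i; exact: nalpha.
have f'beta j : f^`().[beta j] = 0.
  by have [/rootP] := (proj1 (betaE (beta j))) (ex_intro _ j erefl).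
have ABstop z : AB z <-> stop f z.
  split=> [[[i|j] _ <-] /=|].
  - by left; apply/rootf; exists i.
  - by right.
  case=> [/rootf|fz]; first by case=> i iz; exists (inl i).
  have [[i iz]|na] := pselect (exists i, alpha i = z); first by exists (inl i).
  have [|j jz] := (proj2 (betaE z)); last by exists (inr j).
  by split; [apply/rootP|move=> i iz; apply: na; exists i].
have vinj : injective (vertex alpha beta).
  move=> [i|j] [i'|j'] //= h; try by [rewrite (alpha_inj _ _ h)|rewrite (beta_inj _ _ h)].
    by have /eqP[] := fbeta j'; apply/rootf; exists i.
  by have /eqP[] := fbeta j; apply/rootf; exists i'.
pose vs := [seq vertex alpha beta v | v <- enum {: 'I_s + 'I_p}].
have uvs : uniq vs by rewrite map_inj_uniq // enum_uniq.
have vsP z : stop f z -> z \in vs.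
  by move/ABstop => [v _ <-]; apply: map_f; rewrite mem_enum.
have sum_m : (\sum_(j < p) m j = s - 1)%N.
  have root_vs z : root f^`() z -> z \in vs by move=> /rootP fz; apply: vsP; right.
  (* The multiplicities of f' at all vertices add up to deg f - 1. Each [alpha i] contributes
     [n i - 1], and the [n i] add up to deg f. *)
  have := sum_mup_stops sf uvs root_vs.
  rewrite big_map big_enum big_sumType /= szf /=.
  under [X in (_ + X)%N]eq_bigr do rewrite -mE.
  have nE i : n i = (mup (alpha i) f^`()).+1.
    have rfi : root f (alpha i) by apply/rootP/rootf; exists i.
    by rewrite -mup_deriv // fE mup_of_prod.
  under [in RHS]eq_bigr do rewrite nE -addn1.
  rewrite big_split /= sum1_card card_ord.
  move=> h; apply/eqP; rewrite -(eqn_add2l (\sum_(i < s) mup (alpha i) f^`())) h /= subn1.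
  by rewrite -[X in (_ + X)%N](prednK (ltnW s_ge2)) addnS.
have kE j : (m j).+1 = mup (beta j) (f - f.[beta j]%:P).
  rewrite mE [RHS]mup_deriv ?derivB ?derivC ?subr0 // ?root_subC ?eqxx //.
  by rewrite -size_poly_gt0 size_subC // ltnW.
have sum_m1 : (\sum_(j < p) (m j).+1 = s + p - 1)%N.
  rewrite (eq_bigr (fun j => m j + 1)%N) => [|j _]; last by rewrite addn1.
  rewrite big_split /= sum_m sum1_card card_ord addnC addnBA ?(ltnW s_ge2) //.
  by rewrite addnC.
have cardE : (#|{: E}| = \sum_(j < p) (m j).+1)%N.
  rewrite card_tagged sumnE big_map big_enum /=.
  by apply: eq_bigr => j _; rewrite card_ord.
split=> //.
(* Distinct vertices are at distance at least [2 * r0], so a disc of radius [r < r0] about [beta j],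
   even closed, contains no other vertex. *)
have [r0 r00 far0] := seq_separated vs.
exists r0 => // r /andP[rpos rr0].
have far j z : stop f z -> z != beta j -> r < modulus (z - beta j).
  move=> sz zb; have := far0 z (beta j) (vsP z sz) _ zb.
  by move=> /(_ (vsP _ (or_intror (f'beta j)))); lra.
split=> [j|loc locP].
  exact: (exists_paths_in_disc sf fm (fbeta j) (kE j) rpos (far j)).
have iss j k : issued_in_disc f (beta j) r (loc j k) by have [/(_ k)[]] := locP j.
split=> [j k|gamma gammaP].
  split; first exact: (continuation_exists sf fm (fbeta j) ABstop (far j) (iss j k)).
  by move=> c d; exact: (continuation_unique sf (fbeta j) ABstop (iss j k)).
have ex e : exists q : R * (R -> R[i]), is_edge f (beta (tag e)) q.1 q.2 /\
    same_path (gamma e) (Curve 0 q.1 q.2).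
  have [T [L [eL sL]]] := continuation_is_edge ABstop (fbeta (tag e))
    (iss (tag e) (tagged e)) (gammaP e).
  by exists (T, L).
pose T e := (projT1 (cid (ex e))).1; pose L e := (projT1 (cid (ex e))).2.
have edge e : is_edge f (beta (tag e)) (T e) (L e) by rewrite /T /L; case: cid => ? [].
have canon e : same_path (gamma e) (Curve 0 (T e) (L e)).
  by rewrite /T /L; case: cid => ? [].
have lh e : lo (gamma e) < hi (gamma e) by case: (gammaP e) => [[]].
have T0 e : 0 < T e by case: (edge e) => /andP[].
have src e : source (gamma e) = beta (tag e).
  have [-> _] := same_path_ends (lh e) (canon e); rewrite /source /=.
  by case: (edge e).
have edge_inj e e' t : beta (tag e) = beta (tag e') -> 0 < t < T e -> t < T e' ->
    L e t = L e' t -> e = e'.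
  (* Once the tags are identified, [k] and [k'] index the same family of local paths. *)
  case: e e' => j k [j' k'] /= /beta_inj jj; case: _ / jj k' => k' tT tT' LL.
  congr (existT _ j _).
  exact: (continuation_inj sf (fbeta j) ABstop (locP j) (gammaP (existT _ j k))
    (gammaP (existT _ j k')) (edge (existT _ j k)) (edge (existT _ j k'))
    (canon _) (canon _) tT tT' LL).
split=> //.
- move=> e e' see'.
  have bb : beta (tag e) = beta (tag e').
    by rewrite -!src; have [] := same_path_ends (lh e) see'.
  have s1 := same_path_trans (same_path_sym (lh e) (canon e))
    (same_path_trans see' (canon e')).
  have [_ lL _ _ _] := edge e; have [_ lL' _ _ _] := edge e'; rewrite -bb in lL'.
  have [TT LL] := same_path_lifts (fbeta _) (T0 e) lL lL' s1.
  have Te := T0 e.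
  by apply: (edge_inj e e' (T e / 2)) => //; [lra|rewrite -TT; lra|apply: LL; lra].
- move=> e e' ee'.
  apply: (meet_only_at_ends_same_path (lh e) (lh e') (canon e) (canon e')).
  apply: (edges_meet_only_at_ends sf (fbeta (tag e)) (fbeta (tag e'))) => //.
  by move=> t bb tT tT' LL; apply: ee'; exact: (edge_inj e e' t).
have tgt_ex e : exists v, vertex alpha beta v = target (gamma e).
  by case: (gammaP e) => _ _ _ [v _ vE]; exists v.
pose tgt e := projT1 (cid (tgt_ex e)).
have tgtE e : target (gamma e) = vertex alpha beta (tgt e) by rewrite /tgt; case: cid.
exists tgt => //.
pose adj := Defs.adjacent (fun e : E => inr (tag e)) tgt.
(* There are s + p vertices and s + p - 1 edges; connectedness remains. *)
apply: tree_of_card; last first.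
  rewrite card_sum !card_ord cardE sum_m1 subn1 prednK //.
  by rewrite addn_gt0 (ltnW s_ge2).
have adj_sym : connect_sym adj.
  by apply: sym_connect_sym => x y; apply: eq_existsb => e; rewrite /joins orbC.
(* Equality is added to make the relation reflexive at points that are not vertices; transitivity
   uses that [vertex] is injective. *)
pose K x y := x = y \/ exists v v',
  [/\ vertex alpha beta v = x, vertex alpha beta v' = y & connect adj v v'].
have eK : edge_equivalence f K.
  split.
  - by move=> x; left.
  - move=> x y [->|[v [v' [vx vy c]]]]; [by left|right].
    by exists v', v; split=> //; rewrite adj_sym.
  - move=> y x z [->//|[v [v' [vx vy c]]]] [<-|[u [u' [uy uz c']]]]; right.
      by exists v, v'.
    exists v, u'; split=> //; apply: connect_trans c _.
    by rewrite (_ : v' = u) //; apply: vinj; rewrite vy uy.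
  - move=> z U M fz f'z eM; have /ABstop[[i|j] _ /= jz] : stop f z by right.
      by move: fz; rewrite (proj2 (rootf z)) ?eqxx //; exists i.
    rewrite -jz in eM *.
    (* The edge ends where some [gamma] with source [beta j] ends, so its two ends are adjacent in
       the graph. *)
    have [k kP] := edge_is_continuation sf (fbeta j) ABstop rpos (locP j) eM.
    have := kP _ (gammaP (existT _ j k)); rewrite tgtE => <-.
    right; exists (inr j), (tgt (existT _ j k)); split=> //.
    apply: connect1; apply/existsP; exists (existT _ j k).
    by rewrite /joins /= !eqxx.
move=> x y; have sv v : stop f (vertex alpha beta v) by apply/ABstop; exists v.
have [/vinj ->|[v [v' [/vinj -> /vinj -> //]]]] :=
  stops_equivalent sf fm eK (sv x) (sv y).
exact: connect0.
Qed.
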